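(* Let $T\ge 2$ be an integer, $\mathcal{T}=\{1,\dots,T\}$, and consider the general model described in the context. Then: (i) For each $t\in\mathcal{T}$ with $t\le T-1$, as $\alpha\to\infty$, $$\widehat{f}_{t}:=\frac{\sum_{i=1}^{T-t}C^{\alpha}_{i,t+1}}{\sum_{i=1}^{T-t}C^{\alpha}_{i,t}}\xrightarrow{\text{a.s.}} \frac{\operatorname{E}[ZI\{D\le t+1\}]}{\operatorname{E}[ZI\{D\le t\}]}=:f_{t}.$$ (ii) For each $i\in\mathcal{T}$ with $i\ge 2$, as $\alpha\to\infty$, $$\frac{C^{\alpha}_{i,T-i+1}\prod_{t=T-i+1}^{T-1}\widehat{f}_t}{C^{\alpha}_{i,T}}\xrightarrow{\text{a.s.}} 1.$$ (iii) For each $t\in\mathcal{T}$ with $t\le T-2$, as $\alpha\to\infty$, $$\widehat{\sigma}^2_{t}:=\frac{1}{T-t-1}\sum_{i=1}^{T-t}C^{\alpha}_{i,t}\bigg(\frac{C^{\alpha}_{i,t+1}}{C^{\alpha}_{i,t}}-\widehat{f}_{t}\bigg)^2\xrightarrow{d}\sigma^2_t\,\frac{\chi^2_{T-t-1}}{T-t-1},$$ where $\chi^2_\nu$ denotes a random variable with a chi-squared distribution with $\nu$ degrees of freedom and $$\sigma^2_t=(f_t-1)\bigg(\frac{\operatorname{E}[Z^2I\{D=t+1\}]}{\operatorname{E}[ZI\{D=t+1\}]}+(f_t-1)\frac{\operatorname{E}[Z^2I\{D\le t\}]}{\operatorname{E}[ZI\{D\le t\}]}\bigg).$$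
   Context: General model. Fix an integer $T\ge2$ and $\mathcal{T}=\{1,\dots,T\}$ (accident years $i$ and development years $t$). For each $i\in\mathcal{T}$ there is a family of nonnegative integer-valued random variables $(M^{\alpha}_i)_{\alpha\ge0}$ (number of claims of accident year $i$ at exposure $\alpha$) and a sequence of random pairs $(D_{i,k},Z_{i,k})_{k\ge1}$ with $D_{i,k}\in\mathcal{T}$ (development year) and $Z_{i,k}$ real (claim size). Define, for $i,t\in\mathcal{T}$, $$C^{\alpha}_{i,t}=\sum_{k=1}^{M^{\alpha}_i}Z_{i,k}I\{D_{i,k}\le t\}.$$ Assumptions: (GM1) for each $i$, $(D_{i,k},Z_{i,k})_{k\ge1}$ is i.i.d., and the common distribution does not depend on $i$; with $(D,Z)$ a generic pair with this distribution, $\operatorname{E}[Z^2]<\infty$ and $\operatorname{E}[ZI\{D=t\}]>0$ for each $t\in\mathcal{T}$. (GM2) For each $i$, $(D_{i,k},Z_{i,k})_{k\ge1}$ is independent of $(M^{\alpha}_i)_{\alpha\ge 0}$. (GM3) The families $\{(M^{\alpha}_i)_{\alpha},(D_{i,k},Z_{i,k})_{k\ge1}\}$, $i=1,\dots,T$, are independent. (GM4) For each $i$ there is $\lambda_i\in(0,\infty)$ with $M^{\alpha}_i/\alpha\to\lambda_i$ almost surely as $\alpha\to\infty$. $I\{\cdot\}$ denotes an indicator. The components $D$ and $Z$ may be dependent. *)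

(* Defs.v *)
From HB Require Import structures.
From mathcomp Require Import all_boot all_order all_algebra.
From mathcomp Require Import all_classical all_reals all_analysis.
Set Implicit Arguments. Unset Strict Implicit. Unset Printing Implicit Defensive.
Import Order.TTheory GRing.Theory Num.Theory numFieldNormedType.Exports.
Local Open Scope classical_set_scope.
Local Open Scope ring_scope.

Section defs.
Context {d : measure_display} {Omega : measurableType d} {R : realType}.

Definition sigma_of {d' : measure_display} {T : measurableType d'}
  (X : Omega -> T) : set (set Omega) :=
  [set A | exists2 B : set T, measurable B & A = X @^-1` B].

Definition mutually_independent (P : probability Omega R) (I : eqType)
  (K : set I) (F : I -> set (set Omega)) : Prop :=
  forall (J : seq I) (A : I -> set Omega),
    uniq J -> (forall j, j \in J -> K j) ->
    (forall j, j \in J -> F j (A j)) ->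
    P (\bigcap_(j in [set` J]) A j) = (\prod_(j <- J) P (A j))%E.

Definition C (M : nat -> R -> Omega -> nat) (D : nat -> nat -> Omega -> nat)
  (Z : nat -> nat -> Omega -> R) (a : R) (i t : nat) (w : Omega) : R :=
  \sum_(1 <= k < (M i a w).+1) Z i k w * ((D i k w <= t)%N)%:R.

Definition chisq_density (nu : nat) (y : R) : R :=
  y `^ (nu%:R / 2 - 1) * expR (- (y / 2)).

Definition chisq_prob (nu : nat) (A : set R) : R :=
  fine (\int[@lebesgue_measure R]_(y in A `&` `]0, +oo[%classic)
          (chisq_density nu y)%:E)
  / fine (\int[@lebesgue_measure R]_(y in `]0, +oo[%classic)
          (chisq_density nu y)%:E).

Definition cvg_in_distribution (P : probability Omega R)
  (X : R -> Omega -> R) (F : R -> R) : Prop :=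
  forall x : R, {for x, continuous F} ->
    fine (P [set w | X a w <= x]) @[a --> +oo] --> F x.

End defs.

(* Main.v *)
(* Parts (i) and (ii) follow from the strong law of large numbers for the random sums
   C_{i,t}. For (iii), S_i = C_{i,t+1} - f_t C_{i,t} is a sum of M_i centred i.i.d. terms and
   the estimator is, up to the factor 1/(T-t-1), the quadratic form
   sum_i S_i^2 / C_{i,t} - (sum_i S_i)^2 / (sum_i C_{i,t}). Chebyshev's inequality,
   conditionally on M_i, and the law of large numbers allow to replace M_i by a
   deterministic index and C_{i,t} by its mean. The normal law is never introduced:
   by Lindeberg's telescoping along the heat flow, a normalised row sum acts on the functions
   exp(- a (x + m)^2) asymptotically like the heat flow at time 1, uniformly in m and in
   bounded a. Integrating the rows out one after the other gives the limit
   (1 + 2 theta)^(-(T-t-1)/2) of the Laplace transform of the quadratic form, which is that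
   of the chi-squared law; Bernstein polynomials in exp(-Q) turn this into convergence of
   the distribution functions. *)
Require Import Defs.
From HB Require Import structures.
From mathcomp Require Import all_boot all_order all_algebra.
From mathcomp Require Import all_classical all_reals all_analysis.
From mathcomp Require Import measurable_realfun zify ring lra.
Set Implicit Arguments. Unset Strict Implicit. Unset Printing Implicit Defensive.
Import Order.TTheory GRing.Theory Num.Theory numFieldNormedType.Exports.
Local Open Scope classical_set_scope.
Local Open Scope ring_scope.

(** * Independence *)

(** The subtracted square couples all rows, so no row can be treated by itself. Since the weights
    [u] have norm 1, the form is the squared length of a projection that kills the direction [u]:
    its matrix is degenerate and exactly one degree of freedom is lost. This is why the rows are
    eliminated one at a time inside the Laplace transform. Conditionally on the earlier rows, the
    last one enters through a function [exp (- a (x + m)^2)] whose centre [m] is random; hence the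
    need for a limit theorem uniform in [m]. This family is stable under Gaussian smoothing up to a
    factor, so every limit is explicit and the heat equation replaces integrals against a normal
    density. The form is nonnegative, so [exp (-Q)] lies in [[0, 1]] and the Laplace transform at
    integers gives its moments, which determine the limit law. Independence of [M_i] from the claims
    allows a second moment computation for the random index instead of a maximal inequality. The
    variance per claim of [S_i], divided by [E[Z I{D <= t}]], is [sigma_t^2]. *)

Section independence.
Context {d : measure_display} {Omega : measurableType d} {R : realType}
  (P : probability Omega R).

Lemma setI_closed_sigma_of (d' : measure_display) (T : measurableType d')
  (X : Omega -> T) : setI_closed (sigma_of X).
Proof.
move=> _ _ [A mA ->] [B mB ->]; exists (A `&` B); first exact: measurableI.
by rewrite preimage_setI.
Qed.

Lemma sigma_ofT (d' : measure_display) (T : measurableType d')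
  (X : Omega -> T) : sigma_of X setT.
Proof. by exists setT. Qed.

Lemma sigma_of_measurable (d' : measure_display) (T : measurableType d')
  (X : Omega -> T) : measurable_fun setT X -> sigma_of X `<=` measurable.
Proof. by move=> mX _ [A mA ->]; rewrite -[X in measurable X]setTI; exact: mX. Qed.

(** Dynkin's argument: with [B] fixed, the measurable sets obeying the product rule form a
    lambda-system, and it contains the pi-system [G]. *)
Lemma indep_g_sigma_algebra (G : set (set Omega)) (B : set Omega) :
  setI_closed G -> G `<=` measurable -> measurable B ->
  (forall A, G A -> P (A `&` B) = (P A * P B)%E) ->
  forall A, <<s G >> A -> P (A `&` B) = (P A * P B)%E.
Proof.
move=> GI Gm mB GB.
pose H : set (set Omega) :=
  [set A | measurable A /\ P (A `&` B) = (P A * P B)%E].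
suff sub : <<s G >> `<=` H by move=> A /sub[].
apply: lambda_system_subset => //; last first.
- by move=> A GA; split; [exact: Gm|exact: GB].
- apply/dynkin_lambda_system; split.
  + by split; [exact: measurableT|rewrite setTI probability_setT mul1e].
  + move=> A [mA AB]; split; first exact: measurableC.
    have -> : P (~` A `&` B) = (P B - P A * P B)%E.
      rewrite setIC -setDE measureD //; last by rewrite ltey_eq fin_num_measure.
      by congr (_ - _)%E; rewrite setIC; exact: AB.
    by rewrite probability_setC // muleBl ?fin_num_measure // mul1e.
  + move=> F tF FH; split.
      by apply: bigcup_measurable => k _; have [] := FH k.
    rewrite setI_bigcupl !measure_bigcup //; last 3 first.
    * by move=> k _; have [] := FH k.
    * by move=> k _; apply: measurableI => //; have [] := FH k.
    * by apply: trivIset_setIr.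
    rewrite muleC.
    have /fineK PB : P B \is a fin_num by rewrite fin_num_measure.
    rewrite -PB -nneseriesZl //.
    apply: eq_eseriesr => k _; have [_] := FH k.
    by rewrite PB muleC; exact.
Qed.

(* The union over K of the families F is generated by the pi-system of the finite
   intersections, which are coded with total choices of sets so that two of them
   can be intersected pointwise. *)
Definition finite_cylinders (I : eqType) (K : set I) (F : I -> set (set Omega)) :
    set (set Omega) :=
  [set S | exists (J : seq I) (A : I -> set Omega),
     [/\ uniq J, (forall j, j \in J -> K j), (forall j, j \in J -> F j (A j)),
         (forall j, j \notin J -> A j = setT) &
         S = \bigcap_(j in [set` J]) A j]].

Lemma setI_closed_finite_cylinders (I : eqType) (K : set I)
    (F : I -> set (set Omega)) :
  (forall i, K i -> setI_closed (F i)) -> (forall i, K i -> F i setT) ->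
  setI_closed (finite_cylinders K F).
Proof.
move=> FI FT _ _ [J [A [uJ JK FA AT ->]]] [J' [A' [uJ' JK' FA' AT' ->]]].
exists (undup (J ++ J')), (fun j => A j `&` A' j).
have hK j : j \in undup (J ++ J') -> K j.
  by rewrite mem_undup mem_cat => /orP[/JK|/JK'].
split.
- exact: undup_uniq.
- exact: hK.
- move=> j jJ; apply: FI; first exact: hK.
  + by have [/FA//|/AT->] := boolP (j \in J); apply: FT; exact: hK.
  + by have [/FA'//|/AT'->] := boolP (j \in J'); apply: FT; exact: hK.
- move=> j; rewrite mem_undup mem_cat negb_or => /andP[/AT -> /AT' ->].
  by rewrite setTI.
- apply/seteqP; split.
  + move=> w [h h'] j _; split.
      by have [jJ|/AT ->//] := boolP (j \in J); exact: h.
    by have [jJ|/AT' ->//] := boolP (j \in J'); exact: h'.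
  + move=> w h; split => j jJ.
      by have [] := h j; rewrite //= mem_undup mem_cat jJ.
    by have [] := h j; rewrite //= mem_undup mem_cat jJ orbT.
Qed.

Lemma finite_cylinders_measurable (I : eqType) (K : set I)
    (F : I -> set (set Omega)) :
  (forall i, K i -> F i `<=` measurable) -> finite_cylinders K F `<=` measurable.
Proof.
move=> Fm _ [J [A [uJ JK FA AT ->]]].
apply: fin_bigcap_measurable; first exact: finite_seq.
by move=> j jJ; apply: (Fm j); [exact: JK|exact: FA].
Qed.

Lemma sub_finite_cylinders (I : eqType) (K : set I) (F : I -> set (set Omega)) :
  \bigcup_(i in K) F i `<=` finite_cylinders K F.
Proof.
move=> A [i Ki FA]; exists [:: i], (fun j => if j == i then A else setT).
split => //.
- by move=> j; rewrite inE => /eqP ->.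
- by move=> j; rewrite inE => /eqP ->; rewrite eqxx.
- by move=> j; rewrite inE => /negbTE ->.
- apply/seteqP; split => [w Aw j|w /(_ i)]; last by rewrite eqxx; apply; rewrite /= inE.
  by rewrite /= inE => ->.
Qed.

Lemma sub_g_sigma_algebra (G G' : set (set Omega)) :
  G `<=` G' -> <<s G >> `<=` <<s G' >>.
Proof. exact: sub_smallest2r. Qed.

Lemma g_sigma_algebra_measurable (G : set (set Omega)) :
  G `<=` measurable -> <<s G >> `<=` measurable.
Proof. by move=> Gm; apply: smallest_sub => //; exact: sigma_algebra_measurable. Qed.

(** On two cylinders the product rule is one instance of mutual independence, for the concatenated
    index list, whose two parts are disjoint. Two passes of [indep_g_sigma_algebra], one for each
    side, extend it to the generated sigma-algebras. *)
Lemma mutually_independent_group (I : eqType) (K K1 K2 : set I)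
    (F : I -> set (set Omega)) :
  mutually_independent P K F ->
  (forall i, K i -> F i `<=` measurable) ->
  (forall i, K i -> setI_closed (F i)) -> (forall i, K i -> F i setT) ->
  K1 `<=` K -> K2 `<=` K -> K1 `&` K2 = set0 ->
  forall A B, <<s \bigcup_(i in K1) F i >> A -> <<s \bigcup_(i in K2) F i >> B ->
  P (A `&` B) = (P A * P B)%E.
Proof.
move=> ind Fm FI FT K1K K2K K12 A B sA sB.
have m1 : finite_cylinders K1 F `<=` measurable.
  by apply: finite_cylinders_measurable => i /K1K; exact: Fm.
have m2 : finite_cylinders K2 F `<=` measurable.
  by apply: finite_cylinders_measurable => i /K2K; exact: Fm.
have c1 : setI_closed (finite_cylinders K1 F).
  by apply: setI_closed_finite_cylinders => i /K1K; [exact: FI|exact: FT].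
have c2 : setI_closed (finite_cylinders K2 F).
  by apply: setI_closed_finite_cylinders => i /K2K; [exact: FI|exact: FT].
have {}sA := sub_g_sigma_algebra (@sub_finite_cylinders _ K1 F) sA.
have {}sB := sub_g_sigma_algebra (@sub_finite_cylinders _ K2 F) sB.
have mA := g_sigma_algebra_measurable m1 sA.
rewrite setIC muleC.
move: B sB; apply: (indep_g_sigma_algebra c2 m2 mA) => B GB.
rewrite setIC muleC.
move: A sA {mA}; apply: (indep_g_sigma_algebra c1 m1 (m2 _ GB)) => A GA.
move: GA GB => [J [A1 [uJ JK FA AT ->]]] [J' [A' [uJ' JK' FA' AT' ->]]].
have dis j : j \in J -> j \notin J'.
  move=> jJ; apply/negP => jJ'; have : (K1 `&` K2) j by split; [exact: JK|exact: JK'].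
  by rewrite K12.
rewrite (ind J A1) //; last by move=> j /JK/K1K.
rewrite (ind J' A') //; last by move=> j /JK'/K2K.
(* One choice of sets serving both lists; they share no index, so on [J'] it agrees with [A']. *)
pose B1 j := if j \in J then A1 j else A' j.
have := ind (J ++ J') B1; rewrite big_cat /=.
have -> : (\prod_(i <- J) P (B1 i) = \prod_(j <- J) P (A1 j))%E.
  by apply: eq_big_seq => j jJ; rewrite /B1 jJ.
have -> : (\prod_(i <- J') P (B1 i) = \prod_(j <- J') P (A' j))%E.
  apply: eq_big_seq => j jJ; rewrite /B1; case: ifP => // jJ'.
  by have := dis _ jJ'; rewrite jJ.
move=> <-.
- congr (P _); apply/seteqP; split.
  + move=> w [h h'] j /=; rewrite mem_cat /B1; case: ifP => [jJ _|_]; first exact: h.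
    by move=> /= jJ'; exact: h'.
  + move=> w h; split => j jJ; have := h j.
      by rewrite /= mem_cat /B1 jJ; apply.
    rewrite /= mem_cat /B1 jJ orbT; case: ifP => [/dis|_]; first by rewrite jJ.
    by apply.
- rewrite cat_uniq uJ uJ' andbT /=; apply/hasPn => j jJ' /=.
  by apply/negP => /dis; rewrite jJ'.
- by move=> j; rewrite mem_cat => /orP[/JK/K1K|/JK'/K2K].
- move=> j; rewrite mem_cat /B1; case: ifP => [jJ _|_]; first exact: FA.
  by move=> /= /FA'.
Qed.

Definition independent_pair (d1 d2 : measure_display) (T1 : measurableType d1)
    (T2 : measurableType d2) (X : Omega -> T1) (Y : Omega -> T2) :=
  forall A B, measurable A -> measurable B ->
    P (X @^-1` A `&` Y @^-1` B) = (P (X @^-1` A) * P (Y @^-1` B))%E.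

(* Unlike integral_distribution, this does not ask for integrability. *)
Lemma integral_distributionT (d' : measure_display) (T : measurableType d')
    (X : {mfun Omega >-> T}) (f : T -> \bar R) :
  measurable_fun setT f ->
  (\int[distribution P X]_y f y = \int[P]_w f (X w))%E.
Proof.
move=> mf; rewrite integralE [RHS]integralE; congr (_ - _)%E.
  rewrite ge0_integral_distribution //; last exact: measurable_funepos.
  by apply: eq_integral => w _; rewrite -funepos_comp.
rewrite ge0_integral_distribution //; last exact: measurable_funeneg.
by apply: eq_integral => w _; rewrite -funeneg_comp.
Qed.

(** The law of the pair and the product of the two laws agree on rectangles, hence everywhere, and
    Fubini applies. [X] is integrated out with [Y] frozen, which amounts to conditioning on [Y]. *)
Lemma independent_pair_integral (d1 d2 : measure_display) (T1 : measurableType d1)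
    (T2 : measurableType d2) (X : Omega -> T1) (Y : Omega -> T2)
    (f : (T1 * T2)%type -> \bar R) :
  measurable_fun setT X -> measurable_fun setT Y -> independent_pair X Y ->
  measurable_fun setT f -> P.-integrable setT (fun w => f (X w, Y w)) ->
  (\int[P]_w f (X w, Y w) = \int[P]_w \int[P]_w' f (X w', Y w))%E /\
  measurable_fun setT (fun w => \int[P]_w' f (X w', Y w))%E.
Proof.
move=> mX mY ind mf intf.
pose X' : {mfun Omega >-> T1} := HB.pack X (isMeasurableFun.Build _ _ _ _ X mX).
pose Y' : {mfun Omega >-> T2} := HB.pack Y (isMeasurableFun.Build _ _ _ _ Y mY).
have mXY : measurable_fun setT (fun w => (X w, Y w)) by exact: measurable_fun_pair.
pose XY : {mfun Omega >-> (T1 * T2)%type} :=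
  HB.pack (fun w => (X w, Y w)) (isMeasurableFun.Build _ _ _ _ _ mXY).
pose m1 := distribution P X'. pose m2 := distribution P Y'.
have prodE : forall S, measurable S -> (m1 \x m2)%E S = distribution P XY S.
  apply: product_measure_unique => A B mA mB.
  by rewrite /m1 /m2 /distribution /pushforward /= -ind.
have intf' : (m1 \x m2)%E.-integrable setT f.
  have : (distribution P XY).-integrable setT f.
    by apply: (integrable_pushforward mXY) => //.
  move/integrableP => [_ h]; apply/integrableP; split => //.
  rewrite (eq_measure_integral (distribution P XY)) // => S mS _.
  exact: prodE.
have GE w : fubini_G m1 f (Y w) = (\int[P]_w' f (X w', Y w))%E.
  by apply: (@integral_distributionT _ _ X'); exact: measurableT_comp.
split; last first.
  under eq_fun do rewrite -GE.
  exact: (measurableT_comp (measurable_fubini_G intf') mY).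
transitivity (\int[distribution P XY]_z f z)%E; first by rewrite integral_distributionT.
transitivity (\int[(m1 \x m2)%E]_z f z)%E.
  by apply: eq_measure_integral => S mS _; exact/esym/prodE.
rewrite -integral21_prod_meas1 //.
transitivity (\int[P]_w fubini_G m1 f (Y w))%E.
  exact: (@integral_distributionT _ _ Y' _ (measurable_fubini_G intf')).
by apply: eq_integral => w _.
Qed.

End independence.

(** * Expectations and sums of orthogonal variables *)

Section expectation.
Context {d : measure_display} {Omega : measurableType d} {R : realType}
  (P : probability Omega R).
Local Notation rint X := (P.-integrable setT (EFin \o X)).
Implicit Types X Y : Omega -> R.

Lemma rint_measurable X : rint X -> measurable_fun setT X.
Proof. by move=> /measurable_int /measurable_EFinP. Qed.

Lemma rint_cst (c : R) : rint (fun=> c).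
Proof. exact: finite_measure_integrable_cst. Qed.

Lemma rint_le X Y : measurable_fun setT X -> (forall w, `|X w| <= Y w) -> rint Y -> rint X.
Proof.
move=> mX XY iY; apply: (le_integrable measurableT _ _ iY).
  exact/measurable_EFinP.
by move=> w _; rewrite /= lee_fin (le_trans (XY w)) // ler_norm.
Qed.

Lemma rint_bounded X (c : R) : measurable_fun setT X -> (forall w, `|X w| <= c) -> rint X.
Proof. by move=> mX Xc; apply: (rint_le mX Xc); exact: rint_cst. Qed.

Lemma rintD X Y : rint X -> rint Y -> rint (fun w => X w + Y w).
Proof. by move=> iX iY; exact: (integrableD measurableT iX iY). Qed.

Lemma rintZ (c : R) X : rint X -> rint (fun w => c * X w).
Proof. by move=> iX; exact: (integrableZl measurableT c iX). Qed.

Lemma rintB X Y : rint X -> rint Y -> rint (fun w => X w - Y w).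
Proof. by move=> iX iY; exact: (integrableB measurableT iX iY). Qed.

Lemma rint_sum (I : Type) (s : seq I) (Q : pred I) (F : I -> Omega -> R) :
  (forall i, Q i -> rint (F i)) -> rint (fun w => \sum_(i <- s | Q i) F i w).
Proof.
move=> iF; elim: s => [|i s IH].
  by under eq_fun do rewrite big_nil; exact: rint_cst.
have [Qi|nQi] := boolP (Q i).
  rewrite (_ : (fun w => _) = (fun w => F i w + \sum_(i <- s | Q i) F i w)).
    by apply: rintD => //; exact: iF.
  by apply/funext => w; rewrite big_cons Qi.
rewrite (_ : (fun w => _) = (fun w => \sum_(i <- s | Q i) F i w)) //.
by apply/funext => w; rewrite big_cons (negbTE nQi).
Qed.

Lemma expect_cst (c : R) : \int[P]_w c = c.
Proof. by rewrite Rintegral_cst // [X in fine X](_ : _ = 1%E) ?mulr1 //; exact: probability_setT. Qed.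

Lemma expectD X Y : rint X -> rint Y ->
  \int[P]_w (X w + Y w) = \int[P]_w X w + \int[P]_w Y w.
Proof. exact: RintegralD. Qed.

Lemma expectB X Y : rint X -> rint Y ->
  \int[P]_w (X w - Y w) = \int[P]_w X w - \int[P]_w Y w.
Proof. exact: RintegralB. Qed.

Lemma expectZ (c : R) X : rint X -> \int[P]_w (c * X w) = c * \int[P]_w X w.
Proof. exact: RintegralZl. Qed.

Lemma expect_le X Y : rint X -> rint Y -> (forall w, X w <= Y w) ->
  \int[P]_w X w <= \int[P]_w Y w.
Proof. by move=> iX iY XY; apply: le_Rintegral. Qed.

Lemma expect_norm X : rint X -> `|\int[P]_w X w| <= \int[P]_w `|X w|.
Proof. by move=> iX; exact: le_normr_Rintegral. Qed.

Lemma expect_sum (I : Type) (s : seq I) (Q : pred I) (F : I -> Omega -> R) :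
  (forall i, Q i -> rint (F i)) ->
  \int[P]_w (\sum_(i <- s | Q i) F i w) = \sum_(i <- s | Q i) \int[P]_w F i w.
Proof.
move=> iF; elim: s => [|i s IH].
  by under eq_Rintegral do rewrite big_nil; rewrite expect_cst big_nil.
have [Qi|nQi] := boolP (Q i); rewrite big_cons ?Qi ?(negbTE nQi) -IH.
  rewrite -expectD ?IH //; [|exact: iF|exact: rint_sum].
  by apply: eq_Rintegral => w _; rewrite big_cons Qi.
by apply: eq_Rintegral => w _; rewrite big_cons (negbTE nQi).
Qed.

Lemma EFin_expect X : rint X -> (\int[P]_w (X w)%:E = (\int[P]_w X w)%:E)%E.
Proof. by move=> iX; rewrite fineK //; exact: integrable_fin_num. Qed.

Definition sqint X := measurable_fun setT X /\ rint (fun w => X w ^+ 2).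

Lemma sqint_cst (c : R) : sqint (fun=> c).
Proof. by split; [exact: measurable_cst|exact: rint_cst]. Qed.

Lemma sqint_mul X Y : sqint X -> sqint Y -> rint (fun w => X w * Y w).
Proof.
move=> [mX iX] [mY iY].
apply: (@rint_le _ (fun w => X w ^+ 2 + Y w ^+ 2)); last exact: rintD.
  exact: measurable_funM.
move=> w; rewrite normrM -[X w ^+ 2]real_normK ?num_real // -[Y w ^+ 2]real_normK ?num_real //.
by have := normr_ge0 (X w); have := normr_ge0 (Y w); nra.
Qed.

Lemma sqint_rint X : sqint X -> rint X.
Proof.
move=> sX; have := sqint_mul sX (sqint_cst 1).
by under eq_fun do rewrite mulr1.
Qed.

Lemma sqintD X Y : sqint X -> sqint Y -> sqint (fun w => X w + Y w).
Proof.
move=> sX sY; have iXY := sqint_mul sX sY; move: sX sY => [mX iX] [mY iY].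
split; first exact: measurable_funD.
have := rintD (rintD iX iY) (rintZ 2 iXY); congr (P.-integrable _ _).
by apply/funext => w /=; congr (_%:E); ring.
Qed.

Lemma sqintZ (c : R) X : sqint X -> sqint (fun w => c * X w).
Proof.
move=> [mX iX]; split; first exact: measurable_funM.
by have := rintZ (c ^+ 2) iX; under eq_fun do rewrite -exprMn.
Qed.

Lemma sqint_sum (I : Type) (s : seq I) (F : I -> Omega -> R) :
  (forall i, sqint (F i)) -> sqint (fun w => \sum_(i <- s) F i w).
Proof.
move=> iF; elim: s => [|i s IH].
  by under eq_fun do rewrite big_nil; exact: sqint_cst.
by under eq_fun do rewrite big_cons; exact: sqintD.
Qed.

(** Conditioning on [Y] for bounded integrands. Integrability of the inner expectation is part of
    the conclusion because other integrable functions are later subtracted from it. *)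
Lemma independent_pair_expect (d1 d2 : measure_display) (T1 : measurableType d1)
    (T2 : measurableType d2) (X : Omega -> T1) (Y : Omega -> T2) (f : T1 * T2 -> R) (c : R) :
  measurable_fun setT X -> measurable_fun setT Y -> independent_pair P X Y ->
  measurable_fun setT f -> (forall z, `|f z| <= c) ->
  rint (fun w => \int[P]_w' f (X w', Y w)) /\
  \int[P]_w f (X w, Y w) = \int[P]_w \int[P]_w' f (X w', Y w).
Proof.
move=> mX mY ind mf fc.
have mF : measurable_fun setT (EFin \o f) by exact/measurable_EFinP.
have mXY : measurable_fun setT (fun w => (X w, Y w)) by exact: measurable_fun_pair.
have iXY : rint (fun w => f (X w, Y w)).
  by apply: (@rint_bounded _ c) => //; exact: (measurableT_comp mf mXY).
have iY w : rint (fun w' => f (X w', Y w)).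
  apply: (@rint_bounded _ c) => //.
  by apply: (measurableT_comp mf); exact: measurable_fun_pair.
have [eqf mG] := independent_pair_integral mX mY ind mF iXY.
have inner w : (\int[P]_w' (EFin \o f) (X w', Y w) = (\int[P]_w' f (X w', Y w))%:E)%E.
  exact: EFin_expect.
have iG : rint (fun w => \int[P]_w' f (X w', Y w)).
  apply: (@rint_bounded _ c).
    by apply/measurable_EFinP; rewrite (_ : EFin \o _ = (fun w => \int[P]_w' (EFin \o f) (X w', Y w))%E) //;
      apply/funext => w; rewrite inner.
  move=> w; apply: le_trans (expect_norm (iY w)) _.
  rewrite -[leRHS]expect_cst; apply: expect_le => //; last exact: rint_cst.
  exact: integrable_norm.
split=> //; rewrite /Rintegral; congr fine; rewrite eqf.
by apply: eq_integral => w _; rewrite inner.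
Qed.

Lemma rint_indic (A : set Omega) : measurable A -> rint \1_A.
Proof. exact: integrable_indic. Qed.

Lemma expect_indic (A : set Omega) : measurable A ->
  \int[P]_w (\1_A w) = fine (P A).
Proof. by move=> mA; rewrite /Rintegral integral_indic // setIT. Qed.

Lemma chebyshev_sq X (e : R) : sqint X -> 0 < e ->
  fine (P [set w | e <= `|X w|]) <= \int[P]_w (X w ^+ 2) / e ^+ 2.
Proof.
move=> [mX iX] e0; set A := [set w | _].
have mA : measurable A.
  by rewrite /A -[X in measurable X]setTI; apply: measurable_fun_le => //; exact: measurableT_comp.
rewrite ler_pdivlMr ?exprn_gt0 // mulrC -expect_indic // -expectZ; last exact: rint_indic.
apply: expect_le => //; first by apply: rintZ; exact: rint_indic.
move=> w; rewrite indicE; have [/set_mem Aw|_] := boolP (w \in A); last first.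
  by rewrite mulr0 sqr_ge0.
by rewrite mulr1 -[X w ^+ 2]real_normK ?num_real // lerXn2r // nnegrE ltW.
Qed.

(** By Tonelli the series of the [Y k] has expectation at most [B], so it is finite almost
    everywhere and its terms, bounded by its tails, tend to 0. *)
Lemma ae_cvg0_summable (Y : nat -> Omega -> R) (c : nat -> R) (B : R) :
  (forall k w, 0 <= Y k w) -> (forall k, rint (Y k)) ->
  (forall k, \int[P]_w (Y k w) <= c k) -> (forall n, \sum_(0 <= k < n) c k <= B) ->
  {ae P, forall w, Y k w @[k --> \oo] --> 0}.
Proof.
move=> Y0 iY Yc cB.
pose f k w := (Y k w)%:E.
have mf k : measurable_fun setT (f k) by exact: measurable_int (iY k).
have f0 k w : (0 <= f k w)%E by rewrite lee_fin.
have int_f : (\int[P]_w (\sum_(k <oo) f k w) <= B%:E)%E.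
  rewrite integral_nneseries //; apply: lime_le; first by apply: is_cvg_nneseries => *; exact: integral_ge0.
  apply: nearW => n; apply: le_trans (_ : ((\sum_(0 <= k < n) c k)%:E <= _)%E); last by rewrite lee_fin.
  rewrite -sumEFin; apply: lee_sum => k _.
  by rewrite EFin_expect // lee_fin.
have iS : P.-integrable setT (fun w => \sum_(k <oo) f k w)%E.
  apply/integrableP; split; first exact: ge0_emeasurable_sum.
  under eq_integral do rewrite gee0_abs ?nneseries_ge0 //.
  by rewrite (le_lt_trans int_f) // ltry.
have := integrable_ae measurableT iS.
apply: filterS => w /(_ I) fin.
have lty : (\sum_(k <oo) f k w < +oo)%E by rewrite ltey_eq fin.
have := nneseries_tail_cvg lty (fun k _ => f0 k w).
move=> tail.
have : (f k w @[k --> \oo] --> 0)%E.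
  apply: (squeeze_cvge _ (cvg_cst _) tail); apply: nearW => k; rewrite f0 /=.
  apply: le_trans (nneseries_lim_ge k.+1 _); last by move=> *; exact: f0.
  by rewrite big_nat1.
exact: fine_cvg.
Qed.

(* Only the orthogonality of the increments matters for this law of large numbers. *)
Section orthogonal_sums.
Variables (xi : nat -> Omega -> R) (v : R).
Hypothesis xi2 : forall k, sqint (xi k).
Hypothesis xi_orth : forall j k, j != k -> \int[P]_w (xi j w * xi k w) = 0.
Hypothesis xi_var : forall k, \int[P]_w (xi k w ^+ 2) <= v.

Let S n w := \sum_(1 <= k < n.+1) xi k w.

(** Pythagoras, one increment at a time: each new increment is orthogonal to the sum of the previous
    ones. *)
Lemma orthogonal_block_sum m n :
  \int[P]_w ((\sum_(m <= k < n) xi k w) ^+ 2) <= (n - m)%:R * v.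
Proof.
have [mn|/ltnW] := leqP m n; last first.
  move=> nm; under eq_Rintegral do rewrite big_geq // expr0n /=.
  by rewrite expect_cst (eqP nm) mul0r.
rewrite -{1}(subnKC mn); elim: (n - m)%N => [|k IH].
  under eq_Rintegral do rewrite addn0 big_geq // expr0n /=.
  by rewrite expect_cst mul0r.
set T := fun w => \sum_(m <= i < m + k) xi i w.
have sT : sqint T by apply: sqint_sum.
have -> : (fun w => (\sum_(m <= i < m + k.+1) xi i w) ^+ 2) =
          (fun w => T w ^+ 2 + 2 * (T w * xi (m + k) w) + xi (m + k) w ^+ 2).
  apply/funext => w; rewrite addnS big_nat_recr ?leq_addr //= -/(T w); ring.
have iTx := sqint_mul sT (xi2 (m + k)).
rewrite expectD; [|apply: rintD; [exact: sT.2|exact: rintZ]|exact: (xi2 _).2].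
rewrite expectD; [|exact: sT.2|exact: rintZ].
rewrite expectZ //.
have -> : \int[P]_w (T w * xi (m + k) w) = 0.
  under eq_Rintegral do rewrite mulr_suml.
  rewrite expect_sum; last by move=> i _; exact: sqint_mul.
  rewrite big_nat big1 // => i /andP[_ ik]; apply: xi_orth.
  by rewrite ltn_eqF.
rewrite mulr0 addr0 -natr1 mulrDl mul1r; exact: lerD.
Qed.

Let sq n : exists k, (k ^ 2 <= n < k.+1 ^ 2)%N.
Proof.
elim: n => [|n [k /andP[kn nk]]]; first by exists 0%N.
have [h|h] := ltnP n.+1 (k.+1 ^ 2); first by exists k; rewrite h (leq_trans kn).
exists k.+1; rewrite h /= (leq_ltn_trans nk) // ltn_sqr //.
Qed.

(** Subsequence method along squares. The first term is the squared average at the index [(k+1)^2];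
    the second dominates every increment from there up to [(k+2)^2], a maximum being crudely bounded
    by a sum. *)
Let Y k w := (\sum_(1 <= i < (k.+1 ^ 2).+1) xi i w) ^+ 2 / (k.+1)%:R ^+ 4 +
  \sum_(k.+1 ^ 2 <= n < k.+2 ^ 2)
    (\sum_((k.+1 ^ 2).+1 <= i < n.+1) xi i w) ^+ 2 / (k.+1)%:R ^+ 4.

Lemma orthogonal_lln :
  {ae P, forall w, (\sum_(1 <= k < n.+1) xi k w) / n%:R @[n --> \oo] --> 0}.
Proof.
have v0 : 0 <= v.
  apply: le_trans (xi_var 0); apply: Rintegral_ge0 => w _; exact: sqr_ge0.
have iterm a b (x : R) : rint (fun w => (\sum_(a <= i < b) xi i w) ^+ 2 / x).
  under eq_fun do rewrite mulrC.
  by apply: rintZ; exact: (sqint_sum _ xi2).2.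
have iY k : rint (Y k).
  by apply: rintD => //; exact: rint_sum.
have Y0 k w : 0 <= Y k w.
  apply: addr_ge0; first by rewrite divr_ge0 ?sqr_ge0 ?exprn_ge0.
  by apply: sumr_ge0 => n _; rewrite divr_ge0 ?sqr_ge0 ?exprn_ge0.
(* With [K = k + 1], the block holds [2K + 1] indices whose increments have at most [2K] terms,
   which gives [v (5K + 2) / K^3]. The constant 20 is generous (14 would do), and the right-hand
   side telescopes. *)
have EYn k : \int[P]_w Y k w <= 20 * v * ((k.+1)%:R^-1 - (k.+2)%:R^-1).
  rewrite /Y expectD //; last exact: rint_sum.
  rewrite expect_sum //.
  have block a b (x : R) : 0 <= x ->
      \int[P]_w ((\sum_(a <= i < b) xi i w) ^+ 2 / x) <= (b - a)%:R * v / x.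
    move=> x0; under eq_Rintegral do rewrite mulrC.
    rewrite expectZ; last exact: (sqint_sum _ xi2).2.
    by rewrite mulrC ler_wpM2r ?invr_ge0 //; exact: orthogonal_block_sum.
  set K : R := (k.+1)%:R.
  have K1 : 1 <= K by rewrite ler1n.
  have K4 : 0 <= K ^+ 4 by rewrite exprn_ge0 // (le_trans ler01).
  apply: (@le_trans _ _ (K ^+ 2 * v / K ^+ 4 + (2 * K + 1) * ((2 * K) * v / K ^+ 4))).
    apply: lerD.
      by apply: le_trans (block _ _ _ K4) _; rewrite subSS subn0 natrX.
    apply: (@le_trans _ _ (\sum_(k.+1 ^ 2 <= n < k.+2 ^ 2) (2 * K * v / K ^+ 4))).
      rewrite big_nat [leRHS]big_nat; apply: ler_sum => n /andP[_ nk].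
      apply: le_trans (block _ _ _ K4) _; rewrite !ler_wpM2r ?invr_ge0 //.
      rewrite -natrM ler_nat subSS; move: nk; rewrite -!mulnn; lia.
    rewrite sumr_const_nat -[X in X <= _]mulr_natl ler_wpM2r //.
      by rewrite divr_ge0 // mulr_ge0 // mulr_ge0 // (le_trans ler01).
    by rewrite /K -natrM natr1 ler_nat -!mulnn; lia.
  have -> : (k.+2)%:R = K + 1 :> R by rewrite /K -natr1.
  have K0 : 0 < K by exact: lt_le_trans K1.
  have -> : K^-1 - (K + 1)^-1 = (K * (K + 1))^-1.
    by field; rewrite !gt_eqF // ltr_wpDl // ltW.
  have -> : K ^+ 2 * v / K ^+ 4 + (2 * K + 1) * (2 * K * v / K ^+ 4)
          = v * (5 * K + 2) / K ^+ 3 by field; rewrite gt_eqF.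
  have K10 : 0 < K + 1 by rewrite ltr_wpDl // ltW.
  rewrite ler_pdivrMr ?exprn_gt0 //.
  have -> : 20 * v / (K * (K + 1)) * K ^+ 3 = v * (20 * K ^+ 2 / (K + 1)).
    by field; rewrite gt_eqF // gt_eqF.
  rewrite ler_wpM2l // ler_pdivlMr //; nra.
have : {ae P, forall w, Y k w @[k --> \oo] --> 0}.
  apply: (ae_cvg0_summable Y0 iY EYn (B := 20 * v)) => n.
  rewrite -mulr_sumr ler_piMr ?mulr_ge0 //.
  under eq_bigr do rewrite -opprB.
  rewrite sumrN telescope_sumr // opprB invr1 gerBl invr_ge0 //.
apply: filterS => w Yw.
(* [(a + b)^2 <= 2 a^2 + 2 b^2], and [n >= (k+1)^2] replaces the denominator; the increment [b] at
   [n] is one summand of the second term of [Y]. *)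
have key n k : (k.+1 ^ 2 <= n < k.+2 ^ 2)%N ->
    ((\sum_(1 <= i < n.+1) xi i w) / n%:R) ^+ 2 <= 2 * Y k w.
  move=> /andP[kn nk]; set K : R := (k.+1)%:R.
  have K0 : 0 < K by rewrite ltr0n.
  have n0 : 0 < n%:R :> R by rewrite ltr0n (leq_trans _ kn) // expn_gt0.
  rewrite (big_cat_nat (n := (k.+1 ^ 2).+1)) //=.
  set a := \sum_(1 <= i < (k.+1 ^ 2).+1) xi i w.
  set b := \sum_((k.+1 ^ 2).+1 <= i < n.+1) xi i w.
  have bY : b ^+ 2 / K ^+ 4 <= \sum_(k.+1 ^ 2 <= m < k.+2 ^ 2)
      (\sum_((k.+1 ^ 2).+1 <= i < m.+1) xi i w) ^+ 2 / K ^+ 4.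
    rewrite (bigD1_seq n) ?iota_uniq //= ?mem_index_iota ?kn //.
    rewrite -/b lerDl; apply: sumr_ge0 => i _.
    by rewrite divr_ge0 ?sqr_ge0 // exprn_ge0 // ltW.
  apply: (@le_trans _ _ (2 * (a ^+ 2 / K ^+ 4 + b ^+ 2 / K ^+ 4))); last first.
    by rewrite ler_pM2l // lerD2l.
  rewrite -mulrDl mulrA expr_div_n ler_pM ?sqr_ge0 ?invr_ge0 ?sqr_ge0 //.
    have := sqr_ge0 (a - b); nra.
  rewrite lef_pV2 ?posrE ?exprn_gt0 // (_ : K ^+ 4 = (K ^+ 2) ^+ 2); last by rewrite -exprM.
  apply: lerXn2r; rewrite ?nnegrE ?exprn_ge0 ?(ltW K0) ?(ltW n0) //.
  by rewrite /K -natrX ler_nat.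
apply/cvgrPdist_lt => e e0.
move/cvgrPdist_lt : Yw => /(_ (e ^+ 2 / 2)) []; first by rewrite divr_gt0 ?exprn_gt0.
(* Past [(N+1)^2] the integer square root of [n] exceeds [N]; the shift by one reflects that [Y k]
   describes the block starting at [(k+1)^2]. *)
move=> N _ NY; exists (N.+1 ^ 2)%N => // n /= Nn.
have [k /andP[kn nk]] := sq n.
have Nk : (N < k)%N.
  by rewrite -ltnS -ltn_sqr; exact: leq_ltn_trans nk.
case: k => [//|k] in kn nk Nk *.
have := NY k Nk; rewrite sub0r normrN ger0_norm // => Yke.
have /key h : (k.+1 ^ 2 <= n < k.+2 ^ 2)%N by rewrite kn nk.
rewrite sub0r normrN -(@ltr_pXn2r _ 2) ?nnegrE ?(ltW e0) // real_normK ?num_real //.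
by apply: le_lt_trans h _; rewrite mulrC -ltr_pdivlMr.
Qed.

End orthogonal_sums.
End expectation.

(** * Gaussian smoothing *)

Section derivation_rules.
Context {R : realType}.
Implicit Types (f g : R -> R) (x a b : R).

(** Pointwise forms of the differentiation rules: a derivative is assembled as one proof term and
    its closed form is then compared by [ring] or [field]. *)
Lemma is_derive_add f g x a b : is_derive x 1 f a -> is_derive x 1 g b ->
  is_derive x 1 (fun t => f t + g t) (a + b).
Proof. exact: is_deriveD. Qed.

Lemma is_derive_mul f g x a b : is_derive x 1 f a -> is_derive x 1 g b ->
  is_derive x 1 (fun t => f t * g t) (f x * b + g x * a).
Proof. exact: is_deriveM. Qed.

Lemma is_derive_sub f g x a b : is_derive x 1 f a -> is_derive x 1 g b ->
  is_derive x 1 (fun t => f t - g t) (a - b).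
Proof. exact: is_deriveB. Qed.

Lemma is_derive_scale (c : R) f x a : is_derive x 1 f a ->
  is_derive x 1 (fun t => c * f t) (c * a).
Proof. exact: is_deriveZ. Qed.

Lemma is_derive_const (c : R) x : is_derive x 1 (fun=> c) 0.
Proof. exact: is_derive_cst. Qed.

Lemma is_derive_var x : is_derive x 1 (fun t : R => t) 1.
Proof. exact: is_derive_id. Qed.

Lemma is_derive_exp f x a : is_derive x 1 f a ->
  is_derive x 1 (fun t => expR (f t)) (expR (f x) * a).
Proof. by move=> df; apply: is_derive1_comp. Qed.

Lemma is_derive_ln f x a : 0 < f x -> is_derive x 1 f a ->
  is_derive x 1 (fun t => ln (f t)) ((f x)^-1 * a).
Proof. by move=> f0 df; apply: is_derive1_comp; exact: is_derive1_ln. Qed.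

Lemma is_derive_inv f x a : f x != 0 -> is_derive x 1 f a ->
  is_derive x 1 (fun t => (f t)^-1) (- (f x) ^- 2 * a).
Proof.
by move=> f0 df; exact: is_deriveV. Qed.

Lemma le_increment f (f' : R -> R) (p q B : R) : p <= q ->
  (forall t, p <= t <= q -> is_derive t 1 f (f' t)) ->
  (forall t, p <= t <= q -> `|f' t| <= B) -> `|f q - f p| <= B * (q - p).
Proof.
move=> pq df fB.
have [c cpq ->] : exists2 c, c \in `[p, q] & f q - f p = f' c * (q - p).
  apply: MVT_segment => //.
  - by move=> t; rewrite in_itv /= => /andP[pt tq]; apply: df; rewrite !ltW.
  - apply: derivable_within_continuous => t; rewrite in_itv /= => tpq.
    by have [] := df t tpq.
by rewrite normrM (ger0_norm (x := q - p)) ?subr_ge0 // ler_wpM2r ?subr_ge0 // fB //; rewrite in_itv in cpq.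
Qed.

End derivation_rules.

Section gaussian_bounds.
Context {R : realType}.
Implicit Types (s x y b a : R).

Lemma expR_poly_bounds s : 0 <= s ->
  [/\ expR (- s) <= 1, s * expR (- s) <= 1 & s ^+ 2 * expR (- s) <= 4].
Proof.
move=> s0; have e0 := expR_gt0 s.
have h1 : 1 + s <= expR s := expR_ge1Dx s.
(* Square of [1 + s/2 <= exp (s/2)]; the quarter is the origin of the bound 4. *)
have h2 : 1 + s + s ^+ 2 / 4 <= expR s.
  have h : 1 + s / 2 <= expR (s / 2) := expR_ge1Dx _.
  have -> : expR s = expR (s / 2) ^+ 2 by rewrite expr2 -expRD -splitr.
  nra.
rewrite expRN; split.
- by rewrite invf_le1 //; lra.
- by rewrite ler_pdivrMr //; nra.
- by rewrite ler_pdivrMr //; nra.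
Qed.

(** With second moments only, the cubic bound serves small [h] and the quadratic one large [h];
    their minimum is what Lindeberg's condition integrates. The constants come from iterating the
    mean value inequality and are not sharp. *)
Lemma taylor2 (g g1 g2 g3 : R -> R) (K2 K3 x h : R) :
  (forall t : R, is_derive t 1 g (g1 t)) -> (forall t : R, is_derive t 1 g1 (g2 t)) ->
  (forall t : R, is_derive t 1 g2 (g3 t)) ->
  (forall t, `|g2 t| <= K2) -> (forall t, `|g3 t| <= K3) ->
  `|g (x + h) - g x - g1 x * h - g2 x * h ^+ 2 / 2|
     <= Num.min (3 / 2 * K2 * h ^+ 2) (K3 * `|h| ^+ 3).
Proof.
move=> dg dg1 dg2 b2 b3.
have line (f f' : R -> R) (B y : R) : (forall t : R, is_derive t 1 f (f' t)) ->
    (forall t, `|t| <= `|y| -> `|f' t| <= B) -> `|f y - f 0| <= B * `|y|.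
  move=> df fB; have [y0|/ltW y0] := leP 0 y.
    rewrite (_ : B * `|y| = B * (y - 0)); last by rewrite ger0_norm // subr0.
    apply: (le_increment (f' := f')) => // t /andP[t0 ty]; apply: fB.
    by rewrite !ger0_norm.
  rewrite distrC (_ : B * `|y| = B * (0 - y)); last by rewrite ler0_norm // sub0r.
  apply: (le_increment (f' := f')) => // t /andP[ty t0]; apply: fB.
  by rewrite !ler0_norm // lerN2.
have shift (f f' : R -> R) (t : R) : (forall u : R, is_derive u 1 f (f' u)) ->
    is_derive t 1 (fun u => f (x + u)) (f' (x + t)).
  move=> df; have dx : is_derive t 1 (fun u : R => x + u) 1.
    by have := is_derive_add (is_derive_const x t) (is_derive_var t); rewrite add0r.
  by have := @is_derive1_comp _ f (fun u => x + u) t _ _ (df _) dx; rewrite mulr1.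
have r2 (t : R) : `|g2 (x + t) - g2 x| <= K3 * `|t|.
  have := line (fun u => g2 (x + u)) (fun u => g3 (x + u)) K3 t; rewrite addr0; apply => //.
have K30 : 0 <= K3 by exact: le_trans (b3 0).
have K20 : 0 <= K2 by exact: le_trans (b2 0).
have r1 (t : R) : `|g1 (x + t) - g1 x - g2 x * t| <= K3 * `|t| * `|t|.
  have := line (fun u => g1 (x + u) - g1 x - g2 x * u)
    (fun u => g2 (x + u) - g2 x) (K3 * `|t|) t.
  rewrite addr0 mulr0 subr0 subrr subr0; apply => u.
    have := is_derive_sub (is_derive_sub (shift _ _ u dg1) (is_derive_const (g1 x) u))
      (is_derive_scale (g2 x) (is_derive_var u)).
    by rewrite subr0 mulr1.
  by move=> ut; apply: le_trans (r2 u) _; rewrite ler_wpM2l.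
have r1' (t : R) : `|g1 (x + t) - g1 x| <= K2 * `|t|.
  have := line (fun u => g1 (x + u)) (fun u => g2 (x + u)) K2 t; rewrite addr0; apply => //.
pose r u := g (x + u) - g x - g1 x * u.
have dr (u : R) : is_derive u 1 r (g1 (x + u) - g1 x).
  have := is_derive_sub (is_derive_sub (shift _ _ u dg) (is_derive_const (g x) u))
    (is_derive_scale (g1 x) (is_derive_var u)).
  by rewrite subr0 mulr1.
have r_0 : r 0 = 0 by rewrite /r addr0 mulr0 subr0 subrr.
have h2 : `|h| ^+ 2 = h ^+ 2 by rewrite real_normK ?num_real.
rewrite le_min; apply/andP; split.
  have := line r (fun u => g1 (x + u) - g1 x) (K2 * `|h|) h dr.
  rewrite r_0 subr0 => /(_ _)/wrap[t th|hr].
    by apply: le_trans (r1' t) _; rewrite ler_wpM2l.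
  rewrite -/(r h) (le_trans (ler_normB _ _)) //.
  rewrite -mulrA -expr2 h2 in hr.
  have : `|g2 x * h ^+ 2 / 2| <= K2 * h ^+ 2 / 2.
    have hh : 0 <= h ^+ 2 / 2 by rewrite divr_ge0 ?sqr_ge0.
    by rewrite -(mulrA (g2 x)) -(mulrA K2) normrM (ger0_norm hh) ler_wpM2r.
  lra.
have := line (fun u => r u - g2 x / 2 * (u * u))
   (fun u => g1 (x + u) - g1 x - g2 x * u) (K3 * `|h| * `|h|) h.
rewrite r_0 !mulr0 !subr0 -/(r h).
have -> : g2 x * h ^+ 2 / 2 = g2 x / 2 * (h * h) by field.
have -> : K3 * `|h| ^+ 3 = K3 * `|h| * `|h| * `|h| by ring.
apply => t.
  have := is_derive_sub (dr t)
    (is_derive_scale (g2 x / 2) (is_derive_mul (is_derive_var t) (is_derive_var t))).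
  by congr (is_derive _ _ _ _); field.
move=> th; apply: le_trans (r1 t) _.
by rewrite ler_pM // ?mulr_ge0 // ler_wpM2l.
Qed.

(* [heat a t] is the average of [x |-> exp (- a x^2)] under a centered Gaussian of
   variance [t], written without any integral. *)
Definition heat a (t x : R) :=
  expR (- (ln (1 + 2 * a * t) / 2) - a * x ^+ 2 / (1 + 2 * a * t)).

Lemma heat0 a x : heat a 0 x = expR (- (a * x ^+ 2)).
Proof. by rewrite /heat mulr0 addr0 ln1 mul0r divr1 oppr0 add0r. Qed.

Lemma heat_ge0 a t x : 0 <= heat a t x.
Proof. exact: expR_ge0. Qed.

Lemma heat_le1 a t x : 0 <= a -> 0 <= t -> heat a t x <= 1.
Proof.
move=> a0 t0; rewrite -expR0 ler_expR.
have at0 : 0 <= 2 * a * t by rewrite !mulr_ge0.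
have : 0 <= ln (1 + 2 * a * t) by rewrite ln_ge0 // lerDl.
have : 0 <= a * x ^+ 2 / (1 + 2 * a * t).
  by apply: divr_ge0; [exact: mulr_ge0 (sqr_ge0 _)|exact: addr_ge0].
lra.
Qed.

(** The same [d2] serves in space and in time: [heat] solves the heat equation, its time derivative
    being half its second space derivative. The bounds depend on [th] alone, not on [t] or [x]. *)
Lemma heat_taylor (th a t x : R) : 0 <= a <= th -> 0 <= t ->
  exists d1 d2,
    (forall h, `|heat a t (x + h) - heat a t x - d1 * h - d2 * h ^+ 2 / 2|
        <= 31 * (1 + th) ^+ 2 * Num.min (h ^+ 2) (`|h| ^+ 3)) /\
    (forall e, 0 <= e -> `|heat a (t + e) x - heat a t x - e * (d2 / 2)|
        <= 31 * (1 + th) ^+ 2 * e ^+ 2).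
Proof.
move=> /andP[a0 ath] t0.
have p1 s : 0 <= s -> 1 <= 1 + 2 * a * s by move=> s0; rewrite lerDl !mulr_ge0.
have p0 s : 0 <= s -> 0 < 1 + 2 * a * s by move=> s0; rewrite (lt_le_trans _ (p1 _ s0)).
set p := 1 + 2 * a * t; set b := a / p.
pose rho := expR (- (ln p / 2)).
have b0 : 0 <= b by rewrite divr_ge0 // ltW // p0.
have bth : b <= th by rewrite ler_pdivrMr ?p0 // (le_trans ath) // ler_peMr ?p1 // (le_trans a0).
have rho1 : 0 <= rho <= 1.
  rewrite expR_ge0 /= -expR0 ler_expR oppr_le0 divr_ge0 // ln_ge0 //; exact: p1.
(* At fixed time, a bell curve of rate [b <= th] and height [rho <= 1]; [g1], [g2] and [g3] are its
   space derivatives. *)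
pose g y := rho * expR (- b * (y * y)).
have gE y : heat a t y = g y.
  rewrite /heat /g /rho -expRD -/p; congr expR; rewrite /b; field; exact/lt0r_neq0/p0.
pose g1 y : R := - 2 * b * (y * g y).
pose g2 y : R := (4 * b ^+ 2 * (y * y) - 2 * b) * g y.
pose g3 y : R := (- 8 * b ^+ 3 * y ^+ 3 + 12 * b ^+ 2 * y) * g y.
have dg y : is_derive y 1 g (g1 y).
  have := is_derive_scale rho (is_derive_exp (is_derive_scale (- b)
    (is_derive_mul (is_derive_var y) (is_derive_var y)))).
  by congr (is_derive _ _ _ _); rewrite /g1 /g; ring.
have dg1 y : is_derive y 1 g1 (g2 y).
  have := is_derive_scale (- 2 * b) (is_derive_mul (is_derive_var y) (dg y)).
  by congr (is_derive _ _ _ _); rewrite /g1 /g2; ring.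
have dg2 y : is_derive y 1 g2 (g3 y).
  have := is_derive_mul (is_derive_sub (is_derive_scale (4 * b ^+ 2)
    (is_derive_mul (is_derive_var y) (is_derive_var y))) (is_derive_const (2 * b) y)) (dg y).
  by congr (is_derive _ _ _ _); rewrite /g1 /g3; ring.
have gB y : [/\ 0 <= g y, g y <= 1, b * y ^+ 2 * g y <= 1 & (b * y ^+ 2) ^+ 2 * g y <= 4].
  have s0 : 0 <= b * y ^+ 2 by rewrite mulr_ge0 ?sqr_ge0.
  have [e1 e2 e3] := expR_poly_bounds s0.
  have e0 : 0 <= expR (- (b * y ^+ 2)) := expR_ge0 _.
  have -> : g y = rho * expR (- (b * y ^+ 2)) by rewrite /g -expr2 mulNr.
  case/andP: rho1 => r0 r1.
  split; [exact: mulr_ge0|exact: mulr_ile1| |].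
    by rewrite mulrCA mulr_ile1 // mulr_ge0.
  rewrite mulrCA; apply: le_trans e3; apply: ler_piMl => //.
  by rewrite mulr_ge0 ?sqr_ge0.
have th0 : 0 <= th := le_trans a0 ath.
have g2B y : `|g2 y| <= 6 * th.
  have [w0 w1 w2 _] := gB y.
  have -> : g2 y = 4 * b * (b * y ^+ 2 * g y) - 2 * b * g y by rewrite /g2; ring.
  have w3 : 0 <= b * y ^+ 2 * g y := mulr_ge0 (mulr_ge0 b0 (sqr_ge0 y)) w0.
  by rewrite ler_norml; apply/andP; split; nra.
have g3B y : `|g3 y| <= 10 * th ^+ 2 + 22 * th.
  have [w0 w1 w2 w4] := gB y.
  set s := b * y ^+ 2 in w2 w4.
  have s0 : 0 <= s by rewrite mulr_ge0 ?sqr_ge0.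
  have y0 := normr_ge0 y.
  have y2 : `|y| ^+ 2 = y ^+ 2 by rewrite real_normK ?num_real.
  (* [2 |y| <= 1 + y^2] trades odd powers of [|y|] for even ones, which [gB] controls. *)
  have h1 : b ^+ 2 * `|y| <= (b ^+ 2 + b * s) / 2.
    have -> : b * s = b ^+ 2 * `|y| ^+ 2 by rewrite y2 /s; ring.
    have := mulr_ge0 (sqr_ge0 b) (sqr_ge0 (`|y| - 1)); lra.
  have h2 : b ^+ 3 * `|y| ^+ 3 <= (b ^+ 2 * s + b * s ^+ 2) / 2.
    have -> : b ^+ 2 * s = b ^+ 3 * `|y| ^+ 2 by rewrite y2 /s; ring.
    have -> : b * s ^+ 2 = b ^+ 3 * (`|y| ^+ 2) ^+ 2 by rewrite y2 /s; ring.
    have := mulr_ge0 (exprn_ge0 3 b0) (sqr_ge0 (`|y| * (`|y| - 1))); lra.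
  rewrite /g3 normrM (ger0_norm w0).
  apply: (@le_trans _ _ ((8 * (b ^+ 3 * `|y| ^+ 3) + 12 * (b ^+ 2 * `|y|)) * g y)).
    rewrite ler_wpM2r //; apply: le_trans (ler_normD _ _) _.
    have -> : - 8 * b ^+ 3 * y ^+ 3 = - (8 * b ^+ 3 * y ^+ 3) by ring.
    have b3 : 0 <= 8 * b ^+ 3 by rewrite mulr_ge0 // exprn_ge0.
    have b2 : 0 <= 12 * b ^+ 2 by rewrite mulr_ge0 // exprn_ge0.
    rewrite normrN (normrM _ (y ^+ 3)) (normrM _ y) (ger0_norm b3) (ger0_norm b2) normrX.
    by rewrite !mulrA.
  apply: (@le_trans _ _ (4 * (b ^+ 2 * (s * g y) + b * (s ^+ 2 * g y)) +
                         6 * (b ^+ 2 * g y + b * (s * g y)))); first by nra.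
  have b2 : b ^+ 2 <= th ^+ 2 by rewrite lerXn2r ?nnegrE.
  have bb := sqr_ge0 b.
  have := ler_wpM2l bb w1; have := ler_wpM2l bb w2.
  have := ler_wpM2l b0 w4; have := ler_wpM2l b0 w2. nra.
have K1 : 1 <= (1 + th) ^+ 2 by rewrite exprn_ege1 // lerDl.
exists (g1 x), (g2 x); split=> [h|e e0].
  rewrite !gE; apply: le_trans (taylor2 x h dg dg1 dg2 g2B g3B) _.
  have h0 := sqr_ge0 h; have h3 : 0 <= `|h| ^+ 3 by exact: exprn_ge0.
  case: (leP (h ^+ 2) (`|h| ^+ 3)) => hh; rewrite ge_min; apply/orP; [left|right].
    by rewrite ler_wpM2r //; nra.
  by rewrite ler_wpM2r //; nra.
pose k := a * x ^+ 2.
have k0 : 0 <= k by rewrite mulr_ge0 ?sqr_ge0.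
pose q s := 1 + 2 * a * s.
(* [E1] is the logarithmic derivative of [F] in time and [E2] the derivative of [E1], so the second
   derivative of [F] is [F (E1^2 + E2)]. *)
pose E1 s := - (a / q s) + 2 * a * k / q s ^+ 2.
pose E2 s := 2 * a ^+ 2 / q s ^+ 2 - 8 * a ^+ 2 * k / q s ^+ 3.
pose F s := heat a s x.
have dq s : is_derive s 1 q (2 * a).
  have := is_derive_add (is_derive_const 1 s) (is_derive_scale (2 * a) (is_derive_var s)).
  by rewrite add0r mulr1.
have dF s : 0 <= s -> is_derive s 1 F (F s * E1 s).
  move=> s0; have qs : 0 < q s := p0 s s0; have qn : q s != 0 := lt0r_neq0 qs.
  have := is_derive_exp (is_derive_sub (is_derive_scale (- 2^-1) (is_derive_ln qs (dq s)))
    (is_derive_scale k (is_derive_inv qn (dq s)))).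
  rewrite (_ : (fun t => expR _) = F).
    by congr (is_derive _ _ _ _); rewrite /F /heat /E1 -/(q s) /k; congr (expR _ * _); field.
  by apply/funext => u; rewrite /F /heat; congr expR; rewrite /k /q mulNr mulrC.
have dE1 s : 0 <= s -> is_derive s 1 E1 (E2 s).
  move=> s0; have qs : 0 < q s := p0 s s0; have qn : q s != 0 := lt0r_neq0 qs.
  have di := is_derive_inv qn (dq s).
  have := is_derive_add (is_derive_scale (- a) di)
    (is_derive_scale (2 * a * k) (is_derive_mul di di)).
  rewrite (_ : (fun t => _ + _) = E1).
    by congr (is_derive _ _ _ _); rewrite /E2 /q; field.
  by apply/funext => u; rewrite /E1 expr2 invfM mulNr.
have dF1 s : 0 <= s -> is_derive s 1 (fun u => F u * E1 u) (F s * (E1 s ^+ 2 + E2 s)).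
  move=> s0; have := is_derive_mul (dF _ s0) (dE1 _ s0).
  by congr (is_derive _ _ _ _); ring.
(* 31 = 16 + 12 + 3 bounds [|4 r^2 F - 12 r F + 3 F|], by [r^2 F <= 4], [r F <= 1] and [F <= 1]. The
   space constants [9 th] and [10 th^2 + 22 th] are below [31 (1 + th)^2] as well. *)
set K := 31 * (1 + th) ^+ 2.
have F2B s : 0 <= s -> `|F s * (E1 s ^+ 2 + E2 s)| <= K.
  move=> s0; have qs := p0 s s0; have q1 := p1 s s0; rewrite -/(q s) in qs q1.
  have qn := lt0r_neq0 qs.
  pose r := k / q s; pose i := (q s)^-1.
  have r0 : 0 <= r by rewrite divr_ge0 // ltW.
  have i0 : 0 <= i by rewrite invr_ge0 ltW.
  have i1 : i <= 1 by rewrite invf_le1.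
  have [e1 e2 e3] := expR_poly_bounds r0.
  have F0 : 0 <= F s := heat_ge0 _ _ _.
  have Fr : F s <= expR (- r).
    rewrite /F /heat ler_expR -/(q s) -/k -/r.
    by have := ln_ge0 q1; lra.
  have -> : E1 s = a * i * (2 * r - 1) by rewrite /E1 /i /r; field.
  have -> : E2 s = (a * i) ^+ 2 * (2 - 8 * r) by rewrite /E2 /i /r; field.
  have c0 : 0 <= a * i by rewrite mulr_ge0.
  have cth : a * i <= th by apply: le_trans ath; rewrite ler_piMr.
  set c := a * i in c0 cth *.
  have c2 : c ^+ 2 <= th ^+ 2 by rewrite lerXn2r ?nnegrE.
  have f1 : F s <= 1 by exact: le_trans e1.
  have f2 : r * F s <= 1 by apply: le_trans e2; rewrite ler_wpM2l.
  have f3 : r ^+ 2 * F s <= 4 by apply: le_trans e3; rewrite ler_wpM2l ?sqr_ge0.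
  have f20 : 0 <= r * F s by rewrite mulr_ge0.
  have f30 : 0 <= r ^+ 2 * F s := mulr_ge0 (sqr_ge0 r) F0.
  have -> : F s * ((c * (2 * r - 1)) ^+ 2 + c ^+ 2 * (2 - 8 * r))
    = c ^+ 2 * (4 * (r ^+ 2 * F s) - 12 * (r * F s) + 3 * F s) by ring.
  rewrite normrM ger0_norm ?sqr_ge0 //.
  apply: (@le_trans _ _ (th ^+ 2 * 31)).
    rewrite ler_pM ?sqr_ge0 // ler_norml; lra.
  by rewrite /K; nra.
have F1B s : t <= s <= t + e -> `|F s * E1 s - F t * E1 t| <= K * e.
  move=> /andP[ts se].
  apply: (@le_trans _ _ (K * (s - t))); last first.
    by rewrite ler_wpM2l ?lerBlDl // /K mulr_ge0 // sqr_ge0.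
  apply: (le_increment (f := fun u => F u * E1 u) (f' := fun u => F u * (E1 u ^+ 2 + E2 u))) ts _ _.
    by move=> u /andP[tu _]; apply: dF1; exact: le_trans tu.
  by move=> u /andP[tu _]; apply: F2B; exact: le_trans tu.
(* The heat equation at [(t, x)]: the time slope is half of [d2]. *)
have d2E : g2 x / 2 = F t * E1 t.
  by rewrite /g2 -gE -/(F t) /E1 -/p -/(q t) /b /k (_ : q t = p) //; field; exact/lt0r_neq0/p0.
rewrite d2E.
have := le_increment (f := fun u => F u - F t * E1 t * u)
  (f' := fun u => F u * E1 u - F t * E1 t) (p := t) (q := t + e) (B := K * e).
rewrite lerDl (_ : t + e - t = e); last by ring.
have -> : F (t + e) - F t * E1 t * (t + e) - (F t - F t * E1 t * t)
        = heat a (t + e) x - heat a t x - e * (F t * E1 t) by rewrite -/(F (t + e)) -/(F t); ring.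
have -> : K * e ^+ 2 = K * e * e by ring.
apply; [exact: e0|move=> u /andP[tu _]|by move=> u /F1B].
have := is_derive_sub (dF _ (le_trans t0 tu)) (is_derive_scale (F t * E1 t) (is_derive_var u)).
by rewrite mulr1.
Qed.

End gaussian_bounds.

(** * Lindeberg's telescoping along the heat flow *)

Section lindeberg.
Context {d : measure_display} {Omega : measurableType d} {R : realType}
  (P : probability Omega R).
Local Notation rint X := (P.-integrable setT (EFin \o X)).
Implicit Types X Y : Omega -> R.

Lemma heat_measurable (a t : R) : measurable_fun setT (heat a t).
Proof.
apply: measurableT_comp => //; apply: measurable_funB => //.
by apply: measurable_funM => //; apply: measurable_funM.
Qed.

Lemma measurable_fun_min_pow X : measurable_fun setT X ->
  measurable_fun setT (fun w => Num.min (X w ^+ 2) (`|X w| ^+ 3)).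
Proof.
move=> mX; apply: measurable_minr; first exact: measurable_funX.
by apply: measurable_funX; exact: measurableT_comp.
Qed.

Lemma rint_min_pow X : sqint P X -> rint (fun w => Num.min (X w ^+ 2) (`|X w| ^+ 3)).
Proof.
move=> [mX iX]; apply: rint_le iX; first exact: measurable_fun_min_pow.
by move=> w; rewrite ger0_norm ?ge_min ?lexx // le_min sqr_ge0 exprn_ge0.
Qed.

(** Freeze [S]. The first-order term in [eta] vanishes by centring, and the second-order term
    [dl * d2 / 2] is the first-order effect of running the heat flow for a time [dl]. Two remainders
    are left, one from space ([ep]) and one from time ([dl^2]). *)
Lemma lindeberg_step (th a t m dl ep : R) (eta S : Omega -> R) :
  0 <= a <= th -> 0 <= t -> 0 <= dl -> sqint P eta -> measurable_fun setT S ->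
  independent_pair P eta S ->
  \int[P]_w eta w = 0 -> \int[P]_w (eta w ^+ 2) = dl ->
  \int[P]_w Num.min (eta w ^+ 2) (`|eta w| ^+ 3) <= ep ->
  `|\int[P]_w heat a t (S w + eta w + m) - \int[P]_w heat a (t + dl) (S w + m)|
     <= 31 * (1 + th) ^+ 2 * (dl ^+ 2 + ep).
Proof.
move=> ath t0 dl0 s_eta mS ind e1 e2 e3; set K := 31 * _.
have K0 : 0 <= K by rewrite mulr_ge0 // sqr_ge0.
have a0 : 0 <= a by case/andP: ath.
have m_eta := s_eta.1.
pose f (z : R * R) := heat a t (z.2 + z.1 + m).
have mf : measurable_fun setT f.
  apply: measurableT_comp; first exact: heat_measurable.
  apply: measurable_funD => //.
  by apply: measurable_funD.
have fc z : `|f z| <= 1 by rewrite ger0_norm ?heat_ge0 ?heat_le1.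
have [iG ->] := independent_pair_expect m_eta mS ind mf fc.
have iH : rint (fun w => heat a (t + dl) (S w + m)).
  apply: (@rint_bounded _ _ _ _ _ 1).
    by apply: measurableT_comp; [exact: heat_measurable|exact: measurable_funD].
  by move=> w; rewrite ger0_norm ?heat_ge0 ?heat_le1 // addr_ge0.
rewrite -expectB //; apply: le_trans (expect_norm (rintB iG iH)) _.
rewrite -[leRHS](expect_cst P); apply: expect_le.
- exact: (integrable_norm (rintB iG iH)).
- exact: rint_cst.
move=> w; set y := S w + m.
have [d1 [d2 [hx ht]]] := heat_taylor y ath t0.
have ifw : rint (fun w' => f (eta w', S w)).
  by apply: (@rint_bounded _ _ _ _ _ 1) => //; exact: (measurableT_comp mf (measurable_fun_pair m_eta _)).
have iq : rint (fun w' => heat a t y + d1 * eta w' + d2 / 2 * eta w' ^+ 2).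
  apply: rintD; last by apply: rintZ; exact: s_eta.2.
  by apply: rintD; [exact: rint_cst|apply: rintZ; exact: sqint_rint].
have eq : \int[P]_w' (heat a t y + d1 * eta w' + d2 / 2 * eta w' ^+ 2) = heat a t y + dl * (d2 / 2).
  rewrite expectD; [|by apply: rintD; [exact: rint_cst|apply: rintZ; exact: sqint_rint]|
    by apply: rintZ; exact: s_eta.2].
  rewrite expectD; [|exact: rint_cst|by apply: rintZ; exact: sqint_rint].
  rewrite expect_cst !expectZ; [|exact: s_eta.2|exact: sqint_rint].
  by rewrite e1 e2 mulr0 addr0 [d2 / 2 * _]mulrC.
apply: (@le_trans _ _ (`|\int[P]_w' f (eta w', S w) - (heat a t y + dl * (d2 / 2))|
   + `|heat a (t + dl) y - heat a t y - dl * (d2 / 2)|)).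
  apply: le_trans (ler_normB _ _); rewrite le_eqVlt; apply/orP; left; apply/eqP; congr `|_|; ring.
rewrite addrC mulrDr lerD //; first exact: ht.
rewrite -eq -expectB //; apply: le_trans (expect_norm (rintB ifw iq)) _.
apply: (@le_trans _ _ (\int[P]_w' (K * Num.min (eta w' ^+ 2) (`|eta w'| ^+ 3)))); last first.
  by rewrite expectZ ?ler_wpM2l //; exact: rint_min_pow.
apply: expect_le.
- exact: (integrable_norm (rintB ifw iq)).
- by apply: rintZ; exact: rint_min_pow.
move=> w'; apply: le_trans (hx (eta w')); rewrite le_eqVlt; apply/orP; left; apply/eqP; congr `|_|.
rewrite /f /= (_ : S w + eta w' + m = y + eta w'); last by rewrite /y; ring.
ring.
Qed.

(** Each summand, starting with the last, is exchanged for a time increment [dl]; when none is left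
    the integrand is constant. The initial time [t] is general because it grows along the
    induction. *)
Lemma lindeberg_heat (th a m dl ep : R) (eta : nat -> Omega -> R) (n : nat) :
  0 <= a <= th -> 0 <= dl ->
  (forall k, (1 <= k <= n)%N -> [/\ sqint P (eta k), \int[P]_w eta k w = 0,
     \int[P]_w (eta k w ^+ 2) = dl,
     \int[P]_w Num.min (eta k w ^+ 2) (`|eta k w| ^+ 3) <= ep &
     independent_pair P (eta k) (fun w => \sum_(1 <= j < k) eta j w)]) ->
  forall t, 0 <= t ->
  `|\int[P]_w heat a t (\sum_(1 <= k < n.+1) eta k w + m) - heat a (t + n%:R * dl) m|
     <= n%:R * (31 * (1 + th) ^+ 2 * (dl ^+ 2 + ep)).
Proof.
move=> ath dl0; elim: n => [|n IH] hyp t t0.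
  under eq_Rintegral do rewrite big_geq // add0r.
  by rewrite expect_cst mul0r addr0 subrr normr0 mul0r.
have [se e1 e2 e3 ind] := hyp n.+1 (leqnn _).
have mS : measurable_fun setT (fun w => \sum_(1 <= j < n.+1) eta j w).
  rewrite (_ : (fun w => _) = (fun w => \sum_(1 <= j < n.+1 | (1 <= j < n.+1)%N) eta j w)); last first.
    by apply/funext => w; rewrite big_nat.
  apply: (@rint_measurable _ _ _ P); apply: rint_sum => j /andP[j1 jn].
  have jn' : (1 <= j <= n.+1)%N by rewrite j1 ltnW.
  by have [sj _ _ _ _] := hyp j jn'; exact: sqint_rint.
under eq_Rintegral do rewrite big_nat_recr //=.
have step := lindeberg_step m ath t0 dl0 se mS ind e1 e2 e3.
have := IH _ (t + dl) (addr_ge0 t0 dl0).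
rewrite (_ : t + dl + n%:R * dl = t + n.+1%:R * dl); last by rewrite -natr1; ring.
move=> /(_ _)/wrap[k /andP[k1 kn]|rest].
  by apply: hyp; rewrite k1 (leqW kn).
have rhsE (K : R) : n.+1%:R * K = K + n%:R * K by rewrite -natr1; ring.
set C := 31 * (1 + th) ^+ 2 * (dl ^+ 2 + ep) in step rest *.
rewrite (rhsE C); apply: le_trans (lerD step rest); apply: le_trans (ler_normD _ _).
by rewrite addrA subrK.
Qed.

End lindeberg.

Lemma measurable_fun_sum_nat (d : measure_display) (T : measurableType d) (R : realType)
    (m n : nat) (F : nat -> T -> R) :
  (forall k, (m <= k < n)%N -> measurable_fun setT (F k)) ->
  measurable_fun setT (fun w => \sum_(m <= k < n) F k w).
Proof.
move=> mF; elim: n mF => [|n IH] mF.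
  by under eq_fun do rewrite big_nil; exact: measurable_cst.
have [mn|nm] := leqP m n; last first.
  by rewrite (_ : (fun w => _) = fun=> 0) //; apply/funext => w; rewrite big_geq.
rewrite (_ : (fun w => _) = fun w => \sum_(m <= k < n) F k w + F n w); last first.
  by apply/funext => w; rewrite big_nat_recr.
apply: measurable_funD; last by apply: mF; rewrite mn ltnSn.
by apply: IH => k /andP[mk kn]; apply: mF; rewrite mk ltnW.
Qed.

(** * Laplace transform of the quadratic form, one row at a time *)

Section rows.
Context {d : measure_display} {Omega : measurableType d} {R : realType}
  (P : probability Omega R).
Local Notation rint X := (P.-integrable setT (EFin \o X)).

Lemma cauchy_schwarz_sum (w x : nat -> R) n :
  (\sum_(1 <= i < n.+1) w i * x i) ^+ 2 <=
  (\sum_(1 <= i < n.+1) w i ^+ 2) * (\sum_(1 <= i < n.+1) x i ^+ 2).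
Proof.
elim: n => [|n IH]; first by rewrite !big_geq // expr0n mul0r.
rewrite !(@big_nat_recr _ _ _ n.+1 1) //=; set S := \sum_(1 <= i < n.+1) w i * x i in IH *.
set V := \sum_(1 <= i < n.+1) w i ^+ 2 in IH *.
set r := \sum_(1 <= i < n.+1) x i ^+ 2 in IH *.
have V0 : 0 <= V by apply: sumr_ge0 => i _; exact: sqr_ge0.
have r0 : 0 <= r by apply: sumr_ge0 => i _; exact: sqr_ge0.
suff : 2 * (S * w n.+1 * x n.+1) <= V * x n.+1 ^+ 2 + w n.+1 ^+ 2 * r by lra.
move: (w n.+1) (x n.+1) => w' x'.
(* [V = 0] forces [S = 0]; otherwise multiply by [V] and complete the square. *)
have [V1|Vp] := leP V 0.
  have S2 : S ^+ 2 <= 0 by apply: le_trans IH _; rewrite mulr_le0_ge0.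
  have /eqP -> : S == 0 by rewrite -sqrf_eq0 eq_le S2 sqr_ge0.
  rewrite !mul0r mulr0; exact: addr_ge0 (mulr_ge0 V0 (sqr_ge0 _)) (mulr_ge0 (sqr_ge0 _) r0).
rewrite -subr_ge0 -(pmulr_rge0 _ Vp).
have -> : V * (V * x' ^+ 2 + w' ^+ 2 * r - 2 * (S * w' * x'))
  = (V * x' - S * w') ^+ 2 + w' ^+ 2 * (V * r - S ^+ 2) by ring.
by apply: addr_ge0; rewrite ?sqr_ge0 //; apply: mulr_ge0; rewrite ?sqr_ge0 ?subr_ge0.
Qed.

(* [(1 + 2 th)^n (1 - 2 B |u|^2 / (1 + 2 th))] is the determinant of
   [I + 2 (th I - B u u^T)]; integrating one coordinate out of
   [exp (- x^T (th I - B u u^T) x)] against a standard Gaussian only changes [B]. *)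
Lemma rows_laplace (th ep : R) (W : nat -> Omega -> R) (u : nat -> R) (n : nat) :
  0 < th -> 0 <= ep ->
  (forall k, (1 <= k <= n)%N -> measurable_fun setT (W k)) ->
  (forall k, (1 <= k <= n)%N -> 0 < u k) ->
  (forall k, (1 <= k <= n)%N -> independent_pair P (W k) (fun w =>
     (\sum_(1 <= i < k) W i w ^+ 2, \sum_(1 <= i < k) u i * W i w))) ->
  (forall k a m, (1 <= k <= n)%N -> 0 <= a <= th ->
     `|\int[P]_w heat a 0 (W k w + m) - heat a 1 m| <= ep) ->
  forall B, 0 < B -> B * (\sum_(1 <= i < n.+1) u i ^+ 2) <= th ->
    ((1 <= n)%N -> B * u n ^+ 2 < th) ->
  `|\int[P]_w expR (- (th * (\sum_(1 <= i < n.+1) W i w ^+ 2)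
        - B * (\sum_(1 <= i < n.+1) u i * W i w) ^+ 2))
    - expR (- (ln ((1 + 2 * th) ^+ n *
          (1 - 2 * B * (\sum_(1 <= i < n.+1) u i ^+ 2) / (1 + 2 * th))) / 2))|
    <= n%:R * ep.
Proof.
move=> th0 ep0; elim: n => [|n IH] mW u0 ind clt B B0 BV Bu.
  under eq_Rintegral do rewrite !big_geq // expr0n !mulr0 subrr oppr0 expR0.
  by rewrite expect_cst big_geq // mulr0 mul0r subr0 expr0 mul1r ln1 mul0r oppr0 expR0 subrr normr0 mul0r.
have nn : (1 <= n.+1 <= n.+1)%N by rewrite leqnn.
have sub k : (1 <= k <= n)%N -> (1 <= k <= n.+1)%N by move=> /andP[-> /leqW ->].
have {}Bu : B * u n.+1 ^+ 2 < th := Bu isT.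
set x := W n.+1; set v := u n.+1 in Bu *.
set V := \sum_(1 <= i < n.+1) u i ^+ 2.
have VE : \sum_(1 <= i < n.+2) u i ^+ 2 = V + v ^+ 2 by rewrite big_nat_recr.
rewrite VE in BV *.
have V0 : 0 <= V by apply: sumr_ge0 => i _; exact: sqr_ge0.
have v0 : 0 < v := u0 _ nn.
have v2 : 0 < v ^+ 2 by rewrite exprn_gt0.
(* The coefficient of the squared last coordinate in the form; it must be positive for that
   coordinate to be integrated out. *)
pose al := th - B * v ^+ 2.
have al0 : 0 < al by rewrite subr_gt0.
have alth : al <= th by rewrite gerBl mulr_ge0 ?ltW.
(* Integrating out adds [al (m s)^2 / (1 + 2 al)] to [q0]; with [B v^2 = th - al], the coefficient
   of [- s^2] collapses to this [B']. *)
pose B' := B * (1 + 2 * th) / (1 + 2 * al).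
have al1 : 0 < 1 + 2 * al by lra.
have th1 : 0 < 1 + 2 * th by lra.
have B'0 : 0 < B' by rewrite divr_gt0 // mulr_gt0.
have Bv : 0 < B * v ^+ 2 by rewrite mulr_gt0.
(* The hypothesis allows equality, as in the degenerate case of norm one. Since [B v^2 > 0], the
   inequality becomes strict after one elimination, which keeps the next leading coefficient
   positive. *)
have B'V : B' * V < th.
  rewrite /B' mulrAC ltr_pdivrMr // /al.
  have : B * V <= th - B * v ^+ 2 by lra.
  move: Bv; move: (B * v ^+ 2) => c c0 h.
  have : (1 + 2 * th) * (B * V) <= (1 + 2 * th) * (th - c) by rewrite ler_wpM2l // ltW.
  nra.
have B'u : (1 <= n)%N -> B' * u n ^+ 2 < th.
  move=> n1; apply: le_lt_trans B'V; rewrite ler_wpM2l ?(ltW B'0) //.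
  rewrite /V (bigD1_seq n) ?iota_uniq ?mem_index_iota ?n1 //= lerDl.
  by apply: sumr_ge0 => i _; exact: sqr_ge0.
have {IH} := IH (fun k h => mW k (sub k h)) (fun k h => u0 k (sub k h))
  (fun k h => ind k (sub k h)) (fun k a m h => clt k a m (sub k h)) B' B'0 (ltW B'V) B'u.
rewrite -/V; set detV := (1 + 2 * th) ^+ n * _.
set L := expR (- (ln detV / 2)).
set EB := \int[P]_w _ => IH.
have detVp : 0 < detV.
  by rewrite mulr_gt0 ?exprn_gt0 // subr_gt0 ltr_pdivrMr // mul1r -mulrA; lra.
set det := (1 + 2 * th) ^+ n.+1 * _.
have detE : det = (1 + 2 * al) * detV.
  rewrite /det /detV /B' /al exprS; field; rewrite !gt_eqF //.
have -> : expR (- (ln det / 2)) = expR (- (ln (1 + 2 * al) / 2)) * L.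
  by rewrite detE lnM ?posrE // -expRD; congr expR; field.
set rho := expR (- (ln (1 + 2 * al) / 2)).
have rho0 : 0 <= rho := expR_ge0 _.
have rho1 : rho <= 1.
  by rewrite -expR0 ler_expR oppr_le0 divr_ge0 // ln_ge0 // lerDl mulr_ge0 // ltW.
pose Q (z r s : R) := th * (r + z ^+ 2) - B * (s + v * z) ^+ 2.
(* The maximum makes [f] bounded everywhere; along [(x w, Y w)] it is inactive, since [q0 >= 0]
   there by Cauchy-Schwarz. *)
pose f (z : R * (R * R)) := expR (- Num.max 0 (Q z.1 z.2.1 z.2.2)).
pose Y w := (\sum_(1 <= i < n.+1) W i w ^+ 2, \sum_(1 <= i < n.+1) u i * W i w).
have mX : measurable_fun setT x := mW _ nn.
have mY : measurable_fun setT Y.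
  apply: measurable_fun_pair; apply: measurable_fun_sum_nat => i /andP[i1 ni].
    by apply: measurable_funX; apply: mW; rewrite i1 ltnW.
  by apply: measurable_funM => //; apply: mW; rewrite i1 ltnW.
have mQ : measurable_fun setT (fun z : R * (R * R) => Q z.1 z.2.1 z.2.2).
  have m1 : measurable_fun setT (fun z : R * (R * R) => z.2.1).
    exact: (measurableT_comp measurable_fst measurable_snd).
  have m2 : measurable_fun setT (fun z : R * (R * R) => z.2.2).
    exact: (measurableT_comp measurable_snd measurable_snd).
  apply: measurable_funB; apply: measurable_funM => //.
    by apply: measurable_funD => //; exact: measurable_funX.
  by apply: measurable_funX; apply: measurable_funD => //; exact: measurable_funM.
have mf : measurable_fun setT f.
  by apply: measurableT_comp => //; apply: measurableT_comp => //; exact: measurable_maxr.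
have fc z : `|f z| <= 1.
  by rewrite ger0_norm ?expR_ge0 // -expR0 ler_expR oppr_le0 le_max lexx.
(* completing the square in the coordinate [z] *)
pose m (s : R) := - (B * v * s / al).
pose q0 (r s : R) := th * r - B * th / al * s ^+ 2.
have QE z r s : Q z r s = al * (z + m s) ^+ 2 + q0 r s.
  by rewrite /Q /m /q0 /al; field; rewrite -/al gt_eqF.
have BVal : B * V <= al by rewrite /al; lra.
have q0_ge0 w : 0 <= q0 (Y w).1 (Y w).2.
  have /= CS := cauchy_schwarz_sum u (W ^~ w) n; rewrite -/V in CS.
  rewrite /q0 /=; set s2 := _ ^+ 2 in CS *; set r := \sum_(_ <= _ < _) _ in CS *.
  have r0 : 0 <= r by apply: sumr_ge0 => i _; exact: sqr_ge0.
  rewrite (_ : _ - _ = th / al * (al * r - B * s2)); last by field; rewrite gt_eqF.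
  rewrite mulr_ge0 ?divr_ge0 ?(ltW th0) ?(ltW al0) // subr_ge0.
  apply: le_trans (ler_wpM2l (ltW B0) CS) _.
  by rewrite mulrA ler_wpM2r.
have fE z w : f (z, Y w) = expR (- q0 (Y w).1 (Y w).2) * heat al 0 (z + m (Y w).2).
  rewrite heat0 -expRD /f /= QE max_r; first by congr expR; ring.
  exact: addr_ge0 (mulr_ge0 (ltW al0) (sqr_ge0 _)) (q0_ge0 w).
have -> : \int[P]_w expR (- (th * \sum_(1 <= i < n.+2) W i w ^+ 2 -
    B * (\sum_(1 <= i < n.+2) u i * W i w) ^+ 2)) = \int[P]_w f (x w, Y w).
  apply: eq_Rintegral => w _; rewrite fE heat0 -expRD !(@big_nat_recr _ _ _ n.+1 1) //=; congr expR.
  by have := QE (x w) (Y w).1 (Y w).2; rewrite /Q -/x -/v => ->; rewrite /=; ring.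
have [iG ->] := independent_pair_expect mX mY (ind _ nn) mf fc.
have EBE w : rho * expR (- (th * \sum_(1 <= i < n.+1) W i w ^+ 2 -
    B' * (\sum_(1 <= i < n.+1) u i * W i w) ^+ 2)) =
    expR (- q0 (Y w).1 (Y w).2) * heat al 1 (m (Y w).2).
  rewrite /rho /heat mulr1 -!expRD; congr expR; rewrite /q0 /m /B' /= /al; field.
  by rewrite -/al !gt_eqF.
pose h w := expR (- q0 (Y w).1 (Y w).2) * heat al 1 (m (Y w).2).
have ih : rint h.
  apply: (@rint_bounded _ _ _ _ _ 1).
    apply: measurable_funM.
      apply: measurableT_comp => //; apply: measurableT_comp => //.
      apply: measurable_funB; apply: measurable_funM => //.
        exact: (measurableT_comp measurable_fst mY).
      by apply: measurable_funX; exact: (measurableT_comp measurable_snd mY).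
    apply: measurableT_comp; first exact: heat_measurable.
    have mm : measurable_fun setT m by apply: measurable_funN; do 2!apply: measurable_funM => //.
    exact: (measurableT_comp mm (measurableT_comp measurable_snd mY)).
  move=> w; rewrite ger0_norm /h; last by rewrite mulr_ge0 ?expR_ge0 ?heat_ge0.
  apply: mulr_ile1; [exact: expR_ge0|exact: heat_ge0| |exact: heat_le1 (ltW al0) ler01].
  by rewrite -expR0 ler_expR oppr_le0.
have rhop : 0 < rho := expR_gt0 _.
have Eh : \int[P]_w h w = rho * EB.
  rewrite /EB -expectZ; first by apply: eq_Rintegral => w _; rewrite EBE.
  have := rintZ rho^-1 ih; congr (P.-integrable _ _).
  by apply/funext => w /=; rewrite /h -EBE mulKf // gt_eqF.
have inner w : `|\int[P]_w' f (x w', Y w) - h w| <= ep.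
  under eq_Rintegral do rewrite fE.
  rewrite expectZ; last first.
    apply: (@rint_bounded _ _ _ _ _ 1).
      apply: measurableT_comp; first exact: heat_measurable.
      exact: measurable_funD.
    move=> w'; rewrite ger0_norm ?heat_ge0 //; exact: heat_le1 (ltW al0) (lexx 0).
  rewrite /h -mulrBr normrM ger0_norm ?expR_ge0 //.
  apply: le_trans (_ : 1 * ep <= _); last by rewrite mul1r.
  rewrite ler_pM ?expR_ge0 //; first by rewrite -expR0 ler_expR oppr_le0.
  by apply: clt => //; rewrite alth ltW.
(* The error is [ep] for this row plus [rho <= 1] times the error of the remaining rows. *)
rewrite (_ : _ - rho * L = (\int[P]_w \int[P]_w' f (x w', Y w) - \int[P]_w h w)
  + rho * (EB - L)); last by rewrite Eh; ring.
rewrite -natr1 mulrDl mul1r [leRHS]addrC; apply: le_trans (ler_normD _ _) _; apply: lerD.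
  rewrite -expectB //; apply: le_trans (expect_norm (rintB iG ih)) _.
  rewrite -[leRHS](expect_cst P); apply: expect_le => //.
    exact: (integrable_norm (rintB iG ih)).
  exact: rint_cst.
by rewrite normrM ger0_norm // -[leRHS]mul1r ler_pM.
Qed.

End rows.

(** * From Laplace transforms to chi-squared probabilities *)

Section bernstein.
Context {R : realType}.
Implicit Types (x : R) (p : {poly R}).

(* The Bernstein polynomial of degree [n] for the values [phi k], by conditioning on the
   first of the [n] trials instead of through binomial coefficients. *)
Fixpoint bernstein n (phi : nat -> R) : {poly R} :=
  if n is n'.+1 then 'X * bernstein n' (phi \o S) + (1 - 'X) * bernstein n' phi
  else (phi 0%N)%:P.

Lemma bernsteinS n phi x : (bernstein n.+1 phi).[x] =
  x * (bernstein n (phi \o S)).[x] + (1 - x) * (bernstein n phi).[x].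
Proof. by rewrite /= !hornerE. Qed.

Lemma bernstein_le n phi psi x : 0 <= x <= 1 -> (forall k, phi k <= psi k) ->
  (bernstein n phi).[x] <= (bernstein n psi).[x].
Proof.
move=> /andP[x0 x1]; elim: n phi psi => [|n IH] phi psi h; first by rewrite /= !hornerC.
rewrite !bernsteinS lerD // ler_wpM2l ?subr_ge0 ?IH // => k; exact: h.
Qed.

Lemma bernstein_lin n phi psi (a b : R) x :
  (bernstein n (fun k => a * phi k + b * psi k)).[x] =
  a * (bernstein n phi).[x] + b * (bernstein n psi).[x].
Proof.
elim: n phi psi => [|n IH] phi psi; first by rewrite /= !hornerC.
have := IH (phi \o S) (psi \o S); rewrite /= => IHS.
by rewrite !bernsteinS (IH phi psi) [X in x * X]IHS; ring.
Qed.

Lemma bernstein_cst n (c : R) x : (bernstein n (fun=> c)).[x] = c.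
Proof.
elim: n => [|n IH]; first by rewrite /= hornerC.
by rewrite bernsteinS (_ : (fun=> c) \o S = (fun=> c)) // IH; ring.
Qed.

(** Variance plus squared bias of a binomial variable with [n] trials and success probability
    [x]. *)
Lemma bernstein_sq n (c : R) x : (bernstein n (fun k => (k%:R - c) ^+ 2)).[x] =
  n%:R * x * (1 - x) + (n%:R * x - c) ^+ 2.
Proof.
elim: n c => [|n IH] c; first by rewrite /= hornerC; ring.
rewrite bernsteinS IH.
have -> : (fun k : nat => (k%:R - c) ^+ 2) \o S = fun k => (k%:R - (c - 1)) ^+ 2.
  by apply/funext => k /=; rewrite -natr1; ring.
by rewrite IH -natr1; ring.
Qed.

(** The Bernstein operator is linear, positive and fixes constants, so a bound of [|g (k/n) - g x|]
    by a quadratic in [k] passes to the polynomial, where the small binomial variance enters. *)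
Lemma lipschitz_poly_approx (g : R -> R) (L e : R) : 0 < L -> 0 < e ->
  (forall x y, `|g x - g y| <= L * `|x - y|) ->
  exists p, forall x, 0 <= x <= 1 -> `|p.[x] - g x| <= e.
Proof.
move=> L0 e0 gL.
pose dl := e / L.
have dl0 : 0 < dl by rewrite divr_gt0.
(* [n >= dl^-2] makes the variance [x (1 - x) / n] at most [dl^2]. *)
pose n := (Num.bound (dl ^- 2)).+1.
have n0 : 0 < n%:R :> R by rewrite ltr0n.
have ndl : dl ^- 2 <= n%:R.
  have h : 0 <= dl ^- 2 by rewrite invr_ge0 sqr_ge0.
  by apply: le_trans (ltW (archi_boundP h)) _; rewrite ler_nat.
exists (bernstein n (fun k => g (k%:R / n%:R))) => x x01.
have [x0 x1] := andP x01.
(* AM-GM: [|y| <= dl / 2 + y^2 / (2 dl)] *)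
pose q (k : nat) := L * (dl / 2) + L / (2 * dl) / n%:R ^+ 2 * (k%:R - n%:R * x) ^+ 2.
have gq (k : nat) : `|g (k%:R / n%:R) - g x| <= q k.
  apply: le_trans (gL _ _) _; rewrite /q.
  set y := `|_|.
  have -> : L / (2 * dl) / n%:R ^+ 2 * (k%:R - n%:R * x) ^+ 2 = L / (2 * dl) * y ^+ 2.
    by rewrite /y real_normK ?num_real //; field; rewrite !gt_eqF.
  have -> : L * (dl / 2) + L / (2 * dl) * y ^+ 2 = L * ((dl ^+ 2 + y ^+ 2) / (2 * dl)).
    by field; rewrite gt_eqF.
  rewrite ler_wpM2l ?(ltW L0) // ler_pdivlMr; last exact: mulr_gt0 dl0.
  by have := sqr_ge0 (dl - y); nra.
have Bq : (bernstein n q).[x] <= e.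
  rewrite (_ : q = fun k => L * (dl / 2) * 1 + L / (2 * dl) / n%:R ^+ 2 * (k%:R - n%:R * x) ^+ 2); last first.
    by apply/funext => k; rewrite mulr1.
  rewrite bernstein_lin bernstein_cst bernstein_sq subrr expr0n addr0 mulr1.
  have -> : L / (2 * dl) / n%:R ^+ 2 * (n%:R * x * (1 - x)) = L / 2 * (x * (1 - x) / (n%:R * dl)).
    by field; rewrite !gt_eqF.
  have h1 : x * (1 - x) <= 1 by nra.
  have h2 : x * (1 - x) / (n%:R * dl) <= dl.
    rewrite ler_pdivrMr; last exact: mulr_gt0 dl0.
    apply: le_trans h1 _.
    move: ndl; rewrite -[X in X <= _]div1r ler_pdivrMr ?exprn_gt0 //; nra.
  have -> : e = L * (dl / 2) + L / 2 * dl by rewrite /dl; field; rewrite gt_eqF.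
  by rewrite lerD2l ler_wpM2l // divr_ge0 ?ltW.
have up : (bernstein n (fun k => g (k%:R / n%:R))).[x] <= g x + e.
  apply: (@le_trans _ _ ((bernstein n (fun k => g x * 1 + 1 * q k)).[x])).
    apply: bernstein_le => // k; rewrite mulr1 mul1r -lerBlDl; exact: le_trans (ler_norm _) (gq k).
  by rewrite bernstein_lin bernstein_cst mulr1 mul1r lerD2l.
have lo : g x - e <= (bernstein n (fun k => g (k%:R / n%:R))).[x].
  apply: (@le_trans _ _ ((bernstein n (fun k => g x * 1 + -1 * q k)).[x])).
    by rewrite bernstein_lin bernstein_cst mulr1 mulN1r lerD2l lerN2.
  apply: bernstein_le => // k; rewrite mulr1 mulN1r lerBlDl -lerBlDr.
  by apply: le_trans (gq k); rewrite distrC ler_norm.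
by rewrite ler_norml; apply/andP; split; lra.
Qed.

End bernstein.

(** Since [0^-1 = 0], the inverse is the total function [y (|y|^-1)^2], built from measurable
    functions. *)
Lemma measurable_fun_invr (d : measure_display) (T : measurableType d) (R : realType)
    (D : set T) (f : T -> R) :
  measurable_fun D f -> measurable_fun D (fun x => (f x)^-1).
Proof.
move=> mf; have minv : measurable_fun setT (fun y : R => y * (`|y| `^ (-1)) ^+ 2).
  apply: measurable_funM => //; apply: measurable_funX.
  apply: (measurableT_comp (measurable_powR (-1))); exact: normr_measurable.
rewrite (_ : (fun x => _) = (fun y : R => y * (`|y| `^ (-1)) ^+ 2) \o f).
  exact: measurableT_comp.
apply/funext => x /=; have [->|fx0] := eqVneq (f x) 0; first by rewrite invr0 mul0r.
rewrite powR_inv1 // exprVn real_normK ?num_real //; by field.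
Qed.

(** * The chi-squared density and its Laplace transform *)

Section chisq.
Context {R : realType}.
Local Notation mu := (@lebesgue_measure R).
Local Notation D := (`]0, +oo[%classic : set R).
Implicit Types (nu j : nat) (y c : R).

(** Both sides are measures in [A] that agree on half-open intervals. *)
Lemma lebesgue_measure_scale c (A : set R) : 0 < c -> measurable A ->
  (mu A = c%:E * pushforward mu ( *%R c : measurableTypeR R -> measurableTypeR R) A)%E.
Proof.
move=> c0 mA.
have mc : measurable_fun setT ( *%R c : measurableTypeR R -> measurableTypeR R).
  exact: mulrl_measurable.
pose f : {mfun measurableTypeR R >-> measurableTypeR R} :=
  HB.pack ( *%R c : measurableTypeR R -> measurableTypeR R) (isMeasurableFun.Build _ _ _ _ _ mc).
pose k : {nonneg R} := NngNum (ltW c0).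
have := @lebesgue_measure_unique R (mscale k (pushforward mu f)).
rewrite /=; apply => // _ [[a b]] _ <-.
rewrite /mscale /= /pushforward.
have -> : *%R c @^-1` `]a, b] = `](a / c), (b / c)]%classic :> set R.
  apply/seteqP; split => y /=; rewrite !in_itv /= => /andP[ay yb]; apply/andP; split.
  - by rewrite ltr_pdivrMr // mulrC.
  - by rewrite ler_pdivlMr // mulrC.
  - by move: ay; rewrite ltr_pdivrMr // mulrC.
  - by move: yb; rewrite ler_pdivlMr // mulrC.
rewrite !lebesgue_measure_itv /= !lte_fin ltr_pM2r ?invr_gt0 //.
case: ifPn => _; last by rewrite mule0.
rewrite -!EFinB -EFinM; congr (_%:E); field; exact: lt0r_neq0.
Qed.

Lemma integral_scale c (f : R -> \bar R) : 0 < c -> measurable_fun setT f ->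
  (forall y, 0 <= f y)%E ->
  (\int[mu]_(y in D) f y = c%:E * \int[mu]_(y in D) f (c * y)%R)%E.
Proof.
move=> c0 mf f0.
have mc : measurable_fun setT ( *%R c : measurableTypeR R -> measurableTypeR R).
  exact: mulrl_measurable.
pose g : {mfun measurableTypeR R >-> measurableTypeR R} :=
  HB.pack ( *%R c : measurableTypeR R -> measurableTypeR R) (isMeasurableFun.Build _ _ _ _ _ mc).
pose k : {nonneg R} := NngNum (ltW c0).
pose pf := measure_function_pushforward__canonical__measure_function_Measure mu mc.
transitivity (\int[mscale k pf]_(y in D) f y)%E.
  by apply: eq_measure_integral => A mA _; exact: lebesgue_measure_scale.
rewrite ge0_integral_mscale //; last exact: measurable_funS mf.
rewrite ge0_integral_pushforward //; last exact: measurable_funS mf.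
congr (_ * _)%E; congr (integral _ _ _).
apply/seteqP; split => y /=; rewrite !in_itv /= !andbT.
  by rewrite pmulr_rgt0.
by move=> y0; rewrite mulr_gt0.
Qed.

Lemma chisq_density_measurable nu : measurable_fun setT (@chisq_density R nu).
Proof.
apply: measurable_funM; first exact: measurable_powR.
by apply: measurableT_comp => //; apply: measurableT_comp => //; exact: measurable_funM.
Qed.

Lemma chisq_density_ge0 nu y : 0 <= chisq_density nu y.
Proof. by rewrite mulr_ge0 ?powR_ge0 ?expR_ge0. Qed.

(* The derivative of [- 1 / (1 + sqrt y)], which dominates the density up to a constant. *)
Let h y : R := (1 + Num.sqrt y) ^- 2 * (2 * Num.sqrt y)^-1.

(** In [s = sqrt y] the density is [s^(nu-2) exp (- s^2 / 2)]. The single majorant [h] covers both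
    the singularity at 0 when [nu = 1] and the behaviour at infinity. *)
Lemma chisq_density_le nu y : (0 < nu)%N -> 0 < y ->
  chisq_density nu y <= 4 * (2 * nu%:R) ^+ nu * h y.
Proof.
move=> nu0 y0; set s := Num.sqrt y.
have s0 : 0 < s by rewrite sqrtr_gt0.
have s2 : s ^+ 2 = y by rewrite sqr_sqrtr // ltW.
have dE : chisq_density nu y = s ^+ nu * expR (- (y / 2)) / y.
  rewrite /chisq_density mulrAC; congr (_ * _).
  have -> : s ^+ nu = y `^ (nu%:R / 2).
    by rewrite mulrC powRrM powR12_sqrt ?ltW // powR_mulrn // ltW.
  have -> : y `^ (nu%:R / 2) = y `^ (nu%:R / 2 - 1) * y.
    rewrite -[in LHS](subrK 1 (nu%:R / 2)) powRD ?powRr1 ?(ltW y0) //.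
    by rewrite (gt_eqF y0) implybT.
  by rewrite mulfK // gt_eqF.
have n0 : 1 <= nu%:R :> R by rewrite ler1n.
(* The [nu]-th power of [1 + x <= exp x] at [x = y / (2 nu)]. *)
have key : (1 + s ^+ 2) ^+ nu <= (2 * nu%:R) ^+ nu * expR (y / 2).
  have e1 : 1 + y / (2 * nu%:R) <= expR (y / (2 * nu%:R)) := expR_ge1Dx _.
  have -> : expR (y / 2) = expR (y / (2 * nu%:R)) ^+ nu.
    rewrite -expRM_natl; congr expR; field; rewrite gt_eqF //; exact: lt_le_trans n0.
  have c0 : 0 <= 2 * nu%:R :> R by rewrite mulr_ge0.
  rewrite -exprMn; apply: lerXn2r.
  - by rewrite nnegrE; exact: addr_ge0 ler01 (sqr_ge0 s).
  - by rewrite nnegrE; exact: mulr_ge0 c0 (expR_ge0 _).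
  apply: le_trans (ler_wpM2l c0 e1).
  rewrite s2 mulrDr mulr1 mulrCA divff ?mulr1 ?lerD2r; first by lra.
  by rewrite gt_eqF // mulr_gt0 // (lt_le_trans _ n0).
have e0 := expR_gt0 (- (y / 2)).
have n1 : s ^+ nu.-1 <= (1 + s ^+ 2) ^+ nu.-1.
  apply: lerXn2r; [by rewrite nnegrE ltW| |by have := sqr_ge0 (s - 1); nra].
  by rewrite nnegrE; exact: addr_ge0 ler01 (sqr_ge0 s).
have e1 : expR (- (y / 2)) * expR (y / 2) = 1 by rewrite -expRD addNr expR0.
rewrite dE; set E := expR (- (y / 2)) in e0 e1 *.
have -> : s ^+ nu * E / y = (s ^+ nu.-1 * (1 + s) ^+ 2 * 2 * E) * h y.
  rewrite /h -/s -{1}(prednK nu0) exprS -s2; field; rewrite !gt_eqF //; lra.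
have h0 : 0 <= h y by rewrite mulr_ge0 ?invr_ge0 ?sqr_ge0 ?mulr_ge0 ?sqrtr_ge0.
rewrite ler_wpM2r //.
apply: (@le_trans _ _ ((1 + s ^+ 2) ^+ nu.-1 * (2 * (1 + s ^+ 2)) * 2 * E)).
  rewrite ler_wpM2r ?(ltW e0) // ler_wpM2r // ler_pM ?exprn_ge0 ?(ltW s0) //.
    exact: addr_ge0 ler01 (ltW s0).
  by have := sqr_ge0 (s - 1); nra.
have -> : (1 + s ^+ 2) ^+ nu.-1 * (2 * (1 + s ^+ 2)) * 2 * E = 4 * ((1 + s ^+ 2) ^+ nu * E).
  by rewrite -[in RHS](prednK nu0) (exprS _ nu.-1); ring.
rewrite ler_wpM2l //.
apply: le_trans (ler_wpM2r (ltW e0) key) _.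
by rewrite -mulrA [expR (y / 2) * E]mulrC e1 mulr1.
Qed.

Let h_ge0 y : 0 <= h y.
Proof. by rewrite mulr_ge0 ?invr_ge0 ?sqr_ge0 // mulr_ge0 // sqrtr_ge0. Qed.

Let h_primitive y : 0 < y ->
  is_derive y 1 (fun t : R => - (1 + Num.sqrt t)^-1) (h y).
Proof.
move=> y0; have s0 : 0 < Num.sqrt y by rewrite sqrtr_gt0.
have s1 : 1 + Num.sqrt y != 0 by rewrite gt_eqF // addr_gt0.
have dv := @is_derive_inv R (fun t => 1 + Num.sqrt t) y _ s1
  (is_derive_add (is_derive_const 1 y) (is_derive1_sqrt y0)).
have := is_derive_scale (- 1) dv.
rewrite (_ : (fun t => _) = fun t : R => - (1 + Num.sqrt t)^-1); last first.
  by apply/funext => t; rewrite mulN1r.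
by congr (is_derive _ _ _ _); rewrite /h add0r; field; rewrite !gt_eqF // addr_gt0.
Qed.

(** The primitive rises from at least -1 to 0, so the bound is uniform in [a]. Starting at [a > 0]
    avoids the pole of [h] at 0. *)
Let integral_h a : 0 < a -> (\int[mu]_(y in `[a, +oo[) (h y)%:E <= 1)%E.
Proof.
move=> a0; have dF y : 0 < y -> is_derive y 1 (fun t : R => - (1 + Num.sqrt t)^-1) (h y).
  exact: h_primitive.
rewrite (@ge0_continuous_FTC2y _ h (fun t : R => - (1 + Num.sqrt t)^-1) a 0).
- rewrite -EFinB lee_fin sub0r opprK invf_le1 ?lerDl ?sqrtr_ge0 // addr_gt0 //.
- by move=> *; exact: h_ge0.
- apply: derivable_within_continuous => y; rewrite in_itv /= andbT => ay.
  have y0 : 0 < y by exact: lt_le_trans ay.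
  have s0 : 0 < Num.sqrt y by rewrite sqrtr_gt0.
  have ds := is_derive1_sqrt y0.
  have d1 := is_derive_add (is_derive_const 1 y) ds.
  have d2 := @is_derive_inv R (fun t => (1 + Num.sqrt t) * (1 + Num.sqrt t)) y _
    (lt0r_neq0 (mulr_gt0 (addr_gt0 ltr01 s0) (addr_gt0 ltr01 s0))) (is_derive_mul d1 d1).
  have d3 := @is_derive_inv R (fun t => 2 * Num.sqrt t) y _
    (lt0r_neq0 (mulr_gt0 (ltr0n R 2) s0)) (is_derive_scale 2 ds).
  by have [] := is_derive_mul d2 d3.
- rewrite -[X in _ --> X]oppr0; apply: cvgN.
  apply/cvgrPdist_lt => e e0; exists (e ^- 2); split; first exact: num_real.
  move=> y ye; rewrite sub0r normrN.
  have y0 : 0 < y by apply: lt_trans ye; rewrite invr_gt0 exprn_gt0.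
  have s0 : 0 < Num.sqrt y by rewrite sqrtr_gt0.
  rewrite gtr0_norm ?invr_gt0 ?addr_gt0 // invf_plt ?posrE ?addr_gt0 //.
  have : e^-1 < Num.sqrt y.
    rewrite -[e^-1]gtr0_norm ?invr_gt0 // -sqrtr_sqr ltr_sqrt // exprVn; exact: ye.
  lra.
- by move=> y ay; have [] := dF y (lt_trans a0 ay).
- have cF : {for a, continuous (fun t : R => - (1 + Num.sqrt t)^-1)}.
    apply: differentiable_continuous; apply/derivable1_diffP.
    by have [] := dF a a0.
  exact: cvg_at_right_filter cF.
- move=> y; rewrite in_itv /= andbT => ay.
  by rewrite derive1E; have [_ ->] := dF y (lt_trans a0 ay).
Qed.

Lemma chisq_density_integrable nu : (0 < nu)%N ->
  mu.-integrable D (EFin \o chisq_density nu).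
Proof.
move=> nu0; have md : measurable_fun setT (EFin \o @chisq_density R nu).
  by apply/measurable_EFinP; exact: chisq_density_measurable.
apply/integrableP; split; first exact: measurable_funS md.
under eq_integral do rewrite /= ger0_norm ?chisq_density_ge0 //.
(* The half-line is exhausted by [[1/(n+1), +oo[], where [integral_h] gives a bound independent of
   [n]. *)
pose F (n : nat) := `[n.+1%:R^-1, +oo[%classic : set R.
have DF : D = \bigcup_n F n.
  apply/seteqP; split => [y|y [n _]]; rewrite /F /= !in_itv /= !andbT => y0.
    exists (Num.bound y^-1) => //=; rewrite in_itv /= andbT.
    rewrite invf_ple ?posrE //; apply: le_trans (ltW (archi_boundP _)) _.
      by rewrite invr_ge0 ltW.
    by rewrite ler_nat.
  by apply: lt_le_trans y0; rewrite invr_gt0.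
pose K : R := 4 * (2 * nu%:R) ^+ nu.
have K0 : 0 <= K by rewrite mulr_ge0 // exprn_ge0 // mulr_ge0.
apply: (@le_lt_trans _ _ K%:E); last exact: ltry.
rewrite DF.
have ndF : nondecreasing_seq F.
  move=> m n mn; apply/subsetPset => y; rewrite /F /= !in_itv /= !andbT; apply: le_trans.
  by rewrite lef_pV2 ?posrE // ler_nat ltnS.
have mFn n : measurable (F n) by exact: measurable_itv.
have cv : (\int[mu]_(y in F n) (chisq_density nu y)%:E @[n --> \oo] -->
    \int[mu]_(y in \bigcup_n F n) (chisq_density nu y)%:E)%E.
  apply: ge0_nondecreasing_set_cvg_integral => //.
  - by move=> n; exact: measurable_funS md.
  - by move=> n y _; rewrite lee_fin chisq_density_ge0.
apply: (cvge_to_le cv); apply: nearW => n.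
have ms : measurable_fun setT (@Num.sqrt R).
  by apply: nondecreasing_measurable => // x y; exact: ler_wsqrtr.
have mh : measurable_fun setT (EFin \o h).
  apply/measurable_EFinP; apply: measurable_funM; apply: measurable_fun_invr.
    by apply: measurable_funX; exact: measurable_funD.
  exact: measurable_funM.
apply: (@le_trans _ _ (\int[mu]_(y in F n) (K%:E * (h y)%:E))%E).
  apply: ge0_le_integral => //.
  - exact: mFn.
  - by move=> y _; rewrite lee_fin chisq_density_ge0.
  - exact: measurable_funS md.
  - by apply: measurable_funeM; exact: measurable_funS mh.
  - move=> y; rewrite /F /= in_itv /= andbT => ny; rewrite lee_fin.
    by apply: chisq_density_le => //; apply: lt_le_trans ny; rewrite invr_gt0.
rewrite ge0_integralZl //.
- rewrite -[leRHS]mule1 lee_wpmul2l ?lee_fin //.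
  by apply: integral_h; rewrite invr_gt0.
- exact: mFn.
- exact: measurable_funS mh.
- by move=> y _; rewrite lee_fin h_ge0.
Qed.

(** On [[1, 2]] the density is at least [y^-1 exp (-1) >= exp (-1) / 2], because the exponent
    [nu/2 - 1] is at least -1. *)
Lemma chisq_mass_gt0 nu : (0 < nu)%N -> 0 < \int[mu]_(y in D) chisq_density nu y.
Proof.
move=> nu0.
have iD := chisq_density_integrable nu0.
have md := measurable_int _ iD.
have sub : `[1, 2]%classic `<=` D.
  by move=> y /=; rewrite !in_itv /= andbT => /andP[y1 _]; exact: lt_le_trans y1.
have : ((expR (- 1) / 2)%:E <= \int[mu]_(y in D) (chisq_density nu y)%:E)%E.
  apply: (@le_trans _ _ (\int[mu]_(y in `[1%R, 2%R]) (chisq_density nu y)%:E)%E); last first.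
    apply: ge0_subset_integral => //.
    by move=> y _; rewrite lee_fin chisq_density_ge0.
  have m12 : mu `[1, 2]%classic = 1%:E.
    by rewrite lebesgue_measure_itv /= lte_fin ltr1n -EFinB; congr (_%:E); ring.
  apply: (@le_trans _ _ (\int[mu]_(y in `[1%R, 2%R]) (expR (- 1) / 2)%:E)%E).
    rewrite integral_cst // [X in (_ <= _ * X)%E](_ : _ = 1%E) ?mule1 //; exact: m12.
  apply: ge0_le_integral => //.
  - by apply: (measurable_funS _ sub md).
  - move=> y; rewrite /= in_itv /= => /andP[y1 y2]; rewrite lee_fin /chisq_density mulrC.
    apply: ler_pM; rewrite ?expR_ge0 //.
      apply: (@le_trans _ _ (y `^ (-1))).
        by rewrite powR_inv1 ?(le_trans ler01) // lef_pV2 ?posrE // (lt_le_trans ltr01).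
      by rewrite ler_powR // lerBrDl subrr divr_ge0.
    by rewrite ler_expR lerN2; lra.
move=> h1; rewrite -lte_fin fineK; last exact: (integrable_fin_num _ iD).
by apply: lt_le_trans h1; rewrite lte_fin divr_gt0 ?expR_gt0.
Qed.

(** With [c = 1 + 2j], the factor [exp (- j y)] turns [exp (- y/2)] into [exp (- c y/2)], and
    rescaling by [c] yields [c^(-nu/2)], written through [ln] like the determinants in
    [rows_laplace]. *)
Lemma chisq_laplace nu j : (0 < nu)%N ->
  \int[mu]_(y in D) (expR (- y) ^+ j * chisq_density nu y) =
  expR (- (ln ((1 + 2 * j%:R) ^+ nu) / 2)) * \int[mu]_(y in D) chisq_density nu y.
Proof.
move=> nu0; set c : R := 1 + 2 * j%:R.
have c0 : 0 < c by rewrite ltr_pwDl // mulr_ge0.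
have md : measurable_fun setT (EFin \o @chisq_density R nu).
  by apply/measurable_EFinP; exact: chisq_density_measurable.
have iD := chisq_density_integrable nu0.
have scaled y : D y -> chisq_density nu (c * y) =
    expR (ln (c ^+ nu) / 2) / c * (expR (- y) ^+ j * chisq_density nu y).
  rewrite /= in_itv /= andbT => y0.
  rewrite /chisq_density powRM ?(ltW c0) ?(ltW y0) //.
  have -> : expR (- (c * y / 2)) = expR (- y) ^+ j * expR (- (y / 2)).
    rewrite -expRM_natl -expRD; congr expR; rewrite /c; by field.
  have -> : c `^ (nu%:R / 2 - 1) = expR (ln (c ^+ nu) / 2) / c.
    rewrite /powR gt_eqF // lnXn // mulrBl mul1r expRD expRN lnK ?posrE //.
    by congr (expR _ / _); rewrite -mulr_natl; ring.
  ring.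
have e0 : expR (ln (c ^+ nu) / 2) != 0 by rewrite gt_eqF ?expR_gt0.
set X := \int[mu]_(y in D) (_ * _).
have ij : mu.-integrable D (EFin \o (fun y => expR (- y) ^+ j * chisq_density nu y)).
  apply: (le_integrable _ _ _ iD) => //.
    apply/measurable_EFinP; apply: measurable_funTS; apply: measurable_funM => //.
      by apply: measurable_funX; apply: measurableT_comp.
    exact: chisq_density_measurable.
  move=> y; rewrite /= in_itv /= andbT => y0; rewrite lee_fin normrM ler_piMl // normrX.
  by rewrite exprn_ile1 // ger0_norm ?expR_ge0 // -expR0 ler_expR oppr_le0 ltW.
suff : \int[mu]_(y in D) chisq_density nu y = expR (ln (c ^+ nu) / 2) * X.
  by move=> ->; rewrite expRN mulKf.
rewrite [LHS]/Rintegral (integral_scale c0 md); last first.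
  by move=> y; rewrite lee_fin chisq_density_ge0.
have -> : (\int[mu]_(y in D) (EFin \o chisq_density nu) (c * y)%R =
    \int[mu]_(y in D) (expR (ln (c ^+ nu) / 2) / c * (expR (- y) ^+ j * chisq_density nu y))%:E)%E.
  by apply: eq_integral => y /set_mem yD /=; rewrite scaled.
rewrite -[(\int[mu]_(y in D) _)%E]fineK.
  rewrite -EFinM /=; set k := expR (ln (c ^+ nu) / 2) in e0 *.
  transitivity (c * \int[mu]_(y in D) (k / c * (expR (- y) ^+ j * chisq_density nu y))) => //.
  by rewrite RintegralZl // -/X; field; rewrite gt_eqF.
by apply: integrable_fin_num => //; exact: (integrableZl _ _ ij).
Qed.

End chisq.

(** * From the moments of [exp (-Q)] to distribution functions *)

Section laplace_to_cdf.
Context {d : measure_display} {Omega : measurableType d} {R : realType}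
  (P : probability Omega R).
Local Notation rint X := (P.-integrable setT (EFin \o X)).
Local Notation mu := (@lebesgue_measure R).
Local Notation D := (`]0, +oo[%classic : set R).
Variables (nu : nat) (Q : nat -> Omega -> R).
Hypothesis nu0 : (0 < nu)%N.
Hypothesis mQ : forall k, measurable_fun setT (Q k).
Hypothesis Q0 : forall k w, 0 <= Q k w.
Hypothesis QL : forall j, \int[P]_w (expR (- Q k w) ^+ j) @[k --> \oo] -->
  expR (- (ln ((1 + 2 * j%:R) ^+ nu) / 2)).

Let dens := @chisq_density R nu.
Let I0 := \int[mu]_(y in D) dens y.
Let Lam (phi : R -> R) := (\int[mu]_(y in D) (phi y * dens y)) / I0.
Let dint phi := mu.-integrable D (EFin \o (fun y => phi y * dens y)).

Let mD : @measurable _ (measurableTypeR R) D.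
Proof. exact: measurable_itv. Qed.

Let I0_gt0 : 0 < I0. Proof. exact: chisq_mass_gt0. Qed.

Let dint_bounded (phi : R -> R) (c : R) : measurable_fun setT phi ->
  (forall y, D y -> `|phi y| <= c) -> dint phi.
Proof.
move=> mphi phic; have iD := chisq_density_integrable (R := R) nu0.
have c0 : 0 <= c by apply: le_trans (phic 1 _); rewrite //= in_itv /= ltr01.
have : mu.-integrable D (fun y => c%:E * (dens y)%:E)%E by exact: integrableZl.
apply: le_integrable => //.
  apply/measurable_EFinP; apply: measurable_funTS; apply: measurable_funM => //.
  exact: chisq_density_measurable.
move=> y Dy; rewrite /= lee_fin !normrM (ger0_norm c0) ler_wpM2r //; exact: phic.
Qed.

Let Lam_le phi psi : dint phi -> dint psi -> (forall y, D y -> phi y <= psi y) ->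
  Lam phi <= Lam psi.
Proof.
move=> i1 i2 h; rewrite ler_wpM2r ?invr_ge0 ?(ltW I0_gt0) //; apply: le_Rintegral => //.
by move=> y Dy; rewrite ler_wpM2r ?h //; exact: chisq_density_ge0.
Qed.

Let LamD phi psi : dint phi -> dint psi -> Lam (fun y => phi y + psi y) = Lam phi + Lam psi.
Proof.
move=> i1 i2; rewrite /Lam -mulrDl -RintegralD //; congr (_ / _).
by apply: eq_Rintegral => y _; rewrite mulrDl.
Qed.

Let LamZ c phi : dint phi -> Lam (fun y => c * phi y) = c * Lam phi.
Proof.
move=> i1; rewrite /Lam mulrA -RintegralZl //; congr (_ / _).
by apply: eq_Rintegral => y _; rewrite mulrA.
Qed.

Let dintD phi psi : dint phi -> dint psi -> dint (fun y => phi y + psi y).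
Proof.
move=> i1 i2; have := integrableD mD i1 i2.
by apply: eq_integrable => // y _ /=; rewrite -EFinD mulrDl.
Qed.

Let dintZ c phi : dint phi -> dint (fun y => c * phi y).
Proof.
move=> i1; have := integrableZl mD c i1.
by apply: eq_integrable => // y _ /=; rewrite -EFinM mulrA.
Qed.

Let Y k w := expR (- Q k w).

Let Y01 k w : 0 <= Y k w <= 1.
Proof. by rewrite expR_ge0 /= -expR0 ler_expR oppr_le0. Qed.

Let mY k : measurable_fun setT (Y k).
Proof. by apply: measurableT_comp => //; apply: measurableT_comp. Qed.

(** The extra power [j] closes the induction on the polynomial: the factor ['X] in [p * 'X + c] only
    raises [j]. *)
Let poly_cvg (p : {poly R}) j :
  [/\ forall k, rint (fun w => Y k w ^+ j * p.[Y k w]),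
      dint (fun y => expR (- y) ^+ j * p.[expR (- y)]) &
      \int[P]_w (Y k w ^+ j * p.[Y k w]) @[k --> \oo] -->
        Lam (fun y => expR (- y) ^+ j * p.[expR (- y)])].
Proof.
have rY i k : rint (fun w => Y k w ^+ i).
  apply: (@rint_bounded _ _ _ _ _ 1); first exact: measurable_funX.
  move=> w; have /andP[y0 y1] := Y01 k w.
  by rewrite ger0_norm ?exprn_ge0 ?exprn_ile1.
have dY i : dint (fun y => expR (- y) ^+ i).
  apply: (@dint_bounded _ 1).
    by apply: measurable_funX; apply: measurableT_comp.
  move=> y; rewrite /= in_itv /= andbT => y0; rewrite ger0_norm ?exprn_ge0 ?expR_ge0 //.
  by rewrite exprn_ile1 ?expR_ge0 // -expR0 ler_expR oppr_le0 ltW.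
have LamY i : Lam (fun y => expR (- y) ^+ i) = expR (- (ln ((1 + 2 * i%:R) ^+ nu) / 2)).
  by rewrite /Lam /dens chisq_laplace // mulfK // gt_eqF.
elim/poly_ind: p j => [|p c IH] j.
  have zY k : (fun w => Y k w ^+ j * 0.[Y k w]) = fun=> 0.
    by apply/funext => w; rewrite horner0 mulr0.
  have zE : (fun y : R => expR (- y) ^+ j * 0.[expR (- y)]) = fun y => 0 * expR (- y) ^+ 0.
    by apply/funext => y; rewrite horner0 mulr0 mul0r.
  rewrite zE LamZ // mul0r; split; [by move=> k; rewrite zY; exact: rint_cst|exact: dintZ|].
  by under eq_fun do rewrite zY expect_cst; exact: cvg_cst.
have [r1 d1 c1] := IH j.+1.
have eY k : (fun w => Y k w ^+ j * (p * 'X + c%:P).[Y k w]) =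
    fun w => Y k w ^+ j.+1 * p.[Y k w] + c * Y k w ^+ j.
  by apply/funext => w; rewrite !hornerE exprS; ring.
have eE : (fun y : R => expR (- y) ^+ j * (p * 'X + c%:P).[expR (- y)]) =
    fun y => expR (- y) ^+ j.+1 * p.[expR (- y)] + c * expR (- y) ^+ j.
  by apply/funext => y; rewrite !hornerE exprS; ring.
rewrite eE LamD //; last exact: dintZ.
rewrite LamZ //; split.
- by move=> k; rewrite eY; apply: rintD => //; exact: rintZ.
- by apply: dintD => //; exact: dintZ.
- rewrite (_ : (fun k => _) = fun k => \int[P]_w (Y k w ^+ j.+1 * p.[Y k w])
      + c * \int[P]_w (Y k w ^+ j)).
    by apply: cvgD c1 _; apply: cvgM; [exact: cvg_cst|rewrite LamY; exact: QL].
  apply/funext => k; rewrite -expectZ // -expectD //; last exact: rintZ.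
  by apply: eq_Rintegral => w _; rewrite !hornerE exprS; ring.
Qed.

(* A Lipschitz cut-off of the indicator of [u >= u2], vanishing below [u1]. *)
Let cut (u1 u2 u : R) := Num.min 1 (Num.max 0 ((u - u1) / (u2 - u1))).

Let cut01 u1 u2 u : 0 <= cut u1 u2 u <= 1.
Proof. by rewrite /cut le_min ler01 le_max lexx /= ge_min lexx. Qed.

Let cut_lipschitz u1 u2 x y : u1 < u2 ->
  `|cut u1 u2 x - cut u1 u2 y| <= (u2 - u1)^-1 * `|x - y|.
Proof.
move=> u12; have u0 : 0 < (u2 - u1)^-1 by rewrite invr_gt0 subr_gt0.
have -> : (u2 - u1)^-1 * `|x - y| = `|(x - u1) / (u2 - u1) - (y - u1) / (u2 - u1)|.
  by rewrite -mulrBl normrM (gtr0_norm u0) mulrC; congr (`|_| * _); ring.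
rewrite /cut; move: (_ / _) ((y - u1) / _) => a b.
wlog ab : a b / a <= b.
  move=> H; have [/H//|/ltW/H h] := leP a b.
  by rewrite distrC [leRHS]distrC.
have m (c : R) : [\/ c <= 0 /\ Num.min 1 (Num.max 0 c) = 0,
    0 <= c <= 1 /\ Num.min 1 (Num.max 0 c) = c | 1 <= c /\ Num.min 1 (Num.max 0 c) = 1].
  have [c0|c0] := leP c 0; first by constructor 1; rewrite min_r.
  have [c1|c1] := leP c 1; first by constructor 2; rewrite ltW // min_r.
  by constructor 3; split=> //; exact: ltW.
rewrite distrC [leRHS]distrC.
by case: (m a) => -[? ->]; case: (m b) => -[? ->]; rewrite !ger0_norm; lra.
Qed.

Let cut_measurable u1 u2 : measurable_fun setT (cut u1 u2).
Proof.
apply: measurable_minr => //; apply: measurable_maxr => //.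
by apply: measurable_funM => //; exact: measurable_funD.
Qed.

Lemma chisq_probE (A : set R) : measurable A -> chisq_prob nu A = Lam \1_A.
Proof.
move=> mA; rewrite /chisq_prob /Lam; congr (_ / _).
rewrite -[LHS]/(\int[mu]_(y in A `&` D) dens y) Rintegral_mkcondl.
apply: eq_Rintegral => y _; rewrite patchE indicE; case: ifPn => _.
  by rewrite mul1r.
by rewrite mul0r.
Qed.

(** In [u = exp (-q)] the event [q <= b] becomes [u >= exp (-b)]. The cut-off between [u1] and [u2]
    lies between the indicators of [q <= b1] and [q <= b2] and is approximated by a polynomial;
    three errors [e/4] stay below [e]. *)
Lemma chisq_sandwich (b1 b2 e : R) : b1 < b2 -> 0 < e ->
  \forall k \near \oo,
    fine (P [set w | Q k w <= b1]) <= chisq_prob nu [set y | y <= b2] + e /\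
    chisq_prob nu [set y | y <= b1] - e <= fine (P [set w | Q k w <= b2]).
Proof.
move=> b12 e0; pose u1 := expR (- b2); pose u2 := expR (- b1).
have u12 : u1 < u2 by rewrite ltr_expR ltrN2.
have L0 : 0 < (u2 - u1)^-1 by rewrite invr_gt0 subr_gt0.
have e4 : 0 < e / 4 by rewrite divr_gt0.
have [p pg] := lipschitz_poly_approx L0 e4 (fun x y => cut_lipschitz x y u12).
set g := cut u1 u2 in pg.
have mle (b : R) : measurable [set y : R | y <= b].
  by rewrite -set_itvNyc; exact: measurable_itv.
have mset k (b : R) : measurable [set w | Q k w <= b].
  rewrite (_ : [set w | _] = setT `&` Q k @^-1` [set y | y <= b]); last by rewrite setTI.
  exact: mQ.
have rg k : rint (fun w => g (Y k w)).
  apply: (@rint_bounded _ _ _ _ _ 1).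
    by apply: measurableT_comp; [exact: cut_measurable|exact: mY].
  by move=> w; have /andP[h0 h1] := cut01 u1 u2 (Y k w); rewrite ger0_norm.
have dg : dint (fun y => g (expR (- y))).
  apply: (@dint_bounded _ 1).
    apply: measurableT_comp; first exact: cut_measurable.
    by apply: measurableT_comp => //; apply: measurableT_comp.
  by move=> y _; have /andP[h0 h1] := cut01 u1 u2 (expR (- y)); rewrite ger0_norm.
have dA b : dint \1_[set y | y <= b].
  apply: (@dint_bounded _ 1); first exact: measurable_indic.
  by move=> y _; rewrite indicE; case: (_ \in _); rewrite ?normr1 ?normr0.
have dc (c : R) : dint (fun=> c).
  by apply: (@dint_bounded _ `|c|).
have Lamc (c : R) : Lam (fun=> c) = c.
  by rewrite /Lam RintegralZl // ?mulfK ?gt_eqF //; exact: chisq_density_integrable.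
have [rp dp cp] := poly_cvg p 0.
have cutge q : q <= b1 -> g (expR (- q)) = 1.
  move=> qb; rewrite /g /cut; apply/min_l; rewrite le_max; apply/orP; right.
  by rewrite ler_pdivlMr ?subr_gt0 // mul1r lerD2r ler_expR lerN2.
have cutle q : b2 < q -> g (expR (- q)) = 0.
  move=> qb; rewrite /g /cut max_l ?min_r //.
  by rewrite pmulr_lle0 // subr_le0 ler_expR lerN2 ltW.
have ind1 q : \1_[set y : R | y <= b1] q <= g (expR (- q)).
  have /andP[h0 _] := cut01 u1 u2 (expR (- q)).
  by rewrite indicE; have [/set_mem /= /cutge ->|_] := boolP (_ \in _).
have ind2 q : g (expR (- q)) <= \1_[set y : R | y <= b2] q.
  have /andP[_ h1] := cut01 u1 u2 (expR (- q)).
  rewrite indicE; have [_|] := boolP (_ \in _) => //.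
  by rewrite notin_setE /= => /negP; rewrite -ltNge => /cutle ->.
have LamB : `|Lam (fun y => expR (- y) ^+ 0 * p.[expR (- y)]) - Lam (fun y => g (expR (- y)))| <= e / 4.
  have pgy y : D y -> `|expR (- y) ^+ 0 * p.[expR (- y)] - g (expR (- y))| <= e / 4.
    rewrite /= in_itv /= andbT => y0; rewrite mul1r; apply: pg.
    by rewrite expR_ge0 /= -expR0 ler_expR oppr_le0 ltW.
  rewrite ler_norml; apply/andP; split.
    rewrite lerBrDr addrC -(Lamc (- (e / 4))) -LamD //; apply: Lam_le => //.
      exact: dintD.
    by move=> y /pgy; rewrite ler_norml => /andP[+ _]; lra.
  rewrite lerBlDr -(Lamc (e / 4)) -LamD //; apply: Lam_le => //.
    exact: dintD.
  by move=> y /pgy; rewrite ler_norml => /andP[_ +]; lra.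
have EB k : `|\int[P]_w (Y k w ^+ 0 * p.[Y k w]) - \int[P]_w g (Y k w)| <= e / 4.
  rewrite -expectB //; apply: le_trans (expect_norm (rintB (rp k) (rg k))) _.
  rewrite -[leRHS](expect_cst P); apply: expect_le.
  - exact: (integrable_norm (rintB (rp k) (rg k))).
  - exact: rint_cst.
  - by move=> w; rewrite mul1r; apply: pg; exact: Y01.
have fin k (b : R) : \int[P]_w \1_[set y | y <= b] (Q k w) = fine (P [set w | Q k w <= b]).
  by rewrite -expect_indic //; apply: eq_Rintegral.
have rA k (b : R) : rint (fun w => \1_[set y | y <= b] (Q k w)).
  by have := rint_indic P (mset k b).
move/cvgrPdist_le : cp => /(_ _ e4); apply: filterS => k.
rewrite !chisq_probE //.
have hk := EB k; move=> hc.
have h1 : fine (P [set w | Q k w <= b1]) <= \int[P]_w g (Y k w).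
  by rewrite -fin; apply: expect_le => // w; exact: ind1.
have h2 : \int[P]_w g (Y k w) <= fine (P [set w | Q k w <= b2]).
  by rewrite -fin; apply: expect_le => // w; exact: ind2.
have h3 : Lam \1_[set y | y <= b1] <= Lam (fun y => g (expR (- y))).
  by apply: Lam_le => // y _; exact: ind1.
have h4 : Lam (fun y => g (expR (- y))) <= Lam \1_[set y | y <= b2].
  by apply: Lam_le => // y _; exact: ind2.
move: hk hc LamB; rewrite !ler_norml => /andP[? ?] /andP[? ?] /andP[? ?].
by split; lra.
Qed.

End laplace_to_cdf.

(** * Sums of i.i.d. variables *)

Section iid.
Context {d : measure_display} {Omega : measurableType d} {R : realType}
  (P : probability Omega R).
Local Notation rint X := (P.-integrable setT (EFin \o X)).

Lemma same_law_integral (d' : measure_display) (T : measurableType d')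
    (X Y : Omega -> T) (f : T -> \bar R) :
  measurable_fun setT X -> measurable_fun setT Y ->
  (forall B, measurable B -> P (X @^-1` B) = P (Y @^-1` B)) ->
  measurable_fun setT f ->
  (\int[P]_w f (X w) = \int[P]_w f (Y w))%E.
Proof.
move=> mX mY XY mf.
pose X' : {mfun Omega >-> T} := HB.pack X (isMeasurableFun.Build _ _ _ _ X mX).
pose Y' : {mfun Omega >-> T} := HB.pack Y (isMeasurableFun.Build _ _ _ _ Y mY).
transitivity (\int[distribution P X']_y f y)%E; first by rewrite integral_distributionT.
transitivity (\int[distribution P Y']_y f y)%E; last by rewrite integral_distributionT.
by apply: eq_measure_integral => B mB _; exact: XY.
Qed.

Lemma same_law_rint (d' : measure_display) (T : measurableType d')
    (X Y : Omega -> T) (f : T -> R) :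
  measurable_fun setT X -> measurable_fun setT Y ->
  (forall B, measurable B -> P (X @^-1` B) = P (Y @^-1` B)) ->
  measurable_fun setT f -> rint (fun w => f (Y w)) -> rint (fun w => f (X w)).
Proof.
move=> mX mY XY mf /integrableP[_ h]; apply/integrableP; split.
  exact/measurable_EFinP/measurableT_comp.
rewrite (same_law_integral (f := fun y => `|(f y)%:E|%E) mX mY XY) //.
by apply: measurableT_comp => //; exact/measurable_EFinP.
Qed.

Lemma independent_pair_group (I : eqType) (K K1 K2 : set I)
    (F : I -> set (set Omega)) (d1 d2 : measure_display) (T1 : measurableType d1)
    (T2 : measurableType d2) (X : Omega -> T1) (Y : Omega -> T2) :
  mutually_independent P K F ->
  (forall i, K i -> F i `<=` measurable) ->
  (forall i, K i -> setI_closed (F i)) -> (forall i, K i -> F i setT) ->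
  K1 `<=` K -> K2 `<=` K -> K1 `&` K2 = set0 ->
  measurable_fun [set: g_sigma_algebraType (\bigcup_(i in K1) F i)] X ->
  measurable_fun [set: g_sigma_algebraType (\bigcup_(i in K2) F i)] Y ->
  independent_pair P X Y.
Proof.
move=> ind Fm FI FT K1K K2K K12 mX mY A B mA mB.
apply: (mutually_independent_group ind Fm FI FT K1K K2K K12).
  by have := mX measurableT A mA; rewrite setTI.
by have := mY measurableT B mB; rewrite setTI.
Qed.

Lemma sigma_of_measurable_fun (G : set (set Omega)) (d' : measure_display)
    (T : measurableType d') (X : Omega -> T) :
  sigma_of X `<=` G -> measurable_fun [set: g_sigma_algebraType G] X.
Proof.
by move=> XG _ B mB; rewrite setTI; apply: sub_sigma_algebra; apply: XG; exists B.
Qed.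

Section sequence.
Variable xi : nat -> Omega -> R.
Hypothesis xi_meas : forall k, (1 <= k)%N -> measurable_fun setT (xi k).
Hypothesis xi_ind : mutually_independent P [set k | (1 <= k)%N] (fun k => sigma_of (xi k)).
Hypothesis xi_law : forall k, (1 <= k)%N -> forall B : set R, measurable B ->
  P (xi k @^-1` B) = P (xi 1%N @^-1` B).

Lemma iid_rint (f : R -> R) k : (1 <= k)%N -> measurable_fun setT f ->
  rint (fun w => f (xi 1 w)) -> rint (fun w => f (xi k w)).
Proof.
by move=> k1 mf; apply: same_law_rint => //; [exact: xi_meas|exact: xi_meas|exact: xi_law].
Qed.

Lemma iid_expect (f : R -> R) k : (1 <= k)%N -> measurable_fun setT f ->
  \int[P]_w f (xi k w) = \int[P]_w f (xi 1 w).
Proof.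
move=> k1 mf; congr fine.
apply: (same_law_integral (f := EFin \o f)); [exact: xi_meas|exact: xi_meas|exact: xi_law|].
exact/measurable_EFinP.
Qed.

Let group (K1 K2 : set nat) (d1 d2 : measure_display) (T1 : measurableType d1)
    (T2 : measurableType d2) (X : Omega -> T1) (Y : Omega -> T2) :
  K1 `<=` [set k | (1 <= k)%N] -> K2 `<=` [set k | (1 <= k)%N] -> K1 `&` K2 = set0 ->
  measurable_fun [set: g_sigma_algebraType (\bigcup_(i in K1) sigma_of (xi i))] X ->
  measurable_fun [set: g_sigma_algebraType (\bigcup_(i in K2) sigma_of (xi i))] Y ->
  independent_pair P X Y.
Proof.
apply: (independent_pair_group xi_ind).
- by move=> i i1; apply: sigma_of_measurable; exact: xi_meas.
- by move=> i _; exact: setI_closed_sigma_of.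
- by move=> i _; exact: sigma_ofT.
Qed.

Lemma iid_independent_pair j k : (1 <= j)%N -> (1 <= k)%N -> j != k ->
  independent_pair P (xi j) (xi k).
Proof.
move=> j1 k1 jk; apply: (group (K1 := [set j]) (K2 := [set k])).
- by move=> _ ->.
- by move=> _ ->.
- by apply/seteqP; split => // i [/= -> /eqP]; rewrite (negbTE jk).
- by apply: sigma_of_measurable_fun => A XA; exists j.
- by apply: sigma_of_measurable_fun => A XA; exists k.
Qed.

Lemma iid_independent_sum k : (1 <= k)%N ->
  independent_pair P (xi k) (fun w => \sum_(1 <= j < k) xi j w).
Proof.
move=> k1; apply: (group (K1 := [set k]) (K2 := [set j | (1 <= j < k)%N])).
- by move=> _ ->.
- by move=> j /= /andP[].
- by apply/seteqP; split => // i [/= ->]; rewrite ltnn andbF.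
- by apply: sigma_of_measurable_fun => A XA; exists k.
- apply: measurable_fun_sum_nat => j jk.
  by apply: sigma_of_measurable_fun => A XA; exists j.
Qed.

End sequence.
End iid.

Section iid_limits.
Context {d : measure_display} {Omega : measurableType d} {R : realType}
  (P : probability Omega R).
Local Notation rint X := (P.-integrable setT (EFin \o X)).
Lemma dominated_expect_cvg (X_ : nat -> Omega -> R) (X Y : Omega -> R) :
  (forall n, measurable_fun setT (X_ n)) -> measurable_fun setT X ->
  {ae P, forall w, X_ n w @[n --> \oo] --> X w} -> rint Y ->
  (forall n w, `|X_ n w| <= Y w) ->
  \int[P]_w X_ n w @[n --> \oo] --> \int[P]_w X w.
Proof.
move=> mX_ mX cX iY XY.
have [] := @dominated_convergence _ _ _ P setT measurableT (fun n => EFin \o X_ n)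
  (EFin \o X) (EFin \o Y).
- by move=> n; exact/measurable_EFinP.
- exact/measurable_EFinP.
- apply: filterS cX => w h _; by apply: cvg_EFin; [exact: nearW|exact: h].
- exact: iY.
- by apply/aeW => w n _ /=; rewrite lee_fin.
move=> iX _ h; apply: fine_cvg; rewrite fineK; first exact: h.
exact: integrable_fin_num.
Qed.

Variable xi : nat -> Omega -> R.
Hypothesis xi_meas : forall k, (1 <= k)%N -> measurable_fun setT (xi k).
Hypothesis xi_ind : mutually_independent P [set k | (1 <= k)%N] (fun k => sigma_of (xi k)).
Hypothesis xi_law : forall k, (1 <= k)%N -> forall B : set R, measurable B ->
  P (xi k @^-1` B) = P (xi 1%N @^-1` B).
Hypothesis xi2 : sqint P (xi 1).

Let mu := \int[P]_w xi 1 w.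
Let v := \int[P]_w ((xi 1 w - mu) ^+ 2).

Lemma iid_sqint k : (1 <= k)%N -> sqint P (xi k).
Proof.
move=> k1; split; first exact: xi_meas.
apply: (iid_rint xi_meas xi_law (f := fun x => x ^+ 2) k1); last by case: xi2.
exact: measurable_funX.
Qed.

(** Index 0 is set to zero: the hypotheses concern [k >= 1], whereas the law of large numbers for
    orthogonal sums quantifies over all [k]. *)
Let zeta k w := if k == 0%N then 0 else xi k w - mu.

Let zeta2 k : sqint P (zeta k).
Proof.
case: k => [|k]; first exact: sqint_cst.
rewrite (_ : zeta _ = fun w => xi k.+1 w + (- mu)) //.
by apply: sqintD; [exact: iid_sqint|exact: sqint_cst].
Qed.

Let zeta_mean k : (1 <= k)%N -> \int[P]_w (xi k w - mu) = 0.
Proof.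
move=> k1; rewrite expectB; last 2 first.
  exact/sqint_rint/iid_sqint.
  exact: rint_cst.
rewrite (iid_expect xi_meas xi_law (f := fun x => x) k1) //.
by rewrite expect_cst subrr.
Qed.

Let zeta_orth j k : j != k -> \int[P]_w (zeta j w * zeta k w) = 0.
Proof.
case: j k => [|j] [|k] // jk.
- by under eq_Rintegral do rewrite mul0r; rewrite expect_cst.
- by under eq_Rintegral do rewrite mulr0; rewrite expect_cst.
have ind := iid_independent_pair xi_meas xi_ind (ltn0Sn j) (ltn0Sn k) jk.
pose f (z : R * R) : \bar R := ((z.1 - mu) * (z.2 - mu))%:E.
have mf : measurable_fun setT f.
  apply/measurable_EFinP; apply: measurable_funM; apply: measurable_funB => //.
have [h _] := independent_pair_integral (xi_meas (ltn0Sn j)) (xi_meas (ltn0Sn k)) ind mf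
   (sqint_mul (zeta2 j.+1) (zeta2 k.+1)).
rewrite /Rintegral -[LHS]/(fine (\int[P]_w f (xi j.+1 w, xi k.+1 w))%E) h.
rewrite (_ : (fun y => _) = fun=> 0%E) ?integral0 //.
apply/funext => w; rewrite /f /=.
have ij : rint (fun w' => xi j.+1 w' - mu) := sqint_rint (zeta2 j.+1).
under eq_integral do rewrite mulrC.
rewrite EFin_expect; last exact: rintZ.
by rewrite expectZ // zeta_mean // mulr0.
Qed.

Let v_ge0 : 0 <= v. Proof. by apply: Rintegral_ge0 => w _; exact: sqr_ge0. Qed.

Let zeta_var k : \int[P]_w (zeta k w ^+ 2) <= v.
Proof.
case: k => [|k].
  by under eq_Rintegral do rewrite expr0n /=; rewrite expect_cst.
rewrite le_eqVlt; apply/orP; left; apply/eqP.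
apply: (iid_expect xi_meas xi_law (f := fun x => (x - mu) ^+ 2)) => //.
by apply: measurable_funX; exact: measurable_funB.
Qed.

Lemma iid_block_sum m n : (1 <= m)%N ->
  \int[P]_w ((\sum_(m <= k < n) (xi k w - mu)) ^+ 2) <= (n - m)%:R * v.
Proof.
move=> m1; apply: le_trans (orthogonal_block_sum zeta2 zeta_orth zeta_var m n).
rewrite le_eqVlt; apply/orP; left; apply/eqP; apply: eq_Rintegral => w _; congr (_ ^+ 2).
apply: eq_big_nat => k /andP[mk _].
by rewrite /zeta; case: k mk => // mk; move: (leq_trans m1 mk).
Qed.

Lemma iid_lln :
  {ae P, forall w, (\sum_(1 <= k < n.+1) xi k w) / n%:R @[n --> \oo] --> mu}.
Proof.
have [N [mN N0 h]] := orthogonal_lln zeta2 zeta_orth zeta_var.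
exists N; split => // w /= nh; apply: h => /= hw; apply: nh.
have : (\sum_(1 <= k < n.+1) zeta k w) / n%:R + mu @[n --> \oo] --> 0 + mu.
  by apply: cvgD hw _; exact: cvg_cst.
rewrite add0r; apply: cvg_trans; apply: near_eq_cvg; near=> n.
have n0 : (0 < n)%N by near: n; exists 1%N.
have -> : \sum_(1 <= k < n.+1) zeta k w = \sum_(1 <= k < n.+1) (xi k w - mu).
  by apply: eq_big_nat => -[|k].
rewrite sumrB sumr_const_nat subSS subn0 mulrBl -[mu *+ n]mulr_natr mulfK ?subrK //.
by rewrite pnatr_eq0 -lt0n.
Unshelve. all: by end_near. Qed.

Let clt_scale (c : R) : 0 < c -> (Num.sqrt (n%:R * c))^-1 @[n --> \oo] --> 0.
Proof.
move=> c0; apply/cvgrPdist_lt => e e0; near=> n.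
have n0 : 0 < n%:R :> R by rewrite ltr0n; near: n; exists 1%N.
rewrite sub0r normrN ger0_norm ?invr_ge0 ?sqrtr_ge0 //.
rewrite invf_plt ?posrE ?sqrtr_gt0 ?mulr_gt0 // -[ltLHS]ger0_norm ?invr_ge0 ?ltW //.
rewrite -sqrtr_sqr ltr_sqrt ?mulr_gt0 // -ltr_pdivrMr //; near: n.
exact: nbhs_infty_gtr.
Unshelve. all: by end_near. Qed.

(** Each normalised term has variance [1/n], so [n] of them run the heat flow for time 1. The total
    error is [K (1/n + n ep)] with [K] depending on [th] alone, whence the uniformity in [a] and
    [m]. *)
Lemma iid_clt (s2 th e : R) : \int[P]_w xi 1 w = 0 -> \int[P]_w (xi 1 w ^+ 2) = s2 ->
  0 < s2 -> 0 < e ->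
  \forall n \near \oo, forall a m, 0 <= a <= th ->
    `|\int[P]_w heat a 0 ((\sum_(1 <= k < n.+1) xi k w) / Num.sqrt (n%:R * s2) + m)
      - heat a 1 m| <= e.
Proof.
move=> m0 ms s0 e0.
pose eta (n k : nat) w := (Num.sqrt (n%:R * s2))^-1 * xi k w.
pose ep n := \int[P]_w Num.min (eta n 1%N w ^+ 2) (`|eta n 1%N w| ^+ 3).
have eta2 n k : (1 <= k)%N -> sqint P (eta n k) by move=> k1; exact/sqintZ/iid_sqint.
have eta_sq n k w : (0 < n)%N -> eta n k w ^+ 2 = xi k w ^+ 2 / s2 / n%:R.
  move=> n0; have n0' : 0 < n%:R :> R by rewrite ltr0n.
  rewrite /eta exprMn exprVn sqr_sqrtr ?mulr_ge0 ?ltW //.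
  by field; rewrite !gt_eqF.
(* Lindeberg's condition by dominated convergence: [n] times the minimum is at most [xi^2 / s2], and
   it tends to 0 pointwise because its cubic bound is of order [n^(-1/2)]. *)
have nep : n%:R * ep n @[n --> \oo] --> 0.
  have -> : (fun n => n%:R * ep n) =
     (fun n => \int[P]_w (n%:R * Num.min (eta n 1%N w ^+ 2) (`|eta n 1%N w| ^+ 3))).
    by apply/funext => n; rewrite expectZ //; exact/rint_min_pow/eta2.
  rewrite -[X in _ --> X](expect_cst P).
  apply: (dominated_expect_cvg (Y := fun w => xi 1 w ^+ 2 / s2)).
  - move=> n; apply: measurable_funM => //; apply: measurable_fun_min_pow.
    by case: (eta2 n 1%N (leqnn _)).
  - exact: measurable_cst.
  - apply/aeW => w; apply: (@squeeze_cvgr _ _ _ _ (fun=> 0) 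
        (fun n => `|xi 1 w| ^+ 3 / s2 * (Num.sqrt (n%:R * s2))^-1)).
    + near=> n; have n0 : (0 < n)%N by near: n; exists 1%N.
      have n0' : 0 < n%:R :> R by rewrite ltr0n.
      have sn : 0 < Num.sqrt (n%:R * s2) by rewrite sqrtr_gt0 mulr_gt0.
      apply/andP; split.
        by apply: mulr_ge0 => //; rewrite le_min sqr_ge0 exprn_ge0.
      apply: le_trans (ler_wpM2l (ltW n0') (_ : _ <= `|eta n 1%N w| ^+ 3)) _.
        by rewrite ge_min lexx orbT.
      rewrite /eta normrM normfV (gtr0_norm sn) exprMn exprVn.
      rewrite (exprSr _ 2) (sqr_sqrtr (ltW (mulr_gt0 n0' s0))).
      rewrite le_eqVlt; apply/orP; left; apply/eqP; field.
      by rewrite !gt_eqF.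
    + exact: cvg_cst.
    + rewrite -[X in _ --> X](mulr0 (`|xi 1 w| ^+ 3 / s2)); apply: cvgMr.
      exact: clt_scale.
  - have [_ i2] := xi2; have := rintZ s2^-1 i2.
    by congr (P.-integrable _ _); apply/funext => w /=; rewrite mulrC.
  - move=> n w; have [->|n0] := posnP n.
      by rewrite mul0r normr0 mulr_ge0 ?sqr_ge0 ?invr_ge0 ?ltW.
    rewrite ger0_norm; last by apply: mulr_ge0 => //; rewrite le_min sqr_ge0 exprn_ge0.
    apply: le_trans (ler_wpM2l _ (_ : _ <= eta n 1%N w ^+ 2)) _ => //.
      by rewrite ge_min lexx.
    by rewrite eta_sq // mulrC mulfVK // pnatr_eq0 -lt0n.
pose K : R := 31 * (1 + th) ^+ 2.
have cK : K * (n%:R^-1 + n%:R * ep n) @[n --> \oo] --> 0.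
  rewrite -[X in _ --> X](mulr0 K); apply: cvgMr; rewrite -[X in _ --> X](addr0 0).
  apply: cvgD nep; apply/cvgrPdist_lt => r r0; near=> n.
  rewrite sub0r normrN ger0_norm // invf_plt ?posrE //.
    by near: n; exact: nbhs_infty_gtr.
  by rewrite ltr0n; near: n; exists 1%N.
near=> n => a m ath.
have n0 : (0 < n)%N by near: n; exists 1%N.
have n0' : 0 < n%:R :> R by rewrite ltr0n.
have le_e : K * (n%:R^-1 + n%:R * ep n) <= e.
  apply: le_trans (ler_norm _) _; near: n.
  by move/cvgr0Pnorm_le : cK; apply.
have hyp k : (1 <= k <= n)%N -> [/\ sqint P (eta n k), \int[P]_w eta n k w = 0,
     \int[P]_w (eta n k w ^+ 2) = n%:R^-1,
     \int[P]_w Num.min (eta n k w ^+ 2) (`|eta n k w| ^+ 3) <= ep n &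
     independent_pair P (eta n k) (fun w => \sum_(1 <= j < k) eta n j w)].
  move=> /andP[k1 kn]; split.
  - exact: eta2.
  - rewrite expectZ; last exact/sqint_rint/iid_sqint.
    by rewrite (iid_expect xi_meas xi_law (f := fun x => x) k1) // m0 mulr0.
  - rewrite (_ : (fun w => _) = fun w => s2^-1 / n%:R * xi k w ^+ 2); last first.
      by apply/funext => w; rewrite eta_sq // -mulrA mulrC.
    rewrite expectZ; last by case: (iid_sqint k1).
    rewrite (iid_expect xi_meas xi_law (f := fun x => x ^+ 2) k1); last exact: measurable_funX.
    by rewrite ms mulrAC mulVf ?mul1r // gt_eqF.
  - rewrite le_eqVlt; apply/orP; left; apply/eqP.
    apply: (iid_expect xi_meas xi_law (f := fun x => Num.min 
      (((Num.sqrt (n%:R * s2))^-1 * x) ^+ 2) (`|(Num.sqrt (n%:R * s2))^-1 * x| ^+ 3))) => //.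
    by apply: measurable_fun_min_pow; exact: measurable_funM.
  - move=> A B mA mB.
    pose g (x : R) := (Num.sqrt (n%:R * s2))^-1 * x.
    have mg : measurable_fun setT g by exact: measurable_funM.
    rewrite (_ : (fun w => \sum_(1 <= j < k) eta n j w) =
       (fun w => g (\sum_(1 <= j < k) xi j w))); last first.
      by apply/funext => w; rewrite /g mulr_sumr.
    have mgi C : measurable C -> measurable (g @^-1` C).
      by move=> mC; rewrite -[_ @^-1` _]setTI; exact: mg.
    exact: (iid_independent_sum xi_meas xi_ind k1 (mgi A mA) (mgi B mB)).
have := lindeberg_heat m ath (_ : 0 <= n%:R^-1) hyp (lexx 0).
rewrite add0r mulfV ?gt_eqF // => h.
have -> : (fun w => heat a 0 ((\sum_(1 <= k < n.+1) xi k w) / Num.sqrt (n%:R * s2) + m)) =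
  (fun w => heat a 0 (\sum_(1 <= k < n.+1) eta n k w + m)).
  by apply/funext => w; rewrite mulrC /eta mulr_sumr.
apply: le_trans (h _) _; first by rewrite invr_ge0 ltW.
apply: le_trans le_e; rewrite le_eqVlt; apply/orP; left; apply/eqP.
by rewrite /K; field; rewrite ?pnatr_eq0 -?lt0n.
Unshelve. all: by end_near. Qed.

End iid_limits.

(** * Convergence in probability and random indices *)

Section in_probability.
Context {d : measure_display} {Omega : measurableType d} {R : realType}
  (P : probability Omega R).
Implicit Types (X Y : nat -> Omega -> R) (E F : nat -> Omega -> Prop).

(* Bounding the exceptional event by a measurable set makes this insensitive to
   the measurability of [E]. *)
Definition whp E := forall r : R, 0 < r -> \forall j \near \oo,
  exists2 A : set Omega, measurable A & (P A <= r%:E)%E /\ forall w, ~ A w -> E j w.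

Lemma whp_near E : (\forall j \near \oo, forall w, E j w) -> whp E.
Proof.
move=> h r r0; apply: filterS h => j h; exists set0 => //.
by rewrite measure0 lee_fin ltW.
Qed.

Lemma whp_and E F : whp E -> whp F -> whp (fun j w => E j w /\ F j w).
Proof.
move=> hE hF r r0; have r20 : 0 < r / 2 by rewrite divr_gt0.
near=> j.
have [A mA [PA EA]] : exists2 A : set Omega, measurable A &
    (P A <= (r / 2)%:E)%E /\ forall w, ~ A w -> E j w by near: j; exact: hE.
have [B mB [PB FB]] : exists2 A : set Omega, measurable A &
    (P A <= (r / 2)%:E)%E /\ forall w, ~ A w -> F j w by near: j; exact: hF.
exists (A `|` B); first exact: measurableU.
split; last by move=> w /not_orP[nA nB]; split; [exact: EA|exact: FB].
apply: le_trans (measureU2 _ mA mB) _; rewrite [r]splitr EFinD.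
exact: leeD PA PB.
Unshelve. all: by end_near. Qed.

Lemma whp_impl E F : (\forall j \near \oo, forall w, E j w -> F j w) -> whp E -> whp F.
Proof.
move=> EF hE r r0; apply: filterS2 EF (hE r r0) => j EF [A mA [PA EA]].
by exists A => //; split => // w /EA /EF.
Qed.

Definition small X := forall e : R, 0 < e -> whp (fun j w => `|X j w| <= e).

Definition tight X := forall r : R, 0 < r -> exists2 K : R, 0 < K & \forall j \near \oo,
  exists2 A : set Omega, measurable A & (P A <= r%:E)%E /\ forall w, ~ A w -> `|X j w| <= K.

Lemma small_ext X Y : whp (fun j w => X j w = Y j w) -> small X -> small Y.
Proof.
move=> XY hX e e0; apply: whp_impl (whp_and XY (hX e e0)).
by apply: nearW => j w [->].
Qed.

Lemma smallD X Y : small X -> small Y -> small (fun j w => X j w + Y j w).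
Proof.
move=> hX hY e e0; have e20 : 0 < e / 2 by rewrite divr_gt0.
apply: whp_impl (whp_and (hX _ e20) (hY _ e20)); apply: nearW => j w [hx hy].
by rewrite [e]splitr (le_trans (ler_normD _ _)) ?lerD.
Qed.

Lemma smallN X : small X -> small (fun j w => - X j w).
Proof.
move=> hX e e0; apply: whp_impl (hX e e0); apply: nearW => j w.
by rewrite normrN.
Qed.

Lemma smallB X Y : small X -> small Y -> small (fun j w => X j w - Y j w).
Proof. by move=> hX /smallN; exact: smallD. Qed.

Lemma small_sum_nat m n (X : nat -> nat -> Omega -> R) :
  (forall i, (m <= i < n)%N -> small (X i)) -> small (fun j w => \sum_(m <= i < n) X i j w).
Proof.
move=> hX; elim: n hX => [|n IH] hX.
  by move=> e e0; apply: whp_near; apply: nearW => j w; rewrite big_geq // normr0 ltW.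
have [mn|nm] := leqP m n; last first.
  by move=> e e0; apply: whp_near; apply: nearW => j w; rewrite big_geq // normr0 ltW.
have h1 : small (fun j w => \sum_(m <= i < n) X i j w).
  by apply: IH => i /andP[mi i_n]; apply: hX; rewrite mi ltnW.
have h2 : small (X n) by apply: hX; rewrite mn ltnSn.
apply: small_ext (smallD h1 h2).
by apply: whp_near; apply: nearW => j w; rewrite big_nat_recr.
Qed.

Lemma small_tight X : small X -> tight X.
Proof. by move=> hX r r0; exists 1 => //; exact: hX. Qed.

Lemma tight_cst (c : R) : tight (fun=> fun=> c).
Proof.
move=> r r0; exists (1 + `|c|); first by rewrite ltr_wpDr.
apply: nearW => j; exists set0 => //; rewrite measure0 lee_fin ltW //; split => // w _.
by rewrite lerDr.
Qed.

Lemma tightD X Y : tight X -> tight Y -> tight (fun j w => X j w + Y j w).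
Proof.
move=> hX hY r r0; have r20 : 0 < r / 2 by rewrite divr_gt0.
have [K K0 hK] := hX _ r20; have [L L0 hL] := hY _ r20.
exists (K + L); first exact: addr_gt0.
apply: filterS2 hK hL => j [A mA [PA XA]] [B mB [PB YB]].
exists (A `|` B); first exact: measurableU.
split; last first.
  by move=> w /not_orP[/XA hx /YB hy]; rewrite (le_trans (ler_normD _ _)) ?lerD.
by apply: le_trans (measureU2 _ mA mB) _; rewrite [r]splitr EFinD; exact: leeD PA PB.
Qed.

Lemma tight_sum_nat m n (X : nat -> nat -> Omega -> R) :
  (forall i, (m <= i < n)%N -> tight (X i)) -> tight (fun j w => \sum_(m <= i < n) X i j w).
Proof.
have t0 n' : (n' <= m)%N -> tight (fun j w => \sum_(m <= i < n') X i j w).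
  move=> nm; have := tight_cst 0; congr tight; apply/funext => j; apply/funext => w.
  by rewrite big_geq.
move=> hX; elim: n hX => [|n IH] hX; first exact: t0.
have [mn|nm] := leqP m n; last exact: t0.
have h1 : tight (fun j w => \sum_(m <= i < n) X i j w).
  by apply: IH => i /andP[mi i_n]; apply: hX; rewrite mi ltnW.
have h2 : tight (X n) by apply: hX; rewrite mn ltnSn.
have := tightD h1 h2; congr tight; apply/funext => j; apply/funext => w.
by rewrite big_nat_recr.
Qed.

Lemma tightM_small X Y : tight X -> small Y -> small (fun j w => X j w * Y j w).
Proof.
move=> hX hY e e0 r r0; have r20 : 0 < r / 2 by rewrite divr_gt0.
have [K K0 hK] := hX _ r20.
have hL := hY _ (divr_gt0 e0 K0) _ r20.
apply: filterS2 hK hL => j [A mA [PA XA]] [B mB [PB YB]].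
exists (A `|` B); first exact: measurableU.
split; last first.
  move=> w /not_orP[/XA hx /YB hy]; rewrite normrM.
  have -> : e = K * (e / K) by rewrite mulrC divfK ?gt_eqF.
  exact: ler_pM.
by apply: le_trans (measureU2 _ mA mB) _; rewrite [r]splitr EFinD; exact: leeD PA PB.
Qed.

(** [X^2 A - Y^2 B = A ((X - Y) + 2 Y) (X - Y) + Y^2 (A - B)], and each summand is a tight factor
    times a small one. *)
Lemma small_sqr_mul X Y A B (l : R) :
  small (fun j w => X j w - Y j w) -> tight Y ->
  small (fun j w => A j w - l) -> small (fun j w => B j w - l) ->
  small (fun j w => X j w ^+ 2 * A j w - Y j w ^+ 2 * B j w).
Proof.
move=> XY tY Al Bl.
have tA : tight A.
  have := tightD (small_tight Al) (tight_cst l); congr tight.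
  by apply/funext => j; apply/funext => w; rewrite subrK.
have s1 := tightM_small tA (tightM_small (tightD (small_tight XY) (tightD tY tY)) XY).
have s2 := tightM_small tY (tightM_small tY (smallB Al Bl)).
apply: small_ext (smallD s1 s2); apply: whp_near; apply: nearW => j w.
ring.
Qed.

(** The probability of a deviation beyond [e] is the expectation of an indicator that almost surely
    vanishes from some index on; dominated convergence applies. *)
Lemma small_ae_cvg X (l : R) : (forall j, measurable_fun setT (X j)) ->
  {ae P, forall w, X j w @[j --> \oo] --> l} -> small (fun j w => X j w - l).
Proof.
move=> mX hX e e0 r r0.
pose A j := [set w | e < `|X j w - l|].
have mA j : measurable (A j).
  rewrite /A -[X in measurable X]setTI; apply: measurable_fun_ltr => //.
  by apply: measurableT_comp => //; exact: measurable_funB.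
have h : \int[P]_w \1_(A j) w @[j --> \oo] --> \int[P]_w 0.
  apply: (dominated_expect_cvg (Y := fun=> 1)).
  - by move=> j; exact: measurable_indic.
  - exact: measurable_cst.
  - apply: filterS hX => w /cvgrPdist_le /(_ _ e0) hw.
    apply: cvg_near_cst; apply: filterS hw => j hj.
    rewrite indicE memNset //= => /=; apply/negP.
    by rewrite -leNgt distrC.
  - exact: rint_cst.
  - move=> j w; rewrite indicE; case: (_ \in _) => /=; by rewrite ?normr1 ?normr0.
rewrite expect_cst in h; have /cvgrPdist_le /(_ _ r0) := h.
apply: filterS => j hj; exists (A j) => //; split; last first.
  by move=> w /= /negP; rewrite -leNgt.
rewrite -(fineK (fin_num_measure P _ (mA j))) lee_fin -expect_indic //.
by apply: le_trans hj; rewrite sub0r normrN ler_norm.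
Qed.

Lemma tight_second_moment X (B : R) :
  (\forall j \near \oo, sqint P (X j) /\ \int[P]_w (X j w ^+ 2) <= B) -> tight X.
Proof.
(* Chosen so that [|B| <= r K <= r K^2], as Chebyshev's inequality requires. *)
move=> hX r r0; pose K : R := 1 + `|B| / r.
have K1 : 1 <= K by rewrite lerDl divr_ge0 // ltW.
have K0 : 0 < K := lt_le_trans ltr01 K1.
exists K => //; apply: filterS hX => j [sX XB].
pose A := [set w | K <= `|X j w|].
have mA : measurable A.
  rewrite /A -[X in measurable X]setTI; apply: measurable_fun_ler => //.
  by apply: measurableT_comp => //; case: sX.
exists A => //; split; last by move=> w /= /negP; rewrite -ltNge => /ltW.
rewrite -(fineK (fin_num_measure P _ mA)) lee_fin.
apply: le_trans (chebyshev_sq sX K0) _; rewrite ler_pdivrMr ?exprn_gt0 //.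
apply: le_trans XB _; apply: le_trans (ler_norm _) _.
have h : `|B| <= r * K.
  by rewrite /K mulrDr mulrCA mulfV ?gt_eqF // !mulr1 lerDr ltW.
apply: le_trans h _; rewrite ler_wpM2l ?(ltW r0) // expr2.
by rewrite ler_peMr // ltW.
Qed.

Lemma fine_le_exceptional (A B N : set Omega) (r : R) :
  measurable A -> measurable B -> measurable N -> (P N <= r%:E)%E ->
  (forall w, ~ N w -> A w -> B w) -> fine (P A) <= fine (P B) + r.
Proof.
move=> mA mB mN PN h.
rewrite -lee_fin EFinD !fineK; try exact: fin_num_measure.
apply: le_trans (leeD2l _ PN); apply: le_trans (measureU2 _ mB mN).
apply: le_measure; rewrite ?inE //; first exact: measurableU.
by move=> w Aw; have [Nw|nN] := pselect (N w); [right|left; exact: h].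
Qed.

(** Passing from [Y] to [c X] and crossing the gap of the sandwich each shift the argument by [dl];
    continuity at the single point [x] absorbs the total shift [2 dl], which is below the radius
    [q]. *)
Lemma slutsky_cdf X Y (c : R) (G : R -> R) :
  0 < c -> (forall j, measurable_fun setT (X j)) -> (forall j, measurable_fun setT (Y j)) ->
  small (fun j w => Y j w - c * X j w) ->
  (forall b1 b2 e, b1 < b2 -> 0 < e -> \forall j \near \oo,
     fine (P [set w | X j w <= b1]) <= G b2 + e /\
     G b1 - e <= fine (P [set w | X j w <= b2])) ->
  forall x : R, {for x, continuous (fun x : R => G (x / c))} ->
  fine (P [set w | Y j w <= x]) @[j --> \oo] --> G (x / c).
Proof.
move=> c0 mX mY XY XG x Gx.
have mle (Z : nat -> Omega -> R) (b : R) j : (forall j, measurable_fun setT (Z j)) ->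
    measurable [set w | Z j w <= b].
  by move=> mZ; rewrite -[X in measurable X]setTI; apply: measurable_fun_ler.
apply/cvgrPdist_le => e e0.
have e30 : 0 < e / 3 by rewrite divr_gt0.
move/cvgrPdist_le : Gx => /(_ _ e30) /nbhs_ballP[q /= q0 hq].
pose dl := q / 3; have dl0 : 0 < dl by rewrite divr_gt0.
have u1 : (x + dl) / c < (x + 2 * dl) / c by rewrite ltr_pM2r ?invr_gt0 //; lra.
have u2 : (x - 2 * dl) / c < (x - dl) / c by rewrite ltr_pM2r ?invr_gt0 //; lra.
have b1 : `|G (x / c) - G ((x + 2 * dl) / c)| <= e / 3.
  by apply: hq; rewrite /ball /= ltr_norml /dl; apply/andP; split; lra.
have b2 : `|G (x / c) - G ((x - 2 * dl) / c)| <= e / 3.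
  by apply: hq; rewrite /ball /= ltr_norml /dl; apply/andP; split; lra.
near=> j.
have [N mN [PN hN]] : exists2 A : set Omega, measurable A & (P A <= (e / 3)%:E)%E /\
  forall w, ~ A w -> `|Y j w - c * X j w| <= dl by near: j; exact: XY.
have [h1 _] : fine (P [set w | X j w <= (x + dl) / c]) <= G ((x + 2 * dl) / c) + e / 3 /\
   G ((x + dl) / c) - e / 3 <= fine (P [set w | X j w <= (x + 2 * dl) / c]).
  by near: j; exact: XG.
have [_ h2] : fine (P [set w | X j w <= (x - 2 * dl) / c]) <= G ((x - dl) / c) + e / 3 /\
   G ((x - 2 * dl) / c) - e / 3 <= fine (P [set w | X j w <= (x - dl) / c]).
  by near: j; exact: XG.
have h3 : fine (P [set w | Y j w <= x]) <= fine (P [set w | X j w <= (x + dl) / c]) + e / 3.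
  apply: (@fine_le_exceptional _ _ N) => //; [exact: mle|exact: mle|].
  move=> w /hN; rewrite ler_norml => /andP[hw1 hw2] /= hw.
  by rewrite ler_pdivlMr // mulrC; lra.
have h4 : fine (P [set w | X j w <= (x - dl) / c]) <= fine (P [set w | Y j w <= x]) + e / 3.
  apply: (@fine_le_exceptional _ _ N) => //; [exact: mle|exact: mle|].
  move=> w /hN; rewrite ler_norml => /andP[hw1 hw2] /=.
  by rewrite ler_pdivlMr // mulrC; lra.
move: b1 b2; rewrite !ler_norml => /andP[c1 c2] /andP[c3 c4].
apply/andP; split; lra.
Unshelve. all: by end_near. Qed.

End in_probability.

(** * Sums with a random number of terms *)

Section random_index.
Context {d : measure_display} {Omega : measurableType d} {R : realType}
  (P : probability Omega R).
Local Notation rint X := (P.-integrable setT (EFin \o X)).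

Lemma independent_pair_indic_sqr (N : Omega -> nat) (Y : Omega -> R) m :
  measurable_fun setT N -> sqint P Y -> independent_pair P N Y ->
  sqint P (fun w => (N w == m)%:R * Y w) /\
  \int[P]_w (((N w == m)%:R * Y w) ^+ 2) =
    \int[P]_w (N w == m)%:R * \int[P]_w (Y w ^+ 2).
Proof.
move=> mN [mY iY] ind.
have mNm : measurable_fun setT (fun w => (N w == m)%:R : R).
  by apply: (measurableT_comp (f := fun k : nat => (k == m)%:R : R)).
have sq : sqint P (fun w => (N w == m)%:R * Y w).
  split; first exact: measurable_funM.
  apply: rint_le iY; first by apply: measurable_funX; exact: measurable_funM.
  move=> w; rewrite ger0_norm ?sqr_ge0 //; case: (_ == _); first by rewrite mul1r.
  by rewrite mul0r expr0n sqr_ge0.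
split => //.
pose f (z : nat * R) : \bar R := (((z.1 == m)%:R * z.2) ^+ 2)%:E.
have mf : measurable_fun setT f.
  apply/measurable_EFinP; apply: measurable_funX; apply: measurable_funM => //.
  by apply: (measurableT_comp (f := fun k : nat => (k == m)%:R : R)).
have [h _] := independent_pair_integral mN mY ind mf sq.2.
rewrite /Rintegral -[LHS]/(fine (\int[P]_w f (N w, Y w))%E) h -[RHS]expectZ //; congr fine.
apply: eq_integral => w _; rewrite /f /=.
have -> : (fun w' => (((N w' == m)%:R * Y w) ^+ 2)%:E) =
          (fun w' => (Y w ^+ 2 * (N w' == m)%:R)%:E).
  by apply/funext => w'; case: (_ == _); rewrite ?mul1r ?mulr1 ?mul0r ?mulr0 ?expr0n.
have iN : rint (fun w => (N w == m)%:R).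
  apply: (@rint_bounded _ _ _ _ _ 1) => // w'.
  by case: (_ == _); rewrite ?normr0 ?normr1.
have iYN : rint (fun w' => Y w ^+ 2 * (N w' == m)%:R) by exact: rintZ.
by rewrite (EFin_expect iYN) expectZ // mulrC.
Qed.

Lemma sum_eqnat (k L : nat) (Q : pred nat) (F : nat -> R) : (Q k -> (k < L)%N) ->
  \sum_(0 <= m < L | Q m) (k == m)%:R * F m = if Q k then F k else 0.
Proof.
move=> kL; case: ifPn => [Qk|nQ].
  rewrite big_mkcond (bigD1_seq k) ?iota_uniq //=; last by rewrite mem_index_iota kL.
  rewrite Qk eqxx mul1r big1 ?addr0 // => m /negbTE mk.
  by rewrite eq_sym mk mul0r if_same.
by rewrite big1 // => m Qm; case: eqP Qm nQ => [->->|_]//; rewrite mul0r.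
Qed.

Variable xi : nat -> Omega -> R.
Hypothesis xi_meas : forall k, (1 <= k)%N -> measurable_fun setT (xi k).
Hypothesis xi_ind : mutually_independent P [set k | (1 <= k)%N] (fun k => sigma_of (xi k)).
Hypothesis xi_law : forall k, (1 <= k)%N -> forall B : set R, measurable B ->
  P (xi k @^-1` B) = P (xi 1%N @^-1` B).
Hypothesis xi2 : sqint P (xi 1).
Hypothesis xi0 : \int[P]_w xi 1 w = 0.

Let v := \int[P]_w (xi 1 w ^+ 2).
Let S n w := \sum_(1 <= k < n.+1) xi k w.

Let v_ge0 : 0 <= v. Proof. by apply: Rintegral_ge0 => w _; exact: sqr_ge0. Qed.

Let block_sqint m n : (1 <= m)%N -> sqint P (fun w => \sum_(m <= k < n) xi k w).
Proof.
move=> m1; have h k : sqint P (xi (maxn 1 k)).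
  by apply: (iid_sqint xi_meas xi_law xi2); rewrite leq_max leqnn.
have := sqint_sum (index_iota m n) h.
congr sqint; apply/funext => w; apply: eq_big_nat => k /andP[mk _].
by rewrite (maxn_idPr (leq_trans m1 mk)).
Qed.

Let block_sum m n : (1 <= m)%N ->
  \int[P]_w ((\sum_(m <= k < n) xi k w) ^+ 2) <= (n - m)%:R * v.
Proof.
move=> m1; have := iid_block_sum xi_meas xi_ind xi_law xi2 n m1.
rewrite xi0 -/v; under eq_Rintegral do under eq_bigr do rewrite subr0.
by under [X in _ <= _ * X -> _]eq_Rintegral do rewrite subr0.
Qed.

(** Splitting over the values [m] of [N], independence gives [P (N = m)] times the second moment of
    a block. The truncation to [|N - n| <= r] limits that block to [r] terms. *)
Lemma random_index_moment (N : Omega -> nat) (n r : nat) :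
  measurable_fun setT N ->
  (forall m n, (1 <= m)%N -> independent_pair P N (fun w => \sum_(m <= k < n) xi k w)) ->
  let X w := if (n <= N w + r)%N && (N w <= n + r)%N then S (N w) w - S n w else 0 in
  sqint P X /\ \int[P]_w (X w ^+ 2) <= r%:R * v.
Proof.
move=> mN ind X.
pose Q m := (n <= m + r)%N && (m <= n + r)%N.
pose L := (n + r).+1.
have QL m : Q m -> (m < L)%N by case/andP.
(* [S m - S n] up to sign, as a sum over the indices between [n] and [m]; the sign disappears in the
   square. *)
pose B m w := if (n <= m)%N then \sum_(n.+1 <= k < m.+1) xi k w
              else \sum_(m.+1 <= k < n.+1) xi k w.
have B2 m w : (S m w - S n w) ^+ 2 = B m w ^+ 2.
  rewrite /B; case: ifPn => nm.
    by rewrite /S (big_cat_nat (n := n.+1) (p := m.+1)) //= addrAC subrr add0r.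
  rewrite -sqrrN opprB /S [X in X - _](big_cat_nat (n := m.+1)) //=; last by rewrite ltnS ltnW // ltnNge.
  by rewrite addrAC subrr add0r.
have sB m : sqint P (B m).
  by rewrite /B; case: (leqP n m) => _; exact: block_sqint.
have iB m : independent_pair P N (B m).
  by rewrite /B; case: (leqP n m) => _; exact: ind.
have vB m : Q m -> \int[P]_w (B m w ^+ 2) <= r%:R * v.
  rewrite /Q /B => /andP[q1 q2].
  case: (leqP n m) => nm; apply: le_trans (block_sum _ _) _ => //; apply: ler_wpM2r => //.
    by rewrite ler_nat subSS leq_subLR.
  by rewrite ler_nat subSS leq_subLR.
have X2 w : X w ^+ 2 = \sum_(0 <= m < L | Q m) ((N w == m)%:R * B m w) ^+ 2.
  transitivity (\sum_(0 <= m < L | Q m) (N w == m)%:R * B m w ^+ 2).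
    rewrite sum_eqnat /X; last exact: QL.
    by rewrite -/(Q _); case: ifPn => _; rewrite ?B2 ?expr0n.
  by apply: eq_bigr => m _; case: (_ == _); rewrite ?mul1r ?mul0r ?expr0n.
have mS n' : measurable_fun setT (S n') by case: (@block_sqint 1%N n'.+1 (leqnn _)).
have XE w : X w = \sum_(0 <= m < L | Q m) (N w == m)%:R * (S m w - S n w).
  by rewrite sum_eqnat //; exact: QL.
have st m := independent_pair_indic_sqr m mN (sB m) (iB m).
have mX : measurable_fun setT X.
  rewrite (funext XE : X = fun w => _).
  under eq_fun do rewrite big_mkcond.
  apply: measurable_fun_sum_nat => m _; case: (Q m) => //.
  apply: measurable_funM; last exact: measurable_funB.
  by apply: (measurableT_comp (f := fun k : nat => (k == m)%:R : R)).
have iX : rint (fun w => X w ^+ 2).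
  rewrite (funext X2 : (fun w => X w ^+ 2) = _).
  by apply: rint_sum => m _; case: (st m) => [[]].
split => //.
rewrite (funext X2 : (fun w => X w ^+ 2) = _) expect_sum; last first.
  by move=> m _; case: (st m) => [[]].
have iN m : rint (fun w => (N w == m)%:R).
  apply: (@rint_bounded _ _ _ _ _ 1).
    by apply: (measurableT_comp (f := fun k : nat => (k == m)%:R : R)).
  by move=> w; case: (_ == _); rewrite ?normr0 ?normr1.
apply: (@le_trans _ _ (\sum_(0 <= m < L | Q m) \int[P]_w (N w == m)%:R * (r%:R * v))).
  apply: ler_sum => m Qm; rewrite (st m).2 ler_wpM2l ?vB //.
  by apply: Rintegral_ge0 => w _; rewrite ler0n.
rewrite -mulr_suml -[leRHS]mul1r ler_wpM2r ?mulr_ge0 //.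
rewrite -(expect_sum (P := P)) // -[leRHS](expect_cst P).
apply: expect_le; [exact: rint_sum|exact: rint_cst|].
move=> w; have := @sum_eqnat (N w) L Q (fun=> 1) (@QL _).
under eq_bigr do rewrite mulr1.
by move=> ->; case: ifP.
Qed.

Lemma small_cvg (x : nat -> R) (l : R) : x j @[j --> \oo] --> l -> small P (fun j _ => x j - l).
Proof.
move=> /cvgrPdist_le xl e e0; apply: whp_near.
by apply: filterS (xl e e0) => j h _; rewrite distrC.
Qed.

(** Up to probability [r/2] the random index is within [dl * s j] of [n j]; Chebyshev's inequality
    for the truncated difference costs the other [r/2]. *)
Lemma random_sum_small (N : nat -> Omega -> nat) (n : nat -> nat) (s : nat -> R) (lam : R) :
  (forall j, 0 < s j) -> (forall j, measurable_fun setT (N j)) ->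
  (forall j m n, (1 <= m)%N -> independent_pair P (N j) (fun w => \sum_(m <= k < n) xi k w)) ->
  {ae P, forall w, (N j w)%:R / s j @[j --> \oo] --> lam} ->
  (n j)%:R / s j @[j --> \oo] --> lam ->
  small P (fun j w => (S (N j w) w - S (n j) w) / Num.sqrt (s j)).
Proof.
move=> s0 mN ind Nl nl e e0 r r0.
have r20 : 0 < r / 2 by rewrite divr_gt0.
have v1 : 0 < 1 + v by rewrite ltr_pwDl.
(* Chebyshev's inequality needs [dl * s j * v <= (r/2) e^2 (s j)]; dividing by [1 + v] covers
   [v = 0]. *)
pose dl : R := r / 2 * e ^+ 2 / (1 + v).
have dl0 : 0 < dl by rewrite divr_gt0 // mulr_gt0 // exprn_gt0.
have sm : small P (fun j w => ((N j w)%:R / s j - lam) - ((n j)%:R / s j - lam)).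
  apply: smallB; last exact: small_cvg.
  apply: (small_ae_cvg (X := fun j w => (N j w)%:R / s j)) => // j; apply: measurable_funM => //.
  by apply: (measurableT_comp (f := fun k : nat => k%:R : R)).
apply: filterS (sm _ dl0 _ r20) => j [A mA [PA hA]].
pose q := Num.truncn (dl * s j).
have ds0 : 0 <= dl * s j by rewrite mulr_ge0 // ltW.
have [] := random_index_moment (n j) q (mN j) (ind j).
set X := (fun w => if _ then _ else _) => sX XB.
have es0 : 0 < e * Num.sqrt (s j) by rewrite mulr_gt0 // sqrtr_gt0.
pose B := [set w | e * Num.sqrt (s j) <= `|X w|].
have mB : measurable B.
  rewrite /B -[X in measurable X]setTI; apply: measurable_fun_ler => //.
  by apply: measurableT_comp => //; case: sX.
have PB : (P B <= (r / 2)%:E)%E.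
  rewrite -(fineK (fin_num_measure P _ mB)) lee_fin.
  apply: le_trans (chebyshev_sq sX es0) _.
  rewrite ler_pdivrMr ?exprn_gt0 //; apply: le_trans XB _.
  rewrite exprMn sqr_sqrtr ?(ltW (s0 j)) //.
  apply: (@le_trans _ _ (dl * s j * (1 + v))).
    by apply: ler_pM => //; [rewrite truncn_le|rewrite lerDr].
  rewrite [r / 2 * _]mulrA -/(r / 2 * e ^+ 2) (_ : dl * s j * (1 + v) = r / 2 * e ^+ 2 * s j) //.
  by rewrite mulrAC /dl divfK ?gt_eqF.
exists (A `|` B); first exact: measurableU.
split.
  apply: le_trans (measureU2 _ mA mB) _; rewrite [r]splitr EFinD.
  exact: leeD PA PB.
move=> w /not_orP[/hA hw hB].
have [Q1 Q2] : (n j <= N j w + q)%N /\ (N j w <= n j + q)%N.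
  move: hw; rewrite (_ : _ - lam - _ = ((N j w)%:R - (n j)%:R) / s j); last by ring.
  rewrite normrM normfV (gtr0_norm (s0 j)) ler_pdivrMr // ler_norml => /andP[h1 h2].
  split; rewrite -leq_subLR /q truncn_ge_nat //.
    have [le|lt] := leqP (n j) (N j w); last by rewrite natrB ?(ltnW lt) //; lra.
    by move: le; rewrite -subn_eq0 => /eqP ->.
  have [le|lt] := leqP (N j w) (n j); last by rewrite natrB ?(ltnW lt) //; lra.
  by move: le; rewrite -subn_eq0 => /eqP ->.
move: hB; rewrite /B /= /X Q1 Q2 /= => /negP; rewrite -ltNge => hB.
by rewrite normrM normfV (ger0_norm (sqrtr_ge0 _)) ler_pdivrMr ?sqrtr_gt0 // ltW.
Qed.

Lemma partial_sum_tight (n : nat -> nat) (s : nat -> R) (lam : R) :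
  (forall j, 0 < s j) -> (n j)%:R / s j @[j --> \oo] --> lam ->
  tight P (fun j w => S (n j) w / Num.sqrt (s j)).
Proof.
move=> s0 nl; apply: (tight_second_moment (B := (`|lam| + 1) * v)).
move/cvgrPdist_le : nl => /(_ 1 ltr01); apply: filterS => j hj.
have sS : sqint P (S (n j)) := @block_sqint 1%N (n j).+1 (leqnn _).
split.
  have := sqintZ (Num.sqrt (s j))^-1 sS; congr sqint.
  by apply/funext => w; rewrite mulrC.
have -> : (fun w => (S (n j) w / Num.sqrt (s j)) ^+ 2) = (fun w => (s j)^-1 * S (n j) w ^+ 2).
  by apply/funext => w; rewrite exprMn exprVn sqr_sqrtr ?(ltW (s0 j)) // mulrC.
rewrite expectZ; last by case: sS.
apply: (@le_trans _ _ ((s j)^-1 * ((n j)%:R * v))).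
  rewrite ler_wpM2l ?invr_ge0 ?(ltW (s0 j)) //.
  by apply: le_trans (@block_sum 1%N (n j).+1 (leqnn _)) _; rewrite subSS subn0.
rewrite mulrA ler_wpM2r // mulrC.
move: hj; rewrite ler_norml => /andP[h _]; have := ler_norm lam.
by move: h; set z := _ / _ => h h'; lra.
Qed.

End random_index.

(** * The chain ladder model *)

Section studentised_rows.
Context {d : measure_display} {Omega : measurableType d} {R : realType}
  (P : probability Omega R).
Variables (nu : nat) (v : R) (S : nat -> nat -> Omega -> R) (n : nat -> nat -> nat).
Hypothesis nu0 : (0 < nu)%N.
Hypothesis mS : forall i k, (1 <= i <= nu.+1)%N -> measurable_fun setT (S i k).
Hypothesis S_ind : forall m : nat -> nat,
  mutually_independent P [set i | (1 <= i <= nu.+1)%N] (fun i => sigma_of (S i (m i))).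
Hypothesis S_clt : forall i (th e : R), (1 <= i <= nu.+1)%N -> 0 < e ->
  \forall k \near \oo, forall a m : R, 0 <= a <= th ->
    `|\int[P]_w heat a 0 (S i k w / Num.sqrt (k%:R * v) + m) - heat a 1 m| <= e.
Hypothesis n_oo : forall i, (1 <= i <= nu.+1)%N -> n i j @[j --> \oo] --> \oo.

Let tot j := (\sum_(1 <= l < nu.+2) n l j)%N.
Let W i j w := S i (n i j) w / Num.sqrt ((n i j)%:R * v).
Let u i j : R := Num.sqrt ((n i j)%:R / (tot j)%:R).
(** For [tot j > 0] the weights satisfy [|u| = 1], and this is the squared length of [W] without its
    component along [u]: a form of rank [nu] in [nu + 1] variables. *)
Let Q j w := \sum_(1 <= i < nu.+2) W i j w ^+ 2 - (\sum_(1 <= i < nu.+2) u i j * W i j w) ^+ 2.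

Let u_sqr i j : u i j ^+ 2 = (n i j)%:R / (tot j)%:R.
Proof. by rewrite sqr_sqrtr // divr_ge0. Qed.

Let sum_u_sqr j : \sum_(1 <= i < nu.+2) u i j ^+ 2 = (tot j)%:R / (tot j)%:R.
Proof.
by under eq_bigr do rewrite u_sqr; rewrite -mulr_suml /tot natr_sum.
Qed.

Let mW i j : (1 <= i <= nu.+1)%N -> measurable_fun setT (W i j).
Proof. by move=> iN; apply: measurable_funM => //; exact: mS. Qed.

Let mQ j : measurable_fun setT (Q j).
Proof.
apply: measurable_funB.
  by apply: measurable_fun_sum_nat => i iN; apply: measurable_funX; exact: mW.
apply: measurable_funX; apply: measurable_fun_sum_nat => i iN.
by apply: measurable_funM => //; exact: mW.
Qed.

Let Q_ge0 j w : 0 <= Q j w.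
Proof.
rewrite subr_ge0; apply: le_trans (cauchy_schwarz_sum _ _ _) _.
rewrite sum_u_sqr ler_piMl //; first by apply: sumr_ge0 => i _; exact: sqr_ge0.
by have [->|t0] := posnP (tot j); [rewrite mul0r|rewrite mulfV // pnatr_eq0 -lt0n].
Qed.

Let W_ind j k : (1 <= k <= nu.+1)%N -> independent_pair P (W k j) (fun w =>
     (\sum_(1 <= i < k) W i j w ^+ 2, \sum_(1 <= i < k) u i j * W i j w)).
Proof.
move=> /andP[k1 kN].
have ind : mutually_independent P [set i | (1 <= i <= nu.+1)%N]
  (fun i => sigma_of (S i (n i j))) by exact: (@S_ind (n ^~ j)).
apply: (independent_pair_group ind (K1 := [set k]) (K2 := [set i | (1 <= i < k)%N])).
- by move=> i iN; apply: sigma_of_measurable; exact: mS.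
- by move=> i _; exact: setI_closed_sigma_of.
- by move=> i _; exact: sigma_ofT.
- by move=> _ ->; rewrite /= k1.
- by move=> i /= /andP[-> ik]; rewrite ltnW // (leq_trans ik).
- by apply/seteqP; split => // i [/= ->]; rewrite ltnn andbF.
- apply: measurable_funM => //.
  by apply: sigma_of_measurable_fun => A SA; exists k.
have mWi i : (1 <= i < k)%N ->
    measurable_fun [set: g_sigma_algebraType (\bigcup_(i in [set i | (1 <= i < k)%N])
      sigma_of (S i (n i j)))] (W i j).
  move=> ik; apply: measurable_funM => //.
  by apply: sigma_of_measurable_fun => A SA; exists i.
apply: measurable_fun_pair; apply: measurable_fun_sum_nat => i ik.
  by apply: measurable_funX; exact: mWi.
by apply: measurable_funM => //; exact: mWi.
Qed.

Let rows_clt (th e : R) : 0 < e -> \forall j \near \oo, forall i, (1 <= i <= nu.+1)%N ->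
  (0 < n i j)%N /\ forall a m : R, 0 <= a <= th ->
    `|\int[P]_w heat a 0 (W i j w + m) - heat a 1 m| <= e.
Proof.
move=> e0.
pose G i j := (0 < n i j)%N /\ forall a m : R, 0 <= a <= th ->
    `|\int[P]_w heat a 0 (W i j w + m) - heat a 1 m| <= e.
have h i : (1 <= i <= nu.+1)%N -> \forall j \near \oo, G i j.
  move=> iN.
  have [N1 _ hN] := S_clt th iN e0.
  have c1 : \forall j \near \oo, (maxn 1 N1 <= n i j)%N by exact: (n_oo iN (nbhs_infty_ge _)).
  apply: filterS c1 => j; rewrite geq_max => /andP[n0 nN]; split => // a m ath.
  rewrite /W; exact: hN.
have : \forall j \near \oo, forall i : 'I_nu.+2, (1 <= i <= nu.+1)%N -> G i j.
  apply: filter_forall => i; have [iN|iN] := boolP (1 <= i <= nu.+1)%N.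
    by apply: filterS (h _ iN) => j hj _; exact: hj.
  by apply: nearW => j.
apply: filterS => j hj i iN; have iN2 : (i < nu.+2)%N by case/andP: iN.
exact: (hj (Ordinal iN2) iN).
Qed.

(** As [nu >= 1] there is another row [i'], with a positive count. This makes the last weight less
    than 1, the strict condition of [rows_laplace]. *)
Let lt_tot i j : (forall l, (1 <= l <= nu.+1)%N -> (0 < n l j)%N) ->
  (1 <= i <= nu.+1)%N -> (n i j < tot j)%N.
Proof.
move=> n0 iN; rewrite /tot (bigD1_seq i) ?iota_uniq ?mem_index_iota //=.
pose i' := if i == 1%N then 2%N else 1%N.
have iN' : (1 <= i' <= nu.+1)%N by rewrite /i'; case: ifP.
have ii' : i' != i by rewrite /i'; case: (eqVneq i 1%N) => [->|] //; rewrite eq_sym.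
rewrite big_mkcond (bigD1_seq i') ?iota_uniq ?mem_index_iota //= ii'.
by rewrite -[ltnLHS]addn0 ltn_add2l; apply: leq_trans (leq_addr _ _); exact: n0.
Qed.

(** The case [|u|^2 = 1], [B = th = p] of the determinant: one of the [nu + 1] factors cancels,
    which is the lost degree of freedom. *)
Let determinant (p : R) : 0 < p ->
  (1 + 2 * p) ^+ nu.+1 * (1 - 2 * p * 1 / (1 + 2 * p)) = (1 + 2 * p) ^+ nu.
Proof. by move=> p0; rewrite exprS; field; apply: lt0r_neq0; lra. Qed.

Let Q_laplace p : \int[P]_w (expR (- Q j w) ^+ p) @[j --> \oo] -->
  expR (- (ln ((1 + 2 * p%:R) ^+ nu) / 2)).
Proof.
(* [p = 0] is apart because [rows_laplace] asks for a positive argument. *)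
have [->|p0] := posnP p.
  rewrite mulr0 addr0 expr1n ln1 mul0r oppr0 expR0.
  under eq_fun do under eq_Rintegral do rewrite expr0.
  under eq_fun do rewrite expect_cst.
  exact: cvg_cst.
have : 0 < p%:R :> R by rewrite ltr0n.
have QE j w : expR (- Q j w) ^+ p = expR (- (p%:R * (\sum_(1 <= i < nu.+2) W i j w ^+ 2)
      - p%:R * (\sum_(1 <= i < nu.+2) u i j * W i j w) ^+ 2)).
  by rewrite -expRM_natl mulrN mulrBr.
under eq_fun do under eq_Rintegral do rewrite QE.
move: (p%:R : R) => q q0.
apply/cvgrPdist_le => e e0.
(* One share of the error for each of the [nu + 1] rows. *)
have e1 : 0 < e / nu.+1%:R by rewrite divr_gt0.
apply: filterS (rows_clt q e1) => j clt.
have n0 i : (1 <= i <= nu.+1)%N -> (0 < n i j)%N by move=> iN; case: (clt i iN).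
have tot0 : (0 < tot j)%N by apply: leq_ltn_trans (lt_tot n0 (_ : (1 <= 1 <= nu.+1)%N)).
have tt : \sum_(1 <= i < nu.+2) u i j ^+ 2 = 1.
  by rewrite sum_u_sqr mulfV // pnatr_eq0 -lt0n.
have u0 i : (1 <= i <= nu.+1)%N -> 0 < u i j.
  by move=> iN; rewrite sqrtr_gt0 divr_gt0 // ltr0n //; exact: n0.
have uV : q * (\sum_(1 <= i < nu.+2) u i j ^+ 2) <= q by rewrite tt mulr1.
have ulast : (1 <= nu.+1)%N -> q * u nu.+1 j ^+ 2 < q.
  move=> _; rewrite u_sqr gtr_pMr // ltr_pdivrMr ?ltr0n // mul1r ltr_nat.
  by apply: lt_tot => //; rewrite ltn0Sn leqnn.
have := rows_laplace q0 (ltW e1) (fun k kN => @mW k j kN) u0 (@W_ind j)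
  (fun k a m kN => (clt k kN).2 a m) q0 uV ulast.
rewrite tt (determinant q0) mulrCA mulfV ?mulr1 ?pnatr_eq0 // distrC.
exact.
Qed.

Lemma studentised_rows_sandwich (b1 b2 e : R) : b1 < b2 -> 0 < e ->
  \forall j \near \oo,
    fine (P [set w | Q j w <= b1]) <= chisq_prob nu [set y | y <= b2] + e /\
    chisq_prob nu [set y | y <= b1] - e <= fine (P [set w | Q j w <= b2]).
Proof. exact: chisq_sandwich. Qed.

End studentised_rows.

Section small_quadratic.
Context {d : measure_display} {Omega : measurableType d} {R : realType}
  (P : probability Omega R).

Lemma small_quadratic (m n : nat) (X Y A B : nat -> nat -> Omega -> R) (a : nat -> R)
    (A' B' : nat -> Omega -> R) (a' : R) :
  (forall i, (m <= i < n)%N -> [/\ small P (fun j w => X i j w - Y i j w), tight P (Y i),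
     small P (fun j w => A i j w - a i) & small P (fun j w => B i j w - a i)]) ->
  small P (fun j w => A' j w - a') -> small P (fun j w => B' j w - a') ->
  small P (fun j w =>
    (\sum_(m <= i < n) X i j w ^+ 2 * A i j w - (\sum_(m <= i < n) X i j w) ^+ 2 * A' j w)
    - (\sum_(m <= i < n) Y i j w ^+ 2 * B i j w - (\sum_(m <= i < n) Y i j w) ^+ 2 * B' j w)).
Proof.
move=> h hA hB.
have s1 : small P (fun j w => \sum_(m <= i < n) (X i j w ^+ 2 * A i j w - Y i j w ^+ 2 * B i j w)).
  apply: (small_sum_nat (X := fun i j w => X i j w ^+ 2 * A i j w - Y i j w ^+ 2 * B i j w)).
  by move=> i /h[h1 h2 h3 h4]; exact: small_sqr_mul h3 h4.
have s2 : small P (fun j w => \sum_(m <= i < n) X i j w - \sum_(m <= i < n) Y i j w).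
  have := @small_sum_nat _ _ _ P m n (fun i j w => X i j w - Y i j w).
  move=> /(_ _)/wrap[i /h[]//|]; apply: small_ext; apply: whp_near; apply: nearW => j w.
  by rewrite sumrB.
have t2 : tight P (fun j w => \sum_(m <= i < n) Y i j w).
  by apply: tight_sum_nat => i /h[].
apply: small_ext (smallB s1 (small_sqr_mul s2 t2 hA hB)); apply: whp_near; apply: nearW => j w.
rewrite sumrB; ring.
Qed.

End small_quadratic.

(** Weighted Steiner identity: [U / V] is the mean of the ratios [c' / c] with weights [c], and
    moving the centre to any [f] produces the subtracted square. Applied with the true development
    factor, for which [c' - f c] is a sum of centred terms. *)
Lemma sum_sqr_deviation (R : fieldType) (m n : nat) (c c' : nat -> R) (f : R) :
  (forall i, (m <= i < n)%N -> c i != 0) -> \sum_(m <= i < n) c i != 0 ->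
  \sum_(m <= i < n) c i * (c' i / c i - (\sum_(m <= i < n) c' i) / \sum_(m <= i < n) c i) ^+ 2 =
  \sum_(m <= i < n) (c' i - f * c i) ^+ 2 / c i
  - (\sum_(m <= i < n) (c' i - f * c i)) ^+ 2 / \sum_(m <= i < n) c i.
Proof.
move=> c0; rewrite sumrB -mulr_sumr.
set U := \sum_(_ <= _ < _) c' _; set V := \sum_(_ <= _ < _) c _ => V0.
rewrite (@eq_big_nat _ _ _ _ _ _ (fun i => (c' i - f * c i) ^+ 2 / c i +
  (2 * (f - U / V) * (c' i - f * c i) + (f - U / V) ^+ 2 * c i))); last first.
  by move=> i /c0 ci; field; apply/andP.
rewrite big_split /= big_split /= -!mulr_sumr sumrB -mulr_sumr -/U -/V.
congr (_ + _); field; exact: V0.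
Qed.

Lemma telescope_ratio (R : fieldType) (e : nat -> R) m n : (m <= n)%N ->
  (forall t, (m <= t <= n)%N -> e t != 0) ->
  \prod_(m <= t < n) (e t.+1 / e t) = e n / e m.
Proof.
elim: n => [|n IH] mn e0.
  by move: mn e0; rewrite leqn0 => /eqP -> e0; rewrite big_geq // mulfV // e0.
move: mn; rewrite leq_eqVlt => /orP[/eqP mn|mn].
  by rewrite mn big_geq // mulfV // -mn e0 // mn leqnn.
rewrite big_nat_recr //= IH // => [|t /andP[mt tn]]; last by rewrite e0 // mt ltnW.
rewrite mulrC mulrA divfK // e0 // -ltnS mn /=.
exact: ltnW.
Qed.

Lemma random_sum_measurable (d : measure_display) (Omega : measurableType d) (R : realType)
    (N : Omega -> nat) (S : nat -> Omega -> R) :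
  measurable_fun setT N -> (forall n, measurable_fun setT (S n)) ->
  measurable_fun setT (fun w => S (N w) w).
Proof.
move=> mN mS _ B mB; rewrite setTI.
rewrite (_ : _ @^-1` _ = \bigcup_n (N @^-1` [set n] `&` S n @^-1` B)); last first.
  by apply/seteqP; split => [w Bw|w [n _ [/= ->]]//]; exists (N w).
apply: bigcupT_measurable => n; apply: measurableI.
  by rewrite -[_ @^-1` _]setTI; exact: mN.
by rewrite -[_ @^-1` _]setTI; exact: mS.
Qed.

Lemma whp_forall_nat (d : measure_display) (Omega : measurableType d) (R : realType)
    (P : probability Omega R) m n (E : nat -> nat -> Omega -> Prop) :
  (forall i, (m <= i < n)%N -> whp P (E i)) ->
  whp P (fun j w => forall i, (m <= i < n)%N -> E i j w).
Proof.
elim: n => [|n IH] h.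
  by apply: whp_near; apply: nearW => j w i; rewrite ltn0 andbF.
have h1 : whp P (fun j w => forall i, (m <= i < n)%N -> E i j w).
  by apply: IH => i /andP[mi i_n]; apply: h; rewrite mi ltnW.
have [mn|nm] := leqP m n; last first.
  apply: whp_near; apply: nearW => j w i /andP[mi]; rewrite ltnS => i_n.
  by move: (leq_trans mi i_n); rewrite leqNgt nm.
apply: whp_impl (whp_and h1 (h n _)); last by rewrite mn ltnSn.
apply: nearW => j w [hw hn] i /andP[mi]; rewrite ltnS leq_eqVlt => /orP[/eqP -> //|i_n].
by apply: hw; rewrite mi.
Qed.

(** * The claims model: independence, laws of large numbers, parts (i) and (ii) *)

Section model.
Context {d : measure_display} {Omega : measurableType d} {R : realType}
  (P : probability Omega R).
Local Notation rint X := (P.-integrable setT (EFin \o X)).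
Variables (T : nat) (M : nat -> R -> Omega -> nat) (D : nat -> nat -> Omega -> nat)
  (Z : nat -> nat -> Omega -> R) (lam : nat -> R).
Hypothesis T2 : (2 <= T)%N.
Hypothesis mM : forall i (a : R), (1 <= i <= T)%N -> 0 <= a -> measurable_fun setT (M i a).
Hypothesis mDZ : forall i k, (1 <= i <= T)%N -> (1 <= k)%N ->
  measurable_fun setT (D i k) /\ measurable_fun setT (Z i k).
Hypothesis D_range :
  forall i k w, (1 <= i <= T)%N -> (1 <= k)%N -> (1 <= D i k w <= T)%N.
Hypothesis DZ_ind : forall i, (1 <= i <= T)%N ->
  mutually_independent P [set k | (1 <= k)%N] (fun k => sigma_of (fun w => (D i k w, Z i k w))).
Hypothesis DZ_law : forall i k, (1 <= i <= T)%N -> (1 <= k)%N ->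
  forall A : set (nat * R), measurable A ->
    P ((fun w => (D i k w, Z i k w)) @^-1` A) = P ((fun w => (D 1 1 w, Z 1 1 w)) @^-1` A).
Hypothesis Z_sqr : (\int[P]_w ((Z 1 1 w) ^+ 2)%:E < +oo)%E.
Hypothesis EZ_gt0 : forall t, (1 <= t <= T)%N ->
  (0 < \int[P]_w (Z 1 1 w * ((D 1 1 w == t) : nat)%:R)%:E)%E.
Hypothesis M_DZ_ind : forall i, (1 <= i <= T)%N ->
  mutually_independent P setT
    (fun b : bool => if b then
       <<s \bigcup_(k in [set k | (1 <= k)%N]) sigma_of (fun w => (D i k w, Z i k w)) >>
     else <<s \bigcup_(a in [set a : R | 0 <= a]) sigma_of (M i a) >>).
Hypothesis rows_ind : mutually_independent P [set i | (1 <= i <= T)%N]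
    (fun i => <<s (\bigcup_(a in [set a : R | 0 <= a]) sigma_of (M i a))
                `|` (\bigcup_(k in [set k | (1 <= k)%N])
                       sigma_of (fun w => (D i k w, Z i k w))) >>).
Hypothesis lam_gt0 : forall i, (1 <= i <= T)%N -> 0 < lam i.
Hypothesis M_lam : forall i, (1 <= i <= T)%N ->
  {ae P, forall w, (M i a w)%:R / a @[a --> +oo] --> lam i}.

Section row.
Variable g : nat * R -> R.
Hypothesis mg : measurable_fun setT g.
(** [g] is left open because the same facts serve the claims [Z I{D <= t}] and their centred
    combination. *)
Let row i k w := g (D i k w, Z i k w).

Let mpair i k : (1 <= i <= T)%N -> (1 <= k)%N ->
  measurable_fun setT (fun w => (D i k w, Z i k w)).
Proof. by move=> iT k1; have [] := mDZ iT k1; exact: measurable_fun_pair. Qed.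

Lemma row_measurable i k : (1 <= i <= T)%N -> (1 <= k)%N -> measurable_fun setT (row i k).
Proof. by move=> iT k1; apply: measurableT_comp (mpair iT k1). Qed.

Let sub_sigma_row i k : sigma_of (row i k) `<=` sigma_of (fun w => (D i k w, Z i k w)).
Proof.
move=> _ [B mB ->]; exists (g @^-1` B) => //.
by rewrite -[_ @^-1` _]setTI; exact: mg.
Qed.

Lemma row_independent i : (1 <= i <= T)%N ->
  mutually_independent P [set k | (1 <= k)%N] (fun k => sigma_of (row i k)).
Proof.
move=> iT J A uJ JK FA; apply: (DZ_ind iT uJ JK) => j jJ.
exact/sub_sigma_row/FA.
Qed.

Lemma row_law i k (B : set R) : (1 <= i <= T)%N -> (1 <= k)%N -> measurable B ->
  P (row i k @^-1` B) = P (row 1 1 @^-1` B).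
Proof.
move=> iT k1 mB; apply: (DZ_law iT k1 (A := g @^-1` B)).
by rewrite -[_ @^-1` _]setTI; exact: mg.
Qed.

Let i11 : (1 <= 1 <= T)%N. Proof. by rewrite leqnn ltnW. Qed.

Lemma row_law_iid i k (B : set R) : (1 <= i <= T)%N -> (1 <= k)%N -> measurable B ->
  P (row i k @^-1` B) = P (row i 1 @^-1` B).
Proof. by move=> iT k1 mB; rewrite row_law // [RHS]row_law. Qed.

Lemma row_sqint i : (1 <= i <= T)%N -> sqint P (row 1 1) -> sqint P (row i 1).
Proof.
move=> iT [_ s]; split; first exact: row_measurable.
apply: (same_law_rint (X := row i 1) (Y := row 1 1) (f := fun x => x ^+ 2)) s.
- exact: row_measurable.
- exact: row_measurable.
- by move=> B mB; exact: row_law.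
- exact: measurable_funX.
Qed.

Lemma row_expect i (h : R -> R) : (1 <= i <= T)%N -> measurable_fun setT h ->
  \int[P]_w h (row i 1 w) = \int[P]_w h (row 1 1 w).
Proof.
move=> iT mh; congr fine.
apply: (same_law_integral (X := row i 1) (Y := row 1 1) (f := EFin \o h)).
- exact: row_measurable.
- exact: row_measurable.
- by move=> B mB; exact: row_law.
- exact/measurable_EFinP.
Qed.

Lemma row_count_independent i (a : R) m n : (1 <= i <= T)%N -> 0 <= a -> (1 <= m)%N ->
  independent_pair P (M i a) (fun w => \sum_(m <= k < n) row i k w).
Proof.
move=> iT a0 m1 A B mA mB.
have mrow k : (1 <= k)%N -> measurable_fun [set: g_sigma_algebraType
   (\bigcup_(k in [set k | (1 <= k)%N]) sigma_of (fun w => (D i k w, Z i k w)))] (row i k).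
  move=> k1; apply: sigma_of_measurable_fun => C /sub_sigma_row h; by exists k.
have hB : <<s \bigcup_(k in [set k | (1 <= k)%N]) sigma_of (fun w => (D i k w, Z i k w)) >>
    ((fun w => \sum_(m <= k < n) row i k w) @^-1` B).
  have mS : measurable_fun [set: g_sigma_algebraType
     (\bigcup_(k in [set k | (1 <= k)%N]) sigma_of (fun w => (D i k w, Z i k w)))]
     (fun w => \sum_(m <= k < n) row i k w).
    apply: measurable_fun_sum_nat => k /andP[mk _]; apply: mrow.
    exact: leq_trans mk.
  by have := mS measurableT B mB; rewrite setTI.
have hA : <<s \bigcup_(a in [set a : R | 0 <= a]) sigma_of (M i a) >> (M i a @^-1` A).
  by apply: sub_sigma_algebra; exists a => //; exists A.
have := @M_DZ_ind i iT [:: true; false] (fun b => if b then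
  ((fun w => \sum_(m <= k < n) row i k w) @^-1` B) else (M i a @^-1` A)).
move=> /(_ isT (fun _ _ => I) _)/wrap[[] _ //|].
rewrite big_cons big_seq1 => h; rewrite setIC muleC -h; congr (P _).
apply/seteqP; split => [w [wB wA] [] _ //|w h' /=].
by split; [exact: (h' true)|exact: (h' false)].
Qed.

Lemma row_sums_independent (N : nat) (n : nat -> nat) : (N <= T)%N ->
  mutually_independent P [set i | (1 <= i <= N)%N]
    (fun i => sigma_of (fun w => \sum_(1 <= k < (n i).+1) row i k w)).
Proof.
move=> NT J A uJ JK FA.
have JT j : j \in J -> (1 <= j <= T)%N.
  by move=> /JK /= /andP[-> jN]; exact: leq_trans NT.
apply: (rows_ind uJ) => // j jJ; have [B mB ->] := FA j jJ.
set G := _ `|` _.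
have mS : measurable_fun [set: g_sigma_algebraType G]
   (fun w => \sum_(1 <= k < (n j).+1) row j k w).
  apply: measurable_fun_sum_nat => k /andP[k1 _].
  by apply: sigma_of_measurable_fun => C /sub_sigma_row h; right; exists k.
by have := mS measurableT B mB; rewrite setTI.
Qed.

Lemma row_sum_measurable i n : (1 <= i <= T)%N ->
  measurable_fun setT (fun w => \sum_(1 <= k < n.+1) row i k w).
Proof.
by move=> iT; apply: measurable_fun_sum_nat => k /andP[k1 _]; exact: row_measurable.
Qed.

Lemma row_random_sum_measurable i (a : R) : (1 <= i <= T)%N -> 0 <= a ->
  measurable_fun setT (fun w => \sum_(1 <= k < (M i a w).+1) row i k w).
Proof.
move=> iT a0; apply: (random_sum_measurable (S := fun n w => \sum_(1 <= k < n.+1) row i k w)).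
  exact: mM.
by move=> n; exact: row_sum_measurable.
Qed.

(** The quotient by [a] is the average over [M] claims times [M / a]. As [lam i > 0], the count
    tends to infinity, so the law of large numbers along integers can be composed with it. *)
Lemma row_random_sum_lln i : (1 <= i <= T)%N -> sqint P (row 1 1) ->
  {ae P, forall w, (\sum_(1 <= k < (M i a w).+1) row i k w) / a @[a --> +oo]
     --> lam i * \int[P]_w row 1 1 w}.
Proof.
move=> iT s; have si := row_sqint iT s.
have lln := iid_lln (fun k => row_measurable iT) (row_independent iT)
  (fun k k1 B mB => row_law_iid iT k1 mB) si.
rewrite (row_expect (h := fun x => x) iT) // in lln.
apply: filterS2 (M_lam iT) lln => w hM hS.
have Moo : M i a w @[a --> +oo] --> \oo.
  apply/cvgnyPge => n.
  have l2 : 0 < lam i / 2 by rewrite divr_gt0 // lam_gt0.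
  move/cvgrPdist_le : hM => /(_ _ l2) hM; near=> a.
  have a0 : 0 < a by near: a; exact: nbhs_pinfty_gt.
  have na : n%:R / (lam i / 2) <= a by near: a; by apply: nbhs_pinfty_ge; rewrite num_real.
  have : `|lam i - (M i a w)%:R / a| <= lam i / 2 by near: a; exact: hM.
  rewrite ler_norml => /andP[_ h].
  rewrite -(ler_nat R); apply: (@le_trans _ _ (lam i / 2 * a)).
    by rewrite mulrC -ler_pdivrMr.
  by rewrite -ler_pdivlMr //; lra.
have h := cvgM hM (cvg_comp _ _ Moo hS).
apply: cvg_trans (h _); apply: near_eq_cvg; near=> a.
have M0 : (0 < M i a w)%N by near: a; exact: (Moo _ (nbhs_infty_gt 0)).
rewrite -[LHS]/((M i a w)%:R / a * (_ / (M i a w)%:R)) mulrC.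
by rewrite mulrA divfK // pnatr_eq0 -lt0n.
Unshelve. all: by end_near. Qed.

End row.
Let i11 : (1 <= 1 <= T)%N. Proof. by rewrite leqnn ltnW. Qed.

Let claim (b : nat -> bool) (z : nat * R) : R := z.2 * (b z.1)%:R.

Let claim_measurable b : measurable_fun setT (claim b).
Proof.
apply: measurable_funM => //.
by apply: (measurableT_comp (f := fun k : nat => (b k)%:R : R)).
Qed.

Lemma claim_sqint (b : nat -> bool) : sqint P (fun w => Z 1 1 w * (b (D 1 1 w))%:R).
Proof.
have [mD mZ] := mDZ i11 (leqnn 1).
have m2 : measurable_fun setT (fun w => Z 1 1 w * (b (D 1 1 w))%:R).
  apply: measurable_funM => //.
  by apply: (measurableT_comp (f := fun k : nat => (b k)%:R : R)).
split => //.
have iZ : rint (fun w => Z 1 1 w ^+ 2).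
  apply/integrableP; split; first by apply/measurable_EFinP; exact: measurable_funX.
  rewrite (eq_integral (fun w => (Z 1 1 w ^+ 2)%:E)) // => w _ /=.
  by rewrite ger0_norm ?sqr_ge0.
apply: rint_le iZ; first exact: measurable_funX.
move=> w; rewrite ger0_norm ?sqr_ge0 // exprMn; case: (b (D 1 1 w)) => /=.
  by rewrite expr1n mulr1.
by rewrite expr0n mulr0 sqr_ge0.
Qed.

Let ez t := \int[P]_w (Z 1 1 w * (D 1 1 w <= t)%N%:R).

Lemma expected_claims_rec t :
  ez t.+1 = ez t + \int[P]_w (Z 1 1 w * (D 1 1 w == t.+1)%:R).
Proof.
rewrite -expectD; [|exact/sqint_rint/(claim_sqint (fun j => j <= t)%N)|
  exact/sqint_rint/(claim_sqint (fun j => j == t.+1))].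
apply: eq_Rintegral => w _; rewrite -mulrDr -natrD; congr (_ * _%:R).
by rewrite leq_eqVlt ltnS; case: eqP => [->|_]; rewrite ?ltnn ?addn0 //.
Qed.

Lemma expected_claims_gt0 t : (1 <= t <= T)%N -> 0 < ez t.
Proof.
have h s : (1 <= s <= T)%N -> 0 < \int[P]_w (Z 1 1 w * (D 1 1 w == s)%:R).
  move=> sT; have := EZ_gt0 sT.
  by rewrite (EFin_expect (sqint_rint (claim_sqint (fun j => j == s)))) lte_fin.
elim: t => // -[_ _|t IH tT].
  (* [D >= 1] makes [ez 0] vanish, which starts a sum of positive increments. *)
  rewrite expected_claims_rec (_ : ez 0 = 0) ?add0r ?h //.
  rewrite -[RHS](expect_cst P); apply: eq_Rintegral => w _.
  have /andP[d1 _] := D_range w i11 (leqnn 1).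
  by rewrite leqNgt d1 mulr0.
rewrite expected_claims_rec addr_gt0 ?h //; apply: IH.
by rewrite /= ltnW //; case/andP: tT.
Qed.

Lemma C_measurable i t (a : R) : (1 <= i <= T)%N -> 0 <= a ->
  measurable_fun setT (C M D Z a i t).
Proof. exact: (row_random_sum_measurable (claim_measurable (fun j => j <= t)%N)). Qed.

(** One null set serves all [i] and [t], so that limits of sums, ratios and products can afterwards
    be taken pathwise. *)
Lemma C_lln : {ae P, forall w, forall i t, (1 <= i <= T)%N ->
  C M D Z a i t w / a @[a --> +oo] --> lam i * ez t}.
Proof.
apply/ae_foralln => i; apply/ae_foralln => t.
have [iT|iT] := boolP (1 <= i <= T)%N; last by apply/aeW.
have := row_random_sum_lln (claim_measurable (fun j => j <= t)%N) iT
  (claim_sqint (fun j => j <= t)%N).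
by apply: filterS => w h _; exact: h.
Qed.

Lemma sum_C_cvg w t n : (n <= T)%N ->
  (forall i t, (1 <= i <= T)%N -> C M D Z a i t w / a @[a --> +oo] --> lam i * ez t) ->
  (\sum_(1 <= i < n.+1) C M D Z a i t w) / a @[a --> +oo] --> (\sum_(1 <= i < n.+1) lam i) * ez t.
Proof.
move=> nT h; rewrite mulr_suml; under eq_fun do rewrite mulr_suml big_nat.
rewrite big_nat; apply: cvg_big => [x|i /andP[i1 i_n]]; first exact: add_continuous.
by apply: h; rewrite i1 (leq_trans _ nT).
Qed.

Let fhat (t : nat) (a : R) (w : Omega) :=
    (\sum_(1 <= i < (T - t).+1) C M D Z a i t.+1 w)
    / (\sum_(1 <= i < (T - t).+1) C M D Z a i t w).

Let ratio_cvg (x y : R -> R) (l m : R) : m != 0 ->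
  x a / a @[a --> +oo] --> l -> y a / a @[a --> +oo] --> m ->
  x a / y a @[a --> +oo] --> l / m.
Proof.
move=> m0 xl ym; have := cvgM xl (cvgV m0 ym) => h; apply: cvg_trans (h _ _).
apply: near_eq_cvg; near=> a.
have a0 : a != 0 by apply: lt0r_neq0; near: a; exact: nbhs_pinfty_gt.
rewrite -[LHS]/(x a / a * (y a / a)^-1) invfM invrK.
by rewrite (mulrC _ a) mulrA divfK.
Unshelve. all: by end_near. Qed.

Lemma fhat_cvg w t : (1 <= t < T)%N ->
  (forall i t, (1 <= i <= T)%N -> C M D Z a i t w / a @[a --> +oo] --> lam i * ez t) ->
  fhat t a w @[a --> +oo] --> ez t.+1 / ez t.
Proof.
move=> /andP[t1 tT] h.
have Tt : (T - t <= T)%N by rewrite leq_subr.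
have L0 : 0 < \sum_(1 <= i < (T - t).+1) lam i.
  rewrite big_nat_recl ?subn_gt0 // ltr_pwDl //; first by apply: lam_gt0; rewrite i11.
  rewrite big_nat sumr_ge0 // => i /andP[i1 iT].
  by apply/ltW/lam_gt0; rewrite /=; lia.
have e0 : 0 < ez t by apply: expected_claims_gt0; rewrite t1 ltnW.
have -> : ez t.+1 / ez t = ((\sum_(1 <= i < (T - t).+1) lam i) * ez t.+1) /
   ((\sum_(1 <= i < (T - t).+1) lam i) * ez t).
  by field; rewrite !lt0r_neq0.
apply: ratio_cvg; [by rewrite lt0r_neq0 ?mulr_gt0|exact: sum_C_cvg|exact: sum_C_cvg].
Qed.

Lemma development_factor_consistent t : (1 <= t < T)%N ->
  {ae P, forall w, fhat t a w @[a --> +oo] --> ez t.+1 / ez t}.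
Proof. by move=> tT; apply: filterS C_lln => w; exact: fhat_cvg. Qed.

(** The limits [ez (t+1) / ez t] telescope to [ez T / ez (T - i + 1)], the inverse of the limit of
    [C_{i,T-i+1} / C_{i,T}]. *)
Lemma chain_ladder_consistent i : (2 <= i <= T)%N ->
  {ae P, forall w, (C M D Z a i (T - i + 1) w * (\prod_(T - i + 1 <= t < T) fhat t a w)
          / C M D Z a i T w) @[a --> +oo] --> (1 : R)}.
Proof.
move=> /andP[i2 iT]; apply: filterS C_lln => w h.
have iT' : (1 <= i <= T)%N by rewrite iT ltnW.
have m1 : (1 <= T - i + 1 <= T)%N by lia.
have mT : (T - i + 1 <= T)%N by case/andP: m1.
have hp : \prod_(T - i + 1 <= t < T) fhat t a w @[a --> +oo] --> ez T / ez (T - i + 1).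
  rewrite -telescope_ratio //; last first.
    by move=> t tT; apply/lt0r_neq0/expected_claims_gt0; lia.
  under eq_fun do rewrite big_nat.
  rewrite big_nat; apply: cvg_big => [x|t tT]; first exact: mul_continuous.
  by apply: fhat_cvg => //; lia.
have eT : 0 < ez T by apply: expected_claims_gt0; rewrite leqnn ltnW.
have em : 0 < ez (T - i + 1) by exact: expected_claims_gt0.
have li := lam_gt0 iT'.
rewrite [X in _ --> X](_ : 1 = (lam i * ez (T - i + 1)) * (ez T / ez (T - i + 1)) / (lam i * ez T) :> R); last first.
  by field; rewrite !lt0r_neq0.
apply: ratio_cvg; [by rewrite lt0r_neq0 ?mulr_gt0| |exact: h].
under eq_fun do rewrite mulrAC.
by apply: cvgM => //; exact: h.
Qed.

(** * Part (iii) along one sequence [s] of exposures *)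

Section variance_estimator.
Variables (t : nat) (s : nat -> R).
Hypothesis tT : (1 <= t <= T - 2)%N.
Hypothesis s_ge1 : forall j, 1 <= s j.
Hypothesis s_oo : s j @[j --> \oo] --> +oo.

Let f := ez t.+1 / ez t.
Let e2 (b : nat -> bool) := \int[P]_w (Z 1 1 w ^+ 2 * (b (D 1 1 w))%:R).
Let v := e2 (fun j => j == t.+1) + (f - 1) ^+ 2 * e2 (fun j => (j <= t)%N).
Let g (z : nat * R) := z.2 * (z.1 <= t.+1)%N%:R - f * (z.2 * (z.1 <= t)%N%:R).
(* [S i n] is [C_{i,t+1} - f C_{i,t}] for a count [n] in place of [M_i]. *)
Let S i n w := \sum_(1 <= k < n.+1) g (D i k w, Z i k w).
(** The deterministic stand-in for the count [M i (s j)], with the same limit [lam i] after division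
    by [s j]. *)
Let n i j := Num.truncn (lam i * s j).
Let nu := (T - t - 1)%N.

Let nuE : (T - t)%N = nu.+1. Proof. by rewrite /nu; lia. Qed.
Let nu_gt0 : (0 < nu)%N. Proof. by rewrite /nu; lia. Qed.
Let row_range i : (1 <= i <= nu.+1)%N -> (1 <= i <= T)%N. Proof. by rewrite /nu; lia. Qed.
Let s_gt0 j : 0 < s j. Proof. exact: lt_le_trans (s_ge1 j). Qed.
Let p_gt0 : 0 < ez t. Proof. by apply: expected_claims_gt0; lia. Qed.

Let g_measurable : measurable_fun setT g.
Proof.
apply: measurable_funB; first exact: (claim_measurable (fun j => j <= t.+1)%N).
by apply: measurable_funM => //; exact: (claim_measurable (fun j => j <= t)%N).
Qed.

Let g_sqint : sqint P (fun w => g (D 1 1 w, Z 1 1 w)).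
Proof.
have := sqintD (claim_sqint (fun j => j <= t.+1)%N) (sqintZ (- f) (claim_sqint (fun j => j <= t)%N)).
by congr sqint; apply/funext => w; rewrite mulNr.
Qed.

Let g_mean : \int[P]_w g (D 1 1 w, Z 1 1 w) = 0.
Proof.
have i1 := sqint_rint (claim_sqint (fun j => j <= t.+1)%N).
have i2 := sqint_rint (claim_sqint (fun j => j <= t)%N).
rewrite expectB //; last exact: rintZ.
rewrite expectZ // -/(ez t) -/(ez t.+1) /f divfK ?subrr //.
exact: lt0r_neq0.
Qed.

Let rint_sqr_claim (b : nat -> bool) : rint (fun w => Z 1 1 w ^+ 2 * (b (D 1 1 w))%:R).
Proof.
have [_] := claim_sqint b; congr (P.-integrable _ _); apply/funext => w /=; congr EFin.
by case: (b _); rewrite ?mulr1 ?mulr0 ?expr0n.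
Qed.

(** [g] equals [Z] when [D = t+1], [(1 - f) Z] when [D <= t] and 0 otherwise, so no cross term
    arises. *)
Let g_var : \int[P]_w (g (D 1 1 w, Z 1 1 w) ^+ 2) = v.
Proof.
have i1 := rint_sqr_claim (fun j => j == t.+1); have i2 := rint_sqr_claim (fun j => j <= t)%N.
have i3 := rintZ ((f - 1) ^+ 2) i2.
rewrite /v /e2 -(expectZ _ i2) -(expectD i1 i3).
apply: eq_Rintegral => w _; rewrite /g /=.
case: (ltngtP (D 1 1 w) t.+1) => [h|h|->].
- by rewrite -ltnS h /=; ring.
- by rewrite (leqNgt (D _ _ _) t) (ltn_trans (ltnSn t) h) /=; ring.
by rewrite ltnn /=; ring.
Qed.

(** From [0 <= E (X - m)^2] with [X = Z I{D = t+1}]: its second moment is at least the square of its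
    mean, which is positive. *)
Let v_gt0 : 0 < v.
Proof.
apply: ltr_pwDl; last first.
  rewrite mulr_ge0 ?sqr_ge0 //; apply: Rintegral_ge0 => w _.
  by rewrite mulr_ge0 ?sqr_ge0 // ler0n.
pose X w := Z 1 1 w * (D 1 1 w == t.+1)%:R.
have sX : sqint P X := claim_sqint (fun j => j == t.+1).
have m0 : 0 < \int[P]_w X w.
  have tT' : (1 <= t.+1 <= T)%N by lia.
  by have := EZ_gt0 tT'; rewrite (EFin_expect (sqint_rint sX)) lte_fin.
set m := \int[P]_w X w in m0.
have -> : e2 (fun j => j == t.+1) = \int[P]_w (X w ^+ 2).
  apply: eq_Rintegral => w _; rewrite /X; case: (_ == _); first by rewrite !mulr1.
  by rewrite !mulr0 expr0n.
have : 0 <= \int[P]_w (X w ^+ 2 - (2 * m * X w - m ^+ 2)).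
  apply: Rintegral_ge0 => w _; rewrite (_ : _ - _ = (X w - m) ^+ 2) ?sqr_ge0 //; ring.
have [_ iX2] := sX; have iX := sqint_rint sX.
rewrite expectB //; last by apply: rintB; [exact: rintZ|exact: rint_cst].
rewrite expectB; [|exact: rintZ|exact: rint_cst].
rewrite expectZ // expect_cst -/m subr_ge0.
apply: lt_le_trans; rewrite (_ : _ - _ = m ^+ 2); first exact: exprn_gt0.
ring.
Qed.

Let n_cvg i : (1 <= i <= T)%N -> (n i j)%:R / s j @[j --> \oo] --> lam i.
Proof.
move=> iT; have l0 := lam_gt0 iT.
have sV : (s j)^-1 @[j --> \oo] --> 0.
  by apply/gtr0_cvgV0 => //; apply: nearW.
have sl : lam i - (s j)^-1 @[j --> \oo] --> lam i.
  by rewrite -[X in _ --> X](subr0); apply: cvgB => //; exact: cvg_cst.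
apply: (squeeze_cvgr _ sl (cvg_cst _)); apply: nearW => j.
have /truncn_itv/andP[h1 h2] : 0 <= lam i * s j by rewrite mulr_ge0 // ltW.
rewrite ler_pdivrMr // h1 andbT ler_pdivlMr // mulrBl mulVf ?lt0r_neq0 // lerBlDr.
by rewrite natr1 ltW.
Qed.

Let n_oo i : (1 <= i <= T)%N -> n i j @[j --> \oo] --> \oo.
Proof.
move=> iT; have l0 := lam_gt0 iT.
apply/cvgnyPge => N; move/cvgryPge : s_oo => /(_ (N%:R / lam i)); apply: filterS => j h.
rewrite /n truncn_ge_nat; first by rewrite mulrC -ler_pdivrMr.
by rewrite mulr_ge0 // ltW.
Qed.

Let S_ind (m : nat -> nat) :
  mutually_independent P [set i | (1 <= i <= nu.+1)%N] (fun i => sigma_of (S i (m i))).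
Proof.
have nuT : (nu.+1 <= T)%N by rewrite /nu; lia.
exact: (row_sums_independent g_measurable (n := m) nuT).
Qed.

Let S_meas i k : (1 <= i <= nu.+1)%N -> measurable_fun setT (S i k).
Proof. by move=> /row_range iT; exact: row_sum_measurable. Qed.

Let iid_meas i : (1 <= i <= T)%N -> forall k, (1 <= k)%N ->
  measurable_fun setT (fun w => g (D i k w, Z i k w)).
Proof. by move=> iT k k1; exact: (row_measurable g_measurable). Qed.

Let iid_law i : (1 <= i <= T)%N -> forall k, (1 <= k)%N -> forall B : set R, measurable B ->
  P ((fun w => g (D i k w, Z i k w)) @^-1` B) = P ((fun w => g (D i 1 w, Z i 1 w)) @^-1` B).
Proof. by move=> iT k k1 B mB; exact: (row_law_iid g_measurable). Qed.

Let iid_mean i : (1 <= i <= T)%N -> \int[P]_w g (D i 1 w, Z i 1 w) = 0.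
Proof. by move=> iT; rewrite (row_expect g_measurable (h := fun x => x) iT). Qed.

Let iid_var i : (1 <= i <= T)%N -> \int[P]_w (g (D i 1 w, Z i 1 w) ^+ 2) = v.
Proof. by move=> iT; rewrite (row_expect g_measurable (h := fun x => x ^+ 2) iT). Qed.

Let S_clt i (th e : R) : (1 <= i <= nu.+1)%N -> 0 < e ->
  \forall k \near \oo, forall a m : R, 0 <= a <= th ->
    `|\int[P]_w heat a 0 (S i k w / Num.sqrt (k%:R * v) + m) - heat a 1 m| <= e.
Proof.
move=> /row_range iT e0.
exact: (iid_clt (iid_meas iT) (row_independent g_measurable iT) (iid_law iT)
  (row_sqint g_measurable iT g_sqint) th (iid_mean iT) (iid_var iT) v_gt0 e0).
Qed.

Let X i j w := S i (M i (s j) w) w / Num.sqrt (s j).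
Let Y i j w := S i (n i j) w / Num.sqrt (s j).

Let M_measurable i j : (1 <= i <= T)%N -> measurable_fun setT (M i (s j)).
Proof. by move=> iT; apply: mM => //; exact: ltW. Qed.

Let M_cvg i : (1 <= i <= T)%N -> {ae P, forall w, (M i (s j) w)%:R / s j @[j --> \oo] --> lam i}.
Proof. by move=> iT; apply: filterS (M_lam iT) => w; exact: cvg_comp. Qed.

Let XY_small i : (1 <= i <= nu.+1)%N -> small P (fun j w => X i j w - Y i j w).
Proof.
move=> /row_range iT.
have h := random_sum_small (iid_meas iT) (row_independent g_measurable iT) (iid_law iT)
  (row_sqint g_measurable iT g_sqint) (iid_mean iT) s_gt0 (fun j => M_measurable j iT)
  (fun j m n m1 => row_count_independent g_measurable n iT (ltW (s_gt0 j)) m1)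
  (M_cvg iT) (n_cvg iT).
apply: small_ext h; apply: whp_near; apply: nearW => j w.
by rewrite /X /Y -mulrBl.
Qed.

Let Y_tight i : (1 <= i <= nu.+1)%N -> tight P (Y i).
Proof.
move=> /row_range iT.
exact: (partial_sum_tight (iid_meas iT) (row_independent g_measurable iT) (iid_law iT)
  (row_sqint g_measurable iT g_sqint) (iid_mean iT) s_gt0 (n_cvg iT)).
Qed.

Let C_cvg : {ae P, forall w, forall i t, (1 <= i <= T)%N ->
  C M D Z (s j) i t w / s j @[j --> \oo] --> lam i * ez t}.
Proof.
apply: filterS C_lln => w h i t' iT.
by apply: (cvg_comp s (fun a => C M D Z a i t' w / a)) s_oo _; exact: h.
Qed.

Let A_small (V : nat -> Omega -> R) (l : R) : 0 < l -> (forall j, measurable_fun setT (V j)) ->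
  {ae P, forall w, V j w / s j @[j --> \oo] --> l} -> small P (fun j w => s j / V j w - l^-1).
Proof.
move=> l0 mV hV; apply: (small_ae_cvg (X := fun j w => s j / V j w)).
  move=> j; apply: measurable_funM => //; exact: measurable_fun_invr.
apply: filterS hV => w h.
have -> : (fun j => s j / V j w) = (fun j => (V j w / s j)^-1).
  by apply/funext => j; rewrite invfM invrK mulrC.
by apply: cvgV => //; exact: lt0r_neq0.
Qed.

Let L := \sum_(1 <= i < nu.+2) lam i.
Let VS j w := \sum_(1 <= i < nu.+2) C M D Z (s j) i t w.
Let tot j := (\sum_(1 <= l < nu.+2) n l j)%N.

Let L_gt0 : 0 < L.
Proof.
rewrite /L big_nat_recl // ltr_pwDl //; first by apply/lam_gt0/row_range.
rewrite big_nat sumr_ge0 // => i /andP[i1 iT].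
by apply/ltW/lam_gt0/row_range.
Qed.

Let C_small i : (1 <= i <= nu.+1)%N ->
  small P (fun j w => s j / C M D Z (s j) i t w - (lam i * ez t)^-1).
Proof.
move=> /row_range iT; apply: A_small; first by rewrite mulr_gt0 // lam_gt0.
  by move=> j; apply: C_measurable => //; exact: ltW.
by apply: filterS C_cvg => w; exact.
Qed.

Let VS_measurable j t' :
  measurable_fun setT (fun w => \sum_(1 <= i < nu.+2) C M D Z (s j) i t' w).
Proof.
apply: measurable_fun_sum_nat => i iN; apply: C_measurable; last exact: ltW.
exact: row_range.
Qed.

Let VS_small : small P (fun j w => s j / VS j w - (L * ez t)^-1).
Proof.
apply: A_small; [by rewrite mulr_gt0|by move=> j; exact: VS_measurable|].
apply: filterS C_cvg => w h; rewrite /L mulr_suml big_nat.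
under eq_fun do rewrite /VS mulr_suml big_nat.
apply: cvg_big => [x|i iN]; first exact: add_continuous.
by apply: h; exact: row_range.
Qed.

Let n_small i : (1 <= i <= nu.+1)%N ->
  small P (fun j w => s j / ((n i j)%:R * ez t) - (lam i * ez t)^-1).
Proof.
move=> /row_range iT; apply: (small_cvg P (x := fun j => s j / ((n i j)%:R * ez t))).
have -> : (fun j => s j / ((n i j)%:R * ez t)) = (fun j => ((n i j)%:R / s j * ez t)^-1).
  by apply/funext => j; rewrite !invfM invrK mulrA (mulrC (s j)).
apply: cvgV; first by rewrite lt0r_neq0 // mulr_gt0 // lam_gt0.
by apply: cvgMl; exact: n_cvg.
Qed.

Let tot_small : small P (fun j w => s j / ((tot j)%:R * ez t) - (L * ez t)^-1).
Proof.
apply: (small_cvg P (x := fun j => s j / ((tot j)%:R * ez t))).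
have -> : (fun j => s j / ((tot j)%:R * ez t)) = (fun j => ((tot j)%:R / s j * ez t)^-1).
  by apply/funext => j; rewrite !invfM invrK mulrA (mulrC (s j)).
apply: cvgV; first by rewrite lt0r_neq0 // mulr_gt0.
apply: cvgMl; rewrite /L big_nat.
under eq_fun do rewrite /tot natr_sum mulr_suml big_nat.
apply: cvg_big => [x|i iN]; first exact: add_continuous.
by apply: n_cvg; exact: row_range.
Qed.

Let W i j w := S i (n i j) w / Num.sqrt ((n i j)%:R * v).
Let u i j : R := Num.sqrt ((n i j)%:R / (tot j)%:R).
Let Q j w := \sum_(1 <= i < nu.+2) W i j w ^+ 2 - (\sum_(1 <= i < nu.+2) u i j * W i j w) ^+ 2.
Let c := v / (ez t * nu%:R).
Let est j w := (nu%:R)^-1 * \sum_(1 <= i < (T - t).+1)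
  C M D Z (s j) i t w * (C M D Z (s j) i t.+1 w / C M D Z (s j) i t w - fhat t (s j) w) ^+ 2.

(** Equality holds only with high probability: the algebra divides by the [C_{i,t}] and by their
    sum, which may vanish. *)
Let est_quadratic : whp P (fun j w => (nu%:R)^-1 *
  (\sum_(1 <= i < nu.+2) X i j w ^+ 2 * (s j / C M D Z (s j) i t w)
   - (\sum_(1 <= i < nu.+2) X i j w) ^+ 2 * (s j / VS j w)) = est j w).
Proof.
(* If [V = 0] then [s / V = 0], at distance [l > l/2] from the limit. *)
have nz (V : nat -> Omega -> R) (l : R) : 0 < l ->
    small P (fun j w => s j / V j w - l) -> whp P (fun j w => V j w != 0).
  move=> l0 hV; have l20 : 0 < l / 2 by rewrite divr_gt0.
  apply: whp_impl (hV _ l20); apply: nearW => j w; apply: contraTneq => ->.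
  by rewrite invr0 mulr0 sub0r normrN gtr0_norm // -ltNge ltr_pdivrMr // mulr2n mulrDr mulr1 ltrDl.
have h1 : whp P (fun j w => forall i, (1 <= i < nu.+2)%N -> C M D Z (s j) i t w != 0).
  apply: whp_forall_nat => i iN; apply: nz (C_small iN).
  by rewrite invr_gt0 mulr_gt0 // lam_gt0 //; exact: row_range.
have h2 : whp P (fun j w => VS j w != 0).
  by apply: nz VS_small; rewrite invr_gt0 mulr_gt0.
apply: whp_impl (whp_and h1 h2); apply: nearW => j w [C0 V0].
have XE i : X i j w = (C M D Z (s j) i t.+1 w - f * C M D Z (s j) i t w) / Num.sqrt (s j).
  by rewrite /X /S /g sumrB -mulr_sumr.
have ss : Num.sqrt (s j) ^+ 2 = s j by rewrite sqr_sqrtr // ltW.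
rewrite /est /fhat nuE (sum_sqr_deviation _ f C0 V0); congr (_ * (_ - _)).
  apply: eq_big_nat => i /C0 Ci; rewrite XE expr_div_n ss.
  by rewrite mulrA divfK // lt0r_neq0.
under eq_bigr do rewrite XE.
by rewrite -mulr_suml expr_div_n ss mulrA divfK // lt0r_neq0.
Qed.

(** Once all counts [n i j] are positive the normalisations cancel exactly, and only the factor [c],
    which is [sigma2 / nu], survives. *)
Let ideal_quadratic : \forall j \near \oo, forall w, (nu%:R)^-1 *
  (\sum_(1 <= i < nu.+2) Y i j w ^+ 2 * (s j / ((n i j)%:R * ez t))
   - (\sum_(1 <= i < nu.+2) Y i j w) ^+ 2 * (s j / ((tot j)%:R * ez t))) = c * Q j w.
Proof.
have : \forall j \near \oo, forall i : 'I_nu.+2, (1 <= i <= nu.+1)%N -> (0 < n i j)%N.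
  apply: filter_forall => i; have [iN|iN] := boolP (1 <= i <= nu.+1)%N.
    have h : \forall j \near \oo, (0 < n i j)%N by exact: (n_oo (row_range iN) (nbhs_infty_gt 0)).
    by apply: filterS h.
  by apply: nearW => j.
apply: filterS => j n0 w.
have n1 i : (1 <= i <= nu.+1)%N -> 0 < (n i j)%:R :> R.
  by move=> iN; rewrite ltr0n; have /andP[_ i2] := iN; apply: (n0 (Ordinal (i2 : (i < nu.+2)%N))).
have tot0 : 0 < (tot j)%:R :> R.
  rewrite /tot natr_sum big_nat_recl // ltr_pwDl //; first exact: n1.
  by apply: sumr_ge0 => i _; exact: ler0n.
have ss : Num.sqrt (s j) ^+ 2 = s j by rewrite sqr_sqrtr // ltW.
have nu0 : nu%:R != 0 :> R by rewrite pnatr_eq0 -lt0n.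
have WE i : (1 <= i <= nu.+1)%N -> W i j w ^+ 2 = S i (n i j) w ^+ 2 / ((n i j)%:R * v).
  by move=> /n1 ni; rewrite /W expr_div_n sqr_sqrtr // mulr_ge0 // ltW.
have uWE : \sum_(1 <= i < nu.+2) u i j * W i j w =
    (\sum_(1 <= i < nu.+2) S i (n i j) w) / Num.sqrt ((tot j)%:R * v).
  rewrite mulr_suml; apply: eq_big_nat => i /n1 ni.
  have sn0 : Num.sqrt ((n i j)%:R) != 0 :> R by rewrite gt_eqF // sqrtr_gt0.
  have sv0 : Num.sqrt v != 0 by rewrite gt_eqF // sqrtr_gt0.
  have st0 : Num.sqrt ((tot j)%:R) != 0 :> R by rewrite gt_eqF // sqrtr_gt0.
  rewrite /u /W !sqrtrM ?ler0n // sqrtrV ?ler0n //; field.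
  by rewrite sn0 sv0 st0.
rewrite /Q uWE expr_div_n [in RHS]sqr_sqrtr; last by rewrite mulr_ge0 // ltW.
have -> : \sum_(1 <= i < nu.+2) Y i j w ^+ 2 * (s j / ((n i j)%:R * ez t)) =
   (v / ez t) * \sum_(1 <= i < nu.+2) W i j w ^+ 2.
  rewrite mulr_sumr; apply: eq_big_nat => i iN; rewrite WE // /Y expr_div_n ss.
  by field; rewrite !lt0r_neq0 //; exact: n1.
have -> : \sum_(1 <= i < nu.+2) Y i j w = (\sum_(1 <= i < nu.+2) S i (n i j) w) / Num.sqrt (s j).
  by rewrite mulr_suml.
rewrite expr_div_n ss /c; field.
by rewrite nu0 !lt0r_neq0.
Qed.

Let est_small : small P (fun j w => est j w - c * Q j w).
Proof.
have h := tightM_small (tight_cst P (nu%:R)^-1) (small_quadratic (m := 1) (n := nu.+2)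
  (a := fun i => (lam i * ez t)^-1)
  (fun i iN => And4 (XY_small iN) (Y_tight iN) (C_small iN) (n_small iN)) VS_small tot_small).
apply: small_ext h; apply: whp_impl (whp_and est_quadratic (whp_near P ideal_quadratic)).
by apply: nearW => j w [<- <-]; rewrite mulrBr.
Qed.

Let est_measurable j : measurable_fun setT (est j).
Proof.
apply: measurable_funM => //; apply: measurable_fun_sum_nat => i; rewrite nuE => iN.
have mC t' : measurable_fun setT (C M D Z (s j) i t').
  by apply: C_measurable; [exact: row_range|exact: ltW].
apply: measurable_funM => //; apply: measurable_funX; apply: measurable_funB.
  by apply: measurable_funM => //; exact: measurable_fun_invr.
rewrite /fhat nuE; apply: measurable_funM; first exact: VS_measurable.
by apply: measurable_fun_invr; exact: VS_measurable.
Qed.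

Let Q_measurable j : measurable_fun setT (Q j).
Proof.
have mW i : (1 <= i <= nu.+1)%N -> measurable_fun setT (W i j).
  by move=> iN; apply: measurable_funM => //; exact: S_meas.
apply: measurable_funB.
  by apply: measurable_fun_sum_nat => i iN; apply: measurable_funX; exact: mW.
apply: measurable_funX; apply: measurable_fun_sum_nat => i iN.
by apply: measurable_funM => //; exact: mW.
Qed.

Let sigma2 := (f - 1) *
  (e2 (fun j => j == t.+1) / (\int[P]_w (Z 1 1 w * (D 1 1 w == t.+1)%:R))
   + (f - 1) * (e2 (fun j => (j <= t)%N) / ez t)).

(** [(f - 1) ez t = E[Z I{D = t+1}]] cancels the first denominator in [sigma2]. *)
Let sigma2E : sigma2 = v / ez t.
Proof.
have E0 : 0 < \int[P]_w (Z 1 1 w * (D 1 1 w == t.+1)%:R).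
  have tT' : (1 <= t.+1 <= T)%N by lia.
  have := EZ_gt0 tT'.
  by rewrite (EFin_expect (sqint_rint (claim_sqint (fun j => j == t.+1)))) lte_fin.
rewrite /sigma2 /v /f expected_claims_rec; field.
by rewrite !lt0r_neq0.
Qed.

Lemma variance_estimator_cvg (x : R) :
  {for x, continuous (fun x : R => chisq_prob nu [set y | sigma2 * y / nu%:R <= x])} ->
  fine (P [set w | est j w <= x]) @[j --> \oo] -->
    chisq_prob nu [set y | sigma2 * y / nu%:R <= x].
Proof.
have nu0 : 0 < nu%:R :> R by rewrite ltr0n.
have c0 : 0 < c by rewrite divr_gt0 // mulr_gt0.
have E (b : R) : [set y | sigma2 * y / nu%:R <= b] = [set y | y <= b / c].
  have cE y : sigma2 * y / nu%:R = y * c.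
    by rewrite sigma2E /c; field; rewrite !lt0r_neq0.
  by apply/seteqP; split => y /=; rewrite cE ler_pdivlMr.
rewrite (_ : (fun x : R => chisq_prob nu [set y | sigma2 * y / nu%:R <= x]) =
  (fun x : R => chisq_prob nu [set y | y <= x / c])); last by apply/funext => b; rewrite E.
rewrite E.
apply: (slutsky_cdf (G := fun b => chisq_prob nu [set y | y <= b]) c0 Q_measurable
  est_measurable est_small).
exact: (studentised_rows_sandwich nu_gt0 S_meas (@S_ind) S_clt
  (fun i iN => n_oo (row_range iN))).
Qed.

End variance_estimator.
End model.

Theorem theorem1 (d : measure_display) (Omega : measurableType d)
  (R : realType) (P : probability Omega R) (T : nat)
  (M : nat -> R -> Omega -> nat) (D : nat -> nat -> Omega -> nat)
  (Z : nat -> nat -> Omega -> R) :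
  (2 <= T)%N ->
  (* measurability of the random elements *)
  (forall i a, (1 <= i <= T)%N -> 0 <= a -> measurable_fun setT (M i a)) ->
  (forall i k, (1 <= i <= T)%N -> (1 <= k)%N ->
     measurable_fun setT (D i k) /\ measurable_fun setT (Z i k)) ->
  (* D_{i,k} takes values in {1,...,T} *)
  (forall i k w, (1 <= i <= T)%N -> (1 <= k)%N -> (1 <= D i k w <= T)%N) ->
  (* (GM1) i.i.d. within each i, with a common law not depending on i;
     the generic pair (D,Z) is (D_{1,1}, Z_{1,1}) *)
  (forall i, (1 <= i <= T)%N ->
     mutually_independent P [set k | (1 <= k)%N]
       (fun k => sigma_of (fun w => (D i k w, Z i k w)))) ->
  (forall i k, (1 <= i <= T)%N -> (1 <= k)%N ->
     forall A : set (nat * R), measurable A ->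
       P ((fun w => (D i k w, Z i k w)) @^-1` A) =
       P ((fun w => (D 1 1 w, Z 1 1 w)) @^-1` A)) ->
  (\int[P]_w ((Z 1 1 w) ^+ 2)%:E < +oo)%E ->
  (forall t, (1 <= t <= T)%N ->
     (0 < \int[P]_w (Z 1 1 w * ((D 1 1 w == t) : nat)%:R)%:E)%E) ->
  (* (GM2) *)
  (forall i, (1 <= i <= T)%N ->
     mutually_independent P setT
       (fun b : bool => if b then
          <<s \bigcup_(k in [set k | (1 <= k)%N])
                sigma_of (fun w => (D i k w, Z i k w)) >>
        else <<s \bigcup_(a in [set a : R | 0 <= a]) sigma_of (M i a) >>)) ->
  (* (GM3) *)
  mutually_independent P [set i | (1 <= i <= T)%N]
    (fun i => <<s (\bigcup_(a in [set a : R | 0 <= a]) sigma_of (M i a))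
                `|` (\bigcup_(k in [set k | (1 <= k)%N])
                       sigma_of (fun w => (D i k w, Z i k w))) >>) ->
  (* (GM4) *)
  (forall i, (1 <= i <= T)%N -> exists lam : R, 0 < lam /\
     {ae P, forall w, (M i a w)%:R / a @[a --> +oo] --> lam}) ->
  let EZ (g : nat -> bool) :=
    fine (\int[P]_w (Z 1 1 w * (g (D 1 1 w) : nat)%:R)%:E) in
  let EZ2 (g : nat -> bool) :=
    fine (\int[P]_w ((Z 1 1 w) ^+ 2 * (g (D 1 1 w) : nat)%:R)%:E) in
  let f (t : nat) := EZ (fun j => (j <= t.+1)%N) / EZ (fun j => (j <= t)%N) in
  let fhat (t : nat) (a : R) (w : Omega) :=
    (\sum_(1 <= i < (T - t).+1) C M D Z a i t.+1 w)
    / (\sum_(1 <= i < (T - t).+1) C M D Z a i t w) in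
  let sigma2 (t : nat) :=
    (f t - 1) * (EZ2 (fun j => j == t.+1) / EZ (fun j => j == t.+1)
       + (f t - 1) * (EZ2 (fun j => (j <= t)%N) / EZ (fun j => (j <= t)%N))) in
  let sigma2hat (t : nat) (a : R) (w : Omega) :=
    ((T - t - 1)%N%:R)^-1 *
    \sum_(1 <= i < (T - t).+1)
       C M D Z a i t w * (C M D Z a i t.+1 w / C M D Z a i t w - fhat t a w) ^+ 2 in
  (* (i) *)
  (forall t, (1 <= t <= T - 1)%N ->
     {ae P, forall w, fhat t a w @[a --> +oo] --> f t}) /\
  (* (ii) *)
  (forall i, (2 <= i <= T)%N ->
     {ae P, forall w,
        (C M D Z a i (T - i + 1) w * (\prod_(T - i + 1 <= t < T) fhat t a w)
          / C M D Z a i T w) @[a --> +oo] --> (1 : R)}) /\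
  (* (iii) *)
  (forall t, (1 <= t <= T - 2)%N ->
     cvg_in_distribution P (sigma2hat t)
       (fun x => chisq_prob (T - t - 1)
                   [set y | sigma2 t * y / (T - t - 1)%N%:R <= x])).
Proof.
move=> T2 mM mDZ D_range DZ_ind DZ_law Z_sqr EZ_gt0 M_DZ_ind rows_ind M_lam.
(* Turns the existential of (GM4) into a function of [i], with default 0 outside [1..T]. *)
have /choice[lam lamP] i : exists l : R, (1 <= i <= T)%N ->
    0 < l /\ {ae P, forall w, (M i a w)%:R / a @[a --> +oo] --> l}.
  have [iT|iT] := boolP (1 <= i <= T)%N; last by exists 0.
  by have [l lP] := M_lam i iT; exists l.
have lam_gt0 i : (1 <= i <= T)%N -> 0 < lam i by move=> /lamP[].
have lam_cvg i : (1 <= i <= T)%N ->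
    {ae P, forall w, (M i a w)%:R / a @[a --> +oo] --> lam i} by move=> /lamP[].
move=> EZ EZ2 f fhat sigma2 sigma2hat; split; [|split].
- move=> t tT; have tT' : (1 <= t < T)%N by lia.
  exact: (development_factor_consistent T2 mDZ D_range DZ_ind DZ_law Z_sqr
    EZ_gt0 lam_gt0 lam_cvg tT').
- move=> i iT.
  exact: (chain_ladder_consistent T2 mDZ D_range DZ_ind DZ_law Z_sqr
    EZ_gt0 lam_gt0 lam_cvg iT).
(* Convergence as [a] tends to infinity is tested along arbitrary sequences [u]; replacing [u j] by
   its maximum with 1 changes finitely many terms and makes every exposure positive. *)
move=> t tT x Fx; apply/cvg_pinftyP => u u_oo.
pose s j := Num.max (u j) 1.
have s_ge1 j : 1 <= s j by rewrite le_max lexx orbT.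
have us : \forall j \near \oo, s j = u j.
  move/cvgryPge : u_oo => /(_ 1); apply: filterS => j uj.
  by rewrite /s max_l.
have s_oo : s j @[j --> \oo] --> +oo.
  by apply: cvg_trans u_oo; apply: near_eq_cvg; apply: filterS us => j ->.
have := variance_estimator_cvg T2 mM mDZ D_range DZ_ind DZ_law Z_sqr EZ_gt0
    M_DZ_ind rows_ind lam_gt0 lam_cvg tT s_ge1 s_oo Fx.
apply: cvg_trans; apply: near_eq_cvg; apply: filterS us => j sj.
by rewrite sj.
Qed.
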